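(* Let $\mathbb{D}=\{z\in\mathbb{C}:|z|<1\}$ and let $f=h+\overline{g}$ be a sense-preserving univalent harmonic mapping of $\mathbb{D}$ with $h(z)=z+\sum_{n=2}^\infty a_nz^n$ and $g(z)=\sum_{n=2}^\infty b_nz^n$ (so $f\in\mathcal{S}^0_H$), which is stable convex, i.e. $h+\mu\overline{g}$ is univalent and convex in $\mathbb{D}$ for every $|\mu|=1$. Let $m,q\in\mathbb{N}$, $\omega_m\in\mathcal{B}_m$ and $\omega_q\in\mathcal{B}_q$. Then for $s,p\in\mathbb{N}$, $$|Df(\omega_m(z))|^s+|f(\omega_q(z))|^p\le1\quad\text{and}\quad|\mathscr{D}f(\omega_m(z))|^s+|f(\omega_q(z))|^p\le1$$ for $|z|=r\le r_{4,s,m,p,q}$, where $r_{4,s,m,p,q}$ is the unique root in $(0,1)$ of $$\frac{r^{sm}}{(1-r^m)^{2s}}+\left(\frac{r^q}{1-r^q}\right)^p-1=0.$$ The radius $r_{4,s,m,p,q}$ is best possible.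
   Context: For $n\in\mathbb{N}$, $\mathcal{B}_n$ denotes the set of analytic functions $\omega:\mathbb{D}\to\mathbb{C}$ with $|\omega(z)|\le1$ in $\mathbb{D}$, $\omega(0)=\omega'(0)=\cdots=\omega^{(n-1)}(0)=0$ and $\omega^{(n)}(0)\neq0$. For a harmonic $f$, $Df=zf_z-\overline{z}f_{\overline{z}}$ and $\mathscr{D}f=zf_z+\overline{z}f_{\overline{z}}$, and $Df(\omega_m(z))$ means $(Df)(\omega_m(z))$ (similarly for $\mathscr{D}$). ''Best possible'' means that for every $r>r_{4,s,m,p,q}$ there exist such $f,\omega_m,\omega_q$ and $z$ with $|z|=r$ for which the inequality fails. *)

(* Defs.v *)
From mathcomp Require Import all_boot all_order all_algebra.
From mathcomp Require Import all_classical all_reals all_analysis.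
From mathcomp Require Export complex.
Import Order.TTheory GRing.Theory Num.Theory.
Import numFieldNormedType.Exports.

Set Implicit Arguments.
Unset Strict Implicit.
Unset Printing Implicit Defensive.

Local Open Scope ring_scope.
Local Open Scope complex_scope.
Local Open Scope classical_set_scope.

(* The complex numbers over a real type R, seen as a numClosedFieldType so that
   MathComp-Analysis's normed-module structure (complex derivatives) applies. *)
Definition C (R : realType) : numClosedFieldType := R[i].

Definition disk (R : realType) : set (C R) := [set z | `|z| < 1].

Definition cderiv (R : realType) (f : C R -> C R) : C R -> C R := (f^`())%classic.
Definition cderivn (R : realType) (n : nat) (f : C R -> C R) : C R -> C R :=
  derive1n n f.

Definition holomorphic_on (R : realType) (f : C R -> C R) (A : set (C R)) :=
  forall z, A z -> derivable f z 1.

Definition univalent_on (R : realType) (F : C R -> C R) (A : set (C R)) :=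
  forall z w, A z -> A w -> F z = F w -> z = w.

Definition convex_set_C (R : realType) (S : set (C R)) :=
  forall a b, S a -> S b -> forall t : R, 0 <= t <= 1 ->
    S ((1 - t%:C) * a + t%:C * b).

Definition harm_mu (R : realType) (mu : C R) (h g : C R -> C R) : C R -> C R :=
  fun z => h z + mu * (g z)^*.
Definition harm (R : realType) (h g : C R -> C R) : C R -> C R := harm_mu 1 h g.

(* f = h + conj(g) is in S_H^0: h, g analytic in the disk, h(0)=0, h'(0)=1,
   g(0)=g'(0)=0, f univalent and sense-preserving (Jacobian |h'|^2-|g'|^2 > 0)
   in the disk. *)
Definition SH0 (R : realType) (h g : C R -> C R) :=
  [/\ holomorphic_on h (@disk R) /\ holomorphic_on g (@disk R),
      h 0 = 0 /\ cderiv h 0 = 1, g 0 = 0 /\ cderiv g 0 = 0,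
      univalent_on (harm h g) (@disk R) &
      forall z, disk z -> 0 < `|cderiv h z| ^+ 2 - `|cderiv g z| ^+ 2].

Definition stable_convex (R : realType) (h g : C R -> C R) :=
  forall mu : C R, `|mu| = 1 ->
    univalent_on (harm_mu mu h g) (@disk R) /\
    convex_set_C (harm_mu mu h g @` (@disk R)).

Definition Bclass (R : realType) (n : nat) (w : C R -> C R) :=
  [/\ holomorphic_on w (@disk R),
      (forall z, disk z -> `|w z| <= 1),
      (forall k, (k < n)%N -> cderivn k w 0 = 0) &
      cderivn n w 0 != 0].

(* For f = h + conj(g): f_z = h', f_{zbar} = conj(g'), hence
   Df = z f_z - zbar f_zbar = z h'(z) - conj(z g'(z)),
   Df~ = z f_z + zbar f_zbar = z h'(z) + conj(z g'(z)). *)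
Definition Dop (R : realType) (h g : C R -> C R) : C R -> C R :=
  fun z => z * cderiv h z - (z * cderiv g z)^*.
Definition Dscr (R : realType) (h g : C R -> C R) : C R -> C R :=
  fun z => z * cderiv h z + (z * cderiv g z)^*.

Definition rad_fun (R : realType) (s m p q : nat) (r : R) : R :=
  r ^+ (s * m) / (1 - r ^+ m) ^+ (2 * s) + (r ^+ q / (1 - r ^+ q)) ^+ p - 1.

(* Main.v *)
(* If h + mu conj(g) is univalent and convex for every |mu| = 1, then for every
   |lambda| = 1 the analytic function Phi = h + lambda g is univalent and convex:
   along a line of direction e^(i theta), Phi differs from h + mu conj(g), with
   mu = - e^(2 i theta) conj(lambda), by a real multiple of that direction, and
   Phi is monotone along the preimage of a segment under h + mu conj(g).  Convex
   analytic functions have Taylor coefficients of modulus at most 1, whence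
   |Phi(z)| <= |z|/(1-|z|) and |z Phi'(z)| <= |z|/(1-|z|)^2.  Choosing lambda to
   align the arguments bounds |h| + |g| and |z h'| + |z g'|, and the Schwarz lemma
   |omega(z)| <= |z|^n for omega in B_n finishes the upper bound.  The half-plane
   map h = z/(1-z), g = 0 with omega(z) = z^n is extremal.

   The Cauchy theory used along the way (maximum principle, Taylor expansion,
   differentiability of derivatives) avoids contour integrals: only primitives
   on a half-plane are needed. *)

Require Import Defs.
From mathcomp Require Import all_boot all_order all_algebra.
From mathcomp Require Import all_classical all_reals all_analysis.
From mathcomp Require Import complex cyclic separable cyclotomic ring lra.
Import Order.TTheory GRing.Theory Num.Theory.
Import numFieldNormedType.Exports.

Set Implicit Arguments.
Unset Strict Implicit.
Unset Printing Implicit Defensive.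

Local Open Scope ring_scope.
Local Open Scope complex_scope.

Local Notation "z ^*" := (conjc z) : ring_scope.

(** * Modulus and differentiability on the complex numbers *)

(** The hypotheses give complex differentiability point by point, without continuity of the
    derivative, so every analytic tool has to grow out of Goursat's theorem. A weak mean value
    property suffices for the maximum principle: on a small circle, the real part of [k * f] takes
    its central value at some point. The maximum principle in turn allows isolated points without
    differentiability, because it is applied to difference quotients before their behaviour at the
    exceptional points is known. This gives removability of singularities; dividing by [z] again and
    again then produces Taylor coefficients with the exact remainder [z ^+ n * phi n z], which the
    maximum principle estimates.

    Lifts of segments are only real differentiable, hence the Wirtinger calculus, in which |b| < |a|
    is the sense-preserving condition that makes a differential invertible.

    The distortion bound does not differentiate a series: a Lipschitz bound passes from the Taylor
    polynomials to the limit, and the derivative inherits it. *)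

Section ComplexModulus.
Variable R : realType.
Local Notation K := R[i].
Implicit Types (x y z w c : K) (f g : K -> K).

(* The projections are wrapped so that their type does not depend on the
   algebraic structure through which their argument was elaborated. *)
Definition re z : R := complex.Re z.
Definition im z : R := complex.Im z.
Definition abs z : R := ComplexField.Normc.normc z.

Lemma normCE (z : C R) : `|z| = (abs z)%:C.
Proof. by case: z. Qed.

Lemma abs0 : abs 0 = 0.
Proof. exact: ComplexField.Normc.normc0. Qed.

Lemma abs1 : abs 1 = 1.
Proof. exact: ComplexField.Normc.normc1. Qed.

Lemma abs_ge0 z : 0 <= abs z.
Proof. by case: z => a b; exact: sqrtr_ge0. Qed.

Lemma absM x y : abs (x * y) = abs x * abs y.
Proof. exact: ComplexField.Normc.normcM. Qed.

Lemma absV x : abs x^-1 = (abs x)^-1.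
Proof. exact: ComplexField.Normc.normcV. Qed.

Lemma absX x n : abs (x ^+ n) = abs x ^+ n.
Proof. by elim: n => [|n IH]; rewrite ?abs1 // !exprS absM IH. Qed.

Lemma abs_eq0 z : (abs z == 0) = (z == 0).
Proof.
apply/eqP/eqP => [/ComplexField.Normc.eq0_normc //|->]; exact: abs0.
Qed.

Lemma abs_gt0 z : (0 < abs z) = (z != 0).
Proof. by rewrite lt_def abs_eq0 abs_ge0 andbT. Qed.

Lemma absN z : abs (- z) = abs z.
Proof. exact: normcN. Qed.

Lemma absC x y : abs (x - y) = abs (y - x).
Proof. by rewrite -absN opprB. Qed.

Lemma absJ z : abs z^* = abs z.
Proof. by case: z => a b; rewrite /abs /= sqrrN. Qed.

Lemma absR (a : R) : abs a%:C = `|a|.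
Proof. by rewrite /abs /= expr0n addr0 sqrtr_sqr. Qed.

Lemma absD x y : abs (x + y) <= abs x + abs y.
Proof. exact: le_normcD. Qed.

Lemma absB x y : abs (x - y) <= abs x + abs y.
Proof. by rewrite -(absN y) absD. Qed.

Lemma abs_lerB x y : abs x - abs y <= abs (x - y).
Proof. by rewrite lerBlDr -{1}(subrK y x) absD. Qed.

Lemma abs_sum (I : Type) (r : seq I) (F : I -> K) :
  abs (\sum_(i <- r) F i) <= \sum_(i <- r) abs (F i).
Proof.
elim/big_ind2: _ => [|a b d e H1 H2|//]; first by rewrite abs0.
by apply: le_trans (absD _ _) _; exact: lerD.
Qed.

Lemma abs_sqr z : abs z ^+ 2 = re z ^+ 2 + im z ^+ 2.
Proof. by case: z => a b; rewrite /abs sqr_sqrtr // addr_ge0 ?sqr_ge0. Qed.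

Lemma mulcJ_abs z : z * z^* = (abs z ^+ 2)%:C.
Proof.
rewrite abs_sqr; case: z => a b; apply/eqP.
by rewrite eq_complex /=; apply/andP; split; apply/eqP; ring.
Qed.

Lemma re_le_abs z : `|re z| <= abs z.
Proof.
by case: z => a b; rewrite -sqrtr_sqr ler_wsqrtr //= lerDl sqr_ge0.
Qed.

Lemma im_le_abs z : `|im z| <= abs z.
Proof.
by case: z => a b; rewrite -sqrtr_sqr ler_wsqrtr //= lerDr sqr_ge0.
Qed.

Lemma abs_le_reim z : abs z <= `|re z| + `|im z|.
Proof.
rewrite -(@ler_pXn2r _ 2) ?nnegrE ?addr_ge0 ?abs_ge0 //.
rewrite abs_sqr -(real_normK (num_real (re z))) -(real_normK (num_real (im z))).
have := normr_ge0 (re z); have := normr_ge0 (im z); nra.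
Qed.

Lemma reD x y : re (x + y) = re x + re y.
Proof. by case: x; case: y. Qed.
Lemma imD x y : im (x + y) = im x + im y.
Proof. by case: x; case: y. Qed.
Lemma reB x y : re (x - y) = re x - re y.
Proof. by case: x; case: y. Qed.
Lemma imB x y : im (x - y) = im x - im y.
Proof. by case: x; case: y. Qed.
Lemma reM x y : re (x * y) = re x * re y - im x * im y.
Proof. by case: x; case: y. Qed.
Lemma imM x y : im (x * y) = re x * im y + im x * re y.
Proof. by case: x => a b; case: y => c d /=; ring. Qed.
Lemma reRM (a : R) x : re (a%:C * x) = a * re x.
Proof. by rewrite reM /= mul0r subr0. Qed.
Lemma imRM (a : R) x : im (a%:C * x) = a * im x.
Proof. by rewrite imM /= mul0r addr0. Qed.

Lemma complexP x y : re x = re y -> im x = im y -> x = y.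
Proof. by case: x => a b; case: y => c d /= -> ->. Qed.

Lemma RC_D (a b : R) : (a + b)%:C = a%:C + b%:C. Proof. exact: rmorphD. Qed.
Lemma RC_B (a b : R) : (a - b)%:C = a%:C - b%:C. Proof. exact: rmorphB. Qed.
Lemma RC_M (a b : R) : (a * b)%:C = a%:C * b%:C. Proof. exact: rmorphM. Qed.
Lemma RC_V (a : R) : (a^-1)%:C = (a%:C)^-1. Proof. exact: fmorphV. Qed.
Lemma RC_X (a : R) n : (a ^+ n)%:C = a%:C ^+ n. Proof. exact: rmorphXn. Qed.
Lemma RC_nat n : (n%:R : R)%:C = n%:R. Proof. exact: rmorph_nat. Qed.

Lemma normXE (z : C R) n : `|z| ^+ n = (abs z ^+ n)%:C.
Proof. by rewrite normCE RC_X. Qed.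

Lemma conjRM (a : R) x : (a%:C * x)^* = a%:C * x^*.
Proof. by rewrite rmorphM /= oppr0. Qed.

(** Rotating [z] onto the nonnegative axis turns a bound on a modulus into one on a real part, where
    real mean value theorems apply. *)
Lemma phase_ex z : exists k, abs k = 1 /\ k * z = (abs z)%:C.
Proof.
have [->|z0] := eqVneq z 0.
  by exists 1; rewrite abs1 mul1r abs0.
have a0 : abs z != 0 by rewrite abs_eq0.
have c0 : (abs z)%:C != 0 :> K by rewrite -abs_eq0 absR normr_eq0.
exists (z^* / (abs z)%:C); rewrite absM absJ absV absR ger0_norm ?abs_ge0 //.
split; first by rewrite divff.
by rewrite mulrAC [z^* * z]mulrC mulcJ_abs expr2 RC_M mulfK.
Qed.

End ComplexModulus.

(** * Wirtinger differentiability and its calculus rules *)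

Section Differentiability.
Variable R : realType.
Local Notation K := R[i].
Implicit Types (x y z w c a b : K) (f g e : K -> K).

Definition ccont f z := forall eps : R, 0 < eps -> exists2 d : R, 0 < d &
  forall w, abs (w - z) < d -> abs (f w - f z) < eps.

Definition small e z := forall eps : R, 0 < eps -> exists2 d : R, 0 < d &
  forall w, abs (w - z) < d -> abs (e w) <= eps * abs (w - z).

(* Real differentiability in Wirtinger form: [a] and [b] are the derivatives
   of [f] with respect to [z] and its conjugate. *)
Definition hdiff f z a b :=
  small (fun w => f w - f z - (a * (w - z) + b * (w - z)^*)) z.

Definition cdiff f z a := hdiff f z a 0.

Lemma smallD e1 e2 z : small e1 z -> small e2 z ->
  small (fun w => e1 w + e2 w) z.
Proof.
move=> h1 h2 eps e0; have e20 : 0 < eps / 2 by lra.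
have [d1 p1 H1] := h1 _ e20; have [d2 p2 H2] := h2 _ e20.
exists (Num.min d1 d2); first by rewrite lt_min p1.
move=> w; rewrite lt_min => /andP[w1 w2].
apply: le_trans (absD _ _) _.
have := H1 _ w1; have := H2 _ w2; lra.
Qed.

Lemma small_le e1 e2 z (M : R) (d : R) : 0 < d -> small e1 z ->
  (forall w, abs (w - z) < d -> abs (e2 w) <= M * abs (e1 w)) -> small e2 z.
Proof.
move=> d0 h1 hM eps e0.
have M0 : 0 < `|M| + 1 by have := normr_ge0 M; lra.
have [d1 p1 H1] := h1 _ (divr_gt0 e0 M0).
exists (Num.min d d1); first by rewrite lt_min d0.
move=> w; rewrite lt_min => /andP[w1 w2].
apply: le_trans (hM _ w1) _.
apply: le_trans (_ : (`|M| + 1) * abs (e1 w) <= _).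
  by rewrite ler_wpM2r ?abs_ge0 //; have := ler_norm M; lra.
rewrite mulrC -ler_pdivlMr //; apply: le_trans (H1 _ w2) _.
by rewrite mulrAC.
Qed.

Lemma smallM e z k : small e z -> small (fun w => k * e w) z.
Proof.
move=> h; apply: (@small_le e _ _ (abs k) 1) => // w _; by rewrite absM.
Qed.

Lemma smallJ e z : small e z -> small (fun w => (e w)^*) z.
Proof.
move=> h; apply: (@small_le e _ _ 1 1) => // w _; by rewrite absJ mul1r.
Qed.

Lemma small_ext e1 e2 z (d : R) : 0 < d -> small e1 z ->
  (forall w, abs (w - z) < d -> e2 w = e1 w) -> small e2 z.
Proof.
by move=> d0 h he; apply: (@small_le e1 _ _ 1 d) => // w /he ->; rewrite mul1r.
Qed.

Lemma small_eq e1 e2 z : small e1 z -> e2 =1 e1 -> small e2 z.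
Proof. by move=> h he; apply: (@small_ext e1 _ _ 1) => // w _; exact: he. Qed.

Lemma small0 z : small (fun=> 0) z.
Proof.
move=> eps e0; exists 1 => // w _; rewrite abs0.
by rewrite mulr_ge0 ?abs_ge0 // ltW.
Qed.

Lemma lin_le a b w : abs (a * w + b * w^*) <= (abs a + abs b) * abs w.
Proof. by rewrite mulrDl; apply: le_trans (absD _ _) _; rewrite !absM absJ. Qed.

Lemma hdiff_lip f z a b : hdiff f z a b -> exists2 d : R, 0 < d &
  forall w, abs (w - z) < d ->
    abs (f w - f z) <= (abs a + abs b + 1) * abs (w - z).
Proof.
move=> h; have [d d0 H] := h 1 ltr01.
exists d => // w /H; rewrite mul1r => Hw.
have := absD (f w - f z - (a * (w - z) + b * (w - z)^*))
  (a * (w - z) + b * (w - z)^*); rewrite subrK => h1.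
apply: le_trans h1 _; rewrite [leRHS]mulrDl mul1r addrC lerD //.
exact: lin_le.
Qed.

Lemma hdiff_cont f z a b : hdiff f z a b -> ccont f z.
Proof.
move=> /hdiff_lip[d d0 H] eps e0.
have M0 : 0 < abs a + abs b + 1 by have := abs_ge0 a; have := abs_ge0 b; lra.
exists (Num.min d (eps / (abs a + abs b + 1))).
  by rewrite lt_min d0 divr_gt0.
move=> w; rewrite lt_min => /andP[/H w1 w2]; apply: le_lt_trans w1 _.
by rewrite mulrC -ltr_pdivlMr.
Qed.

Lemma cdiff_cont f z a : cdiff f z a -> ccont f z.
Proof. exact: hdiff_cont. Qed.

Lemma hdiff_ext f g z a b (d : R) : 0 < d ->
  (forall w, abs (w - z) < d -> f w = g w) -> hdiff f z a b -> hdiff g z a b.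
Proof.
move=> d0 he h; apply: (small_ext d0 h) => w wd.
by rewrite !he // subrr abs0.
Qed.

Lemma hdiff_eq f g z a b : f =1 g -> hdiff f z a b -> hdiff g z a b.
Proof. by move=> he; apply: (@hdiff_ext _ _ _ _ _ 1) => // w _. Qed.

Lemma hdiff_val f z a b a' b' : hdiff f z a b -> a = a' -> b = b' ->
  hdiff f z a' b'.
Proof. by move=> h <- <-. Qed.

Lemma hdiff_cst c z : hdiff (fun=> c) z 0 0.
Proof.
by apply: (small_eq (@small0 z)) => w; rewrite subrr !mul0r addr0 subr0.
Qed.

Lemma hdiff_id z : hdiff (fun w => w) z 1 0.
Proof. by apply: (small_eq (@small0 z)) => w; ring. Qed.

Lemma hdiffD f g z a b a' b' : hdiff f z a b -> hdiff g z a' b' ->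
  hdiff (fun w => f w + g w) z (a + a') (b + b').
Proof. by move=> h1 h2; apply: (small_eq (smallD h1 h2)) => w /=; ring. Qed.

Lemma hdiffJ f z a b : hdiff f z a b -> hdiff (fun w => (f w)^*) z b^* a^*.
Proof.
move=> h; apply: (small_eq (smallJ h)) => w /=.
by rewrite !rmorphB rmorphD !rmorphM /= !rmorphB /= !conjcK; ring.
Qed.

Lemma hdiffM f g z a b a' b' : hdiff f z a b -> hdiff g z a' b' ->
  hdiff (fun w => f w * g w) z (f z * a' + g z * a) (f z * b' + g z * b).
Proof.
move=> h1 h2.
(* The mixed product is small because one factor is Lipschitz at [z] and the other tends to 0. *)
have h3 : small (fun w => (f w - f z) * (g w - g z)) z.
  have [d d0 H] := hdiff_lip h1.
  have C0 : 0 < abs a + abs b + 1 by have := abs_ge0 a; have := abs_ge0 b; lra.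
  move=> eps e0; have [d2 d20 H2] := hdiff_cont h2 (divr_gt0 e0 C0).
  exists (Num.min d d2); first by rewrite lt_min d0.
  move=> w; rewrite lt_min => /andP[/H w1 /H2 /ltW w2].
  rewrite absM; apply: le_trans (ler_pM (abs_ge0 _) (abs_ge0 _) w1 w2) _.
  by rewrite mulrC mulrA divfK // gt_eqF.
by apply: (small_eq (smallD (smallD (smallM (f z) h2) (smallM (g z) h1)) h3))
  => w; ring.
Qed.

Lemma hdiffZ k f z a b : hdiff f z a b -> hdiff (fun w => k * f w) z (k * a) (k * b).
Proof.
move=> h; apply: hdiff_val (hdiffM (hdiff_cst k z) h) _ _; ring.
Qed.

Lemma hdiffN f z a b : hdiff f z a b -> hdiff (fun w => - f w) z (- a) (- b).
Proof.
move=> h; have := hdiffZ (-1) h; rewrite !mulN1r.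
by apply: hdiff_eq => w; rewrite mulN1r.
Qed.

Lemma hdiffB f g z a b a' b' : hdiff f z a b -> hdiff g z a' b' ->
  hdiff (fun w => f w - g w) z (a - a') (b - b').
Proof. by move=> h1 /hdiffN h2; exact: hdiffD. Qed.

(** Conjugating the inner function swaps and conjugates its two derivatives, whence the cross terms
    of the chain rule. *)
Lemma hdiff_comp f g z a b a' b' : hdiff f z a b -> hdiff g (f z) a' b' ->
  hdiff (fun w => g (f w)) z (a' * a + b' * b^*) (a' * b + b' * a^*).
Proof.
move=> h1 h2.
have C0 : 0 < abs a + abs b + 1 by have := abs_ge0 a; have := abs_ge0 b; lra.
have h3 : small (fun w => g (f w) - g (f z) -
    (a' * (f w - f z) + b' * (f w - f z)^*)) z.
  move=> eps e0; have [d d0 H] := h2 _ (divr_gt0 e0 C0).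
  have [d1 d10 H1] := hdiff_cont h1 d0.
  have [d2 d20 H2] := hdiff_lip h1.
  exists (Num.min d1 d2); first by rewrite lt_min d10.
  move=> w; rewrite lt_min => /andP[/H1 /H w1 /H2 w2].
  apply: le_trans w1 _; rewrite -mulrA ler_pM2l //.
  by rewrite mulrC ler_pdivrMr // mulrC.
have h4 := smallD h3 (smallD (smallM a' h1) (smallM b' (smallJ h1))).
apply: (small_eq h4) => w /=.
by rewrite !rmorphB rmorphD !rmorphM /= !rmorphB /= !conjcK; ring.
Qed.

Lemma cdiff_comp f g z a a' : cdiff f z a -> cdiff g (f z) a' ->
  cdiff (fun w => g (f w)) z (a' * a).
Proof.
move=> h1 h2; apply: hdiff_val (hdiff_comp h1 h2) _ _; by rewrite ?rmorph0; ring.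
Qed.

Lemma cdiffM f g z a a' : cdiff f z a -> cdiff g z a' ->
  cdiff (fun w => f w * g w) z (f z * a' + g z * a).
Proof. by move=> h1 h2; apply: hdiff_val (hdiffM h1 h2) _ _; ring. Qed.

Lemma cdiffD f g z a a' : cdiff f z a -> cdiff g z a' ->
  cdiff (fun w => f w + g w) z (a + a').
Proof. by move=> h1 h2; apply: hdiff_val (hdiffD h1 h2) _ _; ring. Qed.

Lemma cdiffB f g z a a' : cdiff f z a -> cdiff g z a' ->
  cdiff (fun w => f w - g w) z (a - a').
Proof. by move=> h1 h2; apply: hdiff_val (hdiffB h1 h2) _ _; ring. Qed.

Lemma cdiffZ k f z a : cdiff f z a -> cdiff (fun w => k * f w) z (k * a).
Proof. by move=> h1; apply: hdiff_val (hdiffZ k h1) _ _; ring. Qed.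

Lemma cdiff_inv z : z != 0 -> cdiff (fun w => w^-1) z (- z^-1 ^+ 2).
Proof.
move=> z0; have az0 : 0 < abs z by rewrite abs_gt0.
have nz w : abs (w - z) < abs z / 2 -> w != 0.
  move=> h; rewrite -abs_gt0; have := abs_lerB z w; rewrite absC; lra.
(* The remainder equals (w - z)^2 / (w z^2), and |w| >= |z| / 2 on the chosen disk gives the
   constant. *)
apply: (@small_le (fun w => (w - z) * (w - z)) _ _ (2 / abs z ^+ 3) (abs z / 2)).
- by rewrite divr_gt0.
- move=> eps e0; exists eps => // w /ltW h.
  by rewrite absM ler_wpM2r ?abs_ge0.
move=> w h; have w0 := nz _ h.
have -> : w^-1 - z^-1 - (- z^-1 ^+ 2 * (w - z) + 0 * (w - z)^*) =
   ((w - z) * (w - z)) * (w^-1 * z^-1 ^+ 2) by field; rewrite z0 w0.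
rewrite absM [leRHS]mulrC ler_wpM2l ?abs_ge0 //.
have aw : abs z / 2 <= abs w by have := abs_lerB z w; rewrite absC; lra.
have aw0 : 0 < abs w by lra.
rewrite absM absX !absV exprVn -invfM -[2 / _]invf_div.
rewrite lef_pV2 ?posrE ?mulr_gt0 ?divr_gt0 ?exprn_gt0 //.
by rewrite exprS mulrAC ler_wpM2r // exprn_ge0 // abs_ge0.
Qed.

Lemma cdiff_div f g z a a' : cdiff f z a -> cdiff g z a' -> g z != 0 ->
  cdiff (fun w => f w / g w) z ((a * g z - f z * a') / g z ^+ 2).
Proof.
move=> h1 h2 g0; have h3 := cdiff_comp h2 (cdiff_inv g0).
apply: hdiff_val (hdiffM h1 h3) _ _; by field.
Qed.

Lemma cdiffX z n : cdiff (fun w => w ^+ n) z (n%:R * z ^+ n.-1).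
Proof.
elim: n => [|n IH].
  by apply: hdiff_val (hdiff_cst 1 z) _ _ => //; rewrite mul0r.
have h := cdiffM (hdiff_id z) IH.
apply: (@hdiff_eq (fun w => w * w ^+ n)) => [w|]; first by rewrite exprS.
apply: hdiff_val h _ _ => //; case: n {IH} => [|n] /=; first by rewrite mul0r; ring.
by rewrite -!natr1 !exprS; ring.
Qed.

Lemma cdiff_sum n (F : nat -> K -> K) (D : nat -> K) z :
  (forall j, (j < n)%N -> cdiff (F j) z (D j)) ->
  cdiff (fun w => \sum_(j < n) F j w) z (\sum_(j < n) D j).
Proof.
elim: n => [|n IH] h.
  rewrite big_ord0; apply: hdiff_eq (hdiff_cst 0 z) => w.
  by rewrite big_ord0.
rewrite big_ord_recr /=.
apply: (@hdiff_eq (fun w => \sum_(j < n) F j w + F n w)) => [w|].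
  by rewrite big_ord_recr.
apply: cdiffD; last exact: h.
by apply: IH => j jn; apply: h; rewrite ltnS ltnW.
Qed.

Lemma ccontM f g z : ccont f z -> ccont g z -> ccont (fun w => f w * g w) z.
Proof.
move=> h1 h2 eps e0.
pose M := abs (f z) + abs (g z) + 1.
have M0 : 0 < M by have := abs_ge0 (f z); have := abs_ge0 (g z); rewrite /M; lra.
pose e1 := Num.min 1 (eps / (2 * M)).
have e10 : 0 < e1 by rewrite lt_min ltr01 divr_gt0 // mulr_gt0.
have [d1 d10 H1] := h1 _ e10; have [d2 d20 H2] := h2 _ e10.
exists (Num.min d1 d2); first by rewrite lt_min d10.
move=> w; rewrite lt_min => /andP[/H1 w1 /H2 w2].
have -> : f w * g w - f z * g z =
  (f w - f z) * (g w - g z) + f z * (g w - g z) + g z * (f w - f z) by ring.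
have e11 : e1 <= 1 by rewrite ge_min lexx.
have e12 : e1 * (2 * M) <= eps.
  by rewrite -ler_pdivlMr ?mulr_gt0 // ge_min lexx orbT.
have p1 := abs_ge0 (f w - f z); have p2 := abs_ge0 (g w - g z).
have p3 := abs_ge0 (f z); have p4 := abs_ge0 (g z).
apply: le_lt_trans (absD _ _) _; apply: le_lt_trans (lerD (absD _ _) (lexx _)) _.
rewrite !absM; have := ler_pM p1 p2 (ltW w1) (ltW w2).
have := ler_wpM2l p3 (ltW w2); have := ler_wpM2l p4 (ltW w1).
rewrite /M in M0 e12 *; nra.
Qed.

Lemma ccontD f g z : ccont f z -> ccont g z -> ccont (fun w => f w + g w) z.
Proof.
move=> h1 h2 eps e0.
have e20 : 0 < eps / 2 by lra.
have [d1 d10 H1] := h1 _ e20; have [d2 d20 H2] := h2 _ e20.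
exists (Num.min d1 d2); first by rewrite lt_min d10.
move=> w; rewrite lt_min => /andP[/H1 w1 /H2 w2].
rewrite opprD addrACA; apply: le_lt_trans (absD _ _) _; lra.
Qed.

Lemma ccont_comp f g z : ccont f z -> ccont g (f z) -> ccont (fun w => g (f w)) z.
Proof.
move=> h1 h2 eps e0; have [d d0 H] := h2 _ e0; have [d1 d10 H1] := h1 _ d0.
by exists d1 => // w /H1 /H.
Qed.

Lemma ccont_ext f g z (d : R) : 0 < d ->
  (forall w, abs (w - z) < d -> f w = g w) -> ccont f z -> ccont g z.
Proof.
move=> d0 he h eps e0; have [d1 d10 H] := h _ e0.
exists (Num.min d d1); first by rewrite lt_min d0.
move=> w; rewrite lt_min => /andP[w1 w2].
by rewrite -!he ?subrr ?abs0 //; exact: H.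
Qed.

End Differentiability.

(** * Translation to the library derivatives, and derivatives along lines *)

Section DerivativeInterface.
Local Open Scope classical_set_scope.

(** Stated over any [numFieldType], so that one equivalence serves real derivatives along curves and
    complex derivatives. *)
Lemma is_derive_epsP (F : numFieldType) (f : F -> F) (z l : F) :
  (forall eps : F, 0 < eps -> exists2 d : F, 0 < d & forall w, `|w - z| < d ->
     `|f w - f z - l * (w - z)| <= eps * `|w - z|) <-> is_derive z 1 f l.
Proof.
split=> [H|[df dl] eps e0].
  have cv : h^-1 *: ((f \o shift z) (h *: (1 : F)) - f z) @[h --> 0^'] --> l.
    apply/cvgrPdist_le => eps e0; have [d d0 Hd] := H _ e0.
    apply/nbhs_ballP; exists d => // h; rewrite -ball_normE /= sub0r normrN => hd h0.
    have hN0 : 0 < `|h| by rewrite normr_gt0.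
    rewrite /= [_%:A]mulr1 [_ *: _]/(_ * _).
    have := Hd (h + z); rewrite addrK => /(_ hd) Hh.
    rewrite distrC -(ler_pM2r hN0) -normrM.
    by rewrite mulrBl mulrC mulrA mulfV ?mul1r.
  by apply: DeriveDef; [apply/cvg_ex; exists l|exact: cvg_lim cv].
have cv : h^-1 *: ((f \o shift z) (h *: (1 : F)) - f z) @[h --> 0^'] --> l.
  by rewrite -dl; exact: df.
have /cvgrPdist_le /(_ _ e0) /nbhs_ballP[d /= d0 Hd] := cv.
exists d => // w wd; have [->|wz] := eqVneq w z.
  by rewrite !subrr mulr0 subr0 !normr0 mulr0.
have h0 : w - z != 0 by rewrite subr_eq0.
have hN0 : 0 < `|w - z| by rewrite normr_gt0.
have := Hd (w - z); rewrite -ball_normE /= sub0r normrN => /(_ wd h0).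
rewrite [_%:A]mulr1 subrK [_ *: _]/(_ * _) distrC -(ler_pM2r hN0) -normrM.
by rewrite mulrBl mulrAC mulVf ?mul1r.
Qed.

Variable R : realType.
Local Notation K := R[i].

Lemma cdiff_is_derive (f : C R -> C R) (z l : C R) :
  cdiff f z l <-> is_derive z 1 f l.
Proof.
rewrite -is_derive_epsP; split=> H eps e0.
  (* A positive element for the order of the complex field has zero imaginary part, so [eps] is a
     real number. *)
  case: eps e0 => ea eb /=; rewrite ltcE /= => /andP[/eqP -> ea0].
  have [d d0 Hd] := H _ ea0; exists d%:C; first by rewrite ltcR.
  move=> w; rewrite normCE ltcR => /Hd.
  by rewrite mul0r addr0 !normCE -RC_M lecR.
have e0c : 0 < eps%:C :> C R by rewrite ltcR.
have [[d d'] /=] := H _ e0c; rewrite ltcE /= => /andP[/eqP -> d0] Hd.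
exists d => // w wd; have := Hd w; rewrite normCE ltcR => /(_ wd).
by rewrite mul0r addr0 !normCE -RC_M lecR.
Qed.

Lemma derivable_cdiff (f : C R -> C R) z :
  derivable f z 1 -> cdiff f z (cderiv f z).
Proof.
by move=> h; apply/cdiff_is_derive; rewrite /cderiv derive1E; exact/derivableP.
Qed.

Lemma cdiff_derivable (f : C R -> C R) z l : cdiff f z l -> derivable f z 1.
Proof. by move/cdiff_is_derive => [? ?]. Qed.

Lemma cdiff_cderiv (f : C R -> C R) z l : cdiff f z l -> cderiv f z = l.
Proof. by move/cdiff_is_derive => h; rewrite /cderiv derive1E derive_val. Qed.

Lemma cdiff_uniq (f : K -> K) z l l' : cdiff f z l -> cdiff f z l' -> l = l'.
Proof. by move=> /cdiff_cderiv <- /cdiff_cderiv <-. Qed.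

Lemma hdiff_line (f : K -> K) (p q a b : K) (t : R) :
  hdiff f (p + t%:C * q) a b ->
  is_derive t 1 (fun s => re (f (p + s%:C * q))) (re (a * q + b * q^*)).
Proof.
move=> h; apply/is_derive_epsP => eps e0.
have q0 : 0 < abs q + 1 by have := abs_ge0 q; lra.
have [d d0 H] := h _ (divr_gt0 e0 q0).
have E s : p + s%:C * q - (p + t%:C * q) = (s - t)%:C * q by rewrite RC_B; ring.
exists (d / (abs q + 1)); first exact: divr_gt0.
move=> s; rewrite ltr_pdivlMr // => sd.
have /H : abs (p + s%:C * q - (p + t%:C * q)) < d.
  rewrite E absM absR; apply: le_lt_trans sd; rewrite ler_wpM2l //; lra.
have -> : re (f (p + s%:C * q)) - re (f (p + t%:C * q)) -
    re (a * q + b * q^*) * (s - t) =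
  re (f (p + s%:C * q) - f (p + t%:C * q) - (a * (p + s%:C * q - (p + t%:C * q))
    + b * (p + s%:C * q - (p + t%:C * q))^*)).
  rewrite E conjRM !reB; congr (_ - _).
  by rewrite !reD mulrDl !(mulrCA _ (s - t)%:C) !reRM; ring.
move=> h1; apply: le_trans (re_le_abs _) _; apply: le_trans h1 _.
rewrite E absM absR mulrCA [leRHS]mulrC ler_wpM2l //.
rewrite mulrAC ler_pdivrMr // ler_pM2l //; lra.
Qed.

End DerivativeInterface.

(** * Extreme values on closed annuli *)

Section CompactAnnulus.
Local Open Scope classical_set_scope.
Variable R : realType.
Local Notation K := R[i].

Lemma abs_pair_lt (x y x' y' d : R) : `|x - x'| < d / 2 -> `|y - y'| < d / 2 ->
  abs ((x' +i* y') - (x +i* y)) < d.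
Proof.
move=> h1 h2; apply: le_lt_trans (abs_le_reim _) _.
by rewrite /= distrC (distrC y'); lra.
Qed.

(** One statement covers closed disks ([r1 = 0]) and circles ([r1 = r2]). Continuity is required
    relative to the annulus only; compactness is that of a closed part of a square in the real
    plane. *)
Lemma EVT_annulus (u : K -> R) (c : K) (r1 r2 : R) : 0 <= r1 <= r2 ->
  (forall z, r1 <= abs (z - c) <= r2 -> forall eps, 0 < eps ->
     exists2 d : R, 0 < d & forall w, r1 <= abs (w - c) <= r2 ->
       abs (w - z) < d -> `|u w - u z| < eps) ->
  exists2 z0, r1 <= abs (z0 - c) <= r2 &
    forall z, r1 <= abs (z - c) <= r2 -> u z <= u z0.
Proof.
move=> /andP[r10 r12] hu; have r20 := le_trans r10 r12.
pose T := (R * R)%type.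
pose N (p : T) : R := p.1 ^+ 2 + p.2 ^+ 2.
pose tz (p : T) : K := c + (p.1 +i* p.2).
have NE p : abs (tz p - c) ^+ 2 = N p.
  by rewrite abs_sqr /tz [c + _]addrC addrK.
pose B : set T := (`[- r2, r2] `*` `[- r2, r2]).
pose A : set T := ([set p | r1 ^+ 2 <= N p] `&` [set p | N p <= r2 ^+ 2]).
have AE p : A p <-> r1 <= abs (tz p - c) <= r2.
  rewrite /A /= -NE !ler_pXn2r ?nnegrE ?abs_ge0 //.
  by split=> [[-> ->]|/andP[-> ->]].
have cN : continuous N.
  move=> p; apply: cvgD; rewrite /=; apply: cvgM => //; 
    [exact: cvg_fst|exact: cvg_fst|exact: cvg_snd|exact: cvg_snd].
have clA : closed A.
  apply: closedI.
    by apply: (@closed_comp _ _ N [set x | r1 ^+ 2 <= x]%classic) => [p _|];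
      [exact: cN|exact: closed_ge].
  by apply: (@closed_comp _ _ N [set x | x <= r2 ^+ 2]%classic) => [p _|];
      [exact: cN|exact: closed_le].
have cB : compact B by exact: compact_setX (@segment_compact R _ _) (@segment_compact R _ _).
have cA : compact A.
  have sq (x : R) : x ^+ 2 <= r2 ^+ 2 -> -r2 <= x <= r2.
    by move=> h; rewrite -ler_norml -(@ler_pXn2r _ 2) ?nnegrE // real_normK ?num_real.
  apply: subclosed_compact clA cB _ => -[x y] [_ h].
  have {}h : x ^+ 2 + y ^+ 2 <= r2 ^+ 2 := h.
  have h1 := sqr_ge0 x; have h2 := sqr_ge0 y.
  split; rewrite /= in_itv /=; apply: sq; lra.
have A0 : (A !=set0).
  exists (r2, 0); apply/AE.
  suff -> : abs (tz (r2, 0) - c) = r2 by rewrite r12 lexx.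
  rewrite /tz [c + _]addrC addrK -[RHS](ger0_norm r20); exact: absR.
have cu : {within A, continuous (fun p => u (tz p))}%classic.
  apply/subspace_continuousP => p Ap; apply/cvgrPdist_lt => eps e0.
  have /AE Ap' := Ap; have [d d0 Hd] := hu _ Ap' _ e0.
  apply/nbhs_ballP; exists (d / 2); first by rewrite /= divr_gt0.
  move=> q [/= q1 q2] /AE Aq; rewrite distrC; apply: Hd => //.
  by rewrite /tz opprD addrACA subrr add0r; exact: abs_pair_lt.
have [p0 /set_mem /AE hp0 H] := compact_EVT_max A0 cA cu.
exists (tz p0) => // z hz.
have tzK : tz (re (z - c), im (z - c)) = z.
  by rewrite /tz; case: (z) => a b; case: (c) => a' b' /=;
  apply/eqP; rewrite eq_complex /= !subrKC !eqxx.
by rewrite -tzK; apply: H; apply/mem_set/AE; rewrite tzK.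
Qed.

End CompactAnnulus.

(** * Goursat's theorem *)

Section SegmentIntegrals.
Variable R : realType.
Local Notation K := R[i].
Implicit Types (f F : K -> K) (a b c z : K) (g : R -> K) (U : K -> Prop).

Lemma mean_value01 (u u' : R -> R) :
  (forall t : R, 0 <= t <= 1 -> is_derive t 1 u (u' t)) ->
  exists2 t : R, 0 < t < 1 & u 1 - u 0 = u' t.
Proof.
move=> h; have [t||t tI ->] := @MVT R u u' 0 1 ltr01.
- by rewrite in_itv /= => /andP[t0 t1]; apply: h; rewrite !ltW.
- apply: derivable_within_continuous => t; rewrite in_itv /= => tI.
  by have [] := h t tI.
- by exists t; [move: tI; rewrite in_itv|rewrite subr0 mulr1].
Qed.

Definition crv_derive g (t : R) (v : K) :=
  is_derive t 1 (fun s => re (g s)) (re v) /\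
  is_derive t 1 (fun s => im (g s)) (im v).

Lemma crv_deriveB g1 g2 t v1 v2 : crv_derive g1 t v1 -> crv_derive g2 t v2 ->
  crv_derive (fun s => g1 s - g2 s) t (v1 - v2).
Proof.
move=> [h1 h2] [h3 h4]; split.
  rewrite reB; have -> : (fun s => re (g1 s - g2 s)) =
    (fun s => re (g1 s)) - (fun s => re (g2 s)) by apply/funext => s; exact: reB.
  exact: is_deriveB.
rewrite imB; have -> : (fun s => im (g1 s - g2 s)) =
  (fun s => im (g1 s)) - (fun s => im (g2 s)) by apply/funext => s; exact: imB.
exact: is_deriveB.
Qed.

Lemma crv_derive_affine g (x k t : R) v : crv_derive g (x + t * k) v ->
  crv_derive (fun s => g (x + s * k)) t (v * k%:C).
Proof.
have H (u : R -> R) l : is_derive (x + t * k) 1 u l ->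
    is_derive t 1 (fun s => u (x + s * k)) (k * l).
  move=> /is_derive_epsP h; apply/is_derive_epsP => eps e0.
  have k0 : 0 < `|k| + 1 by have := normr_ge0 k; lra.
  have [d d0 Hd] := h _ (divr_gt0 e0 k0).
  have E s : x + s * k - (x + t * k) = (s - t) * k by ring.
  exists (d / (`|k| + 1)); first exact: divr_gt0.
  move=> s; rewrite ltr_pdivlMr // => sd.
  have /Hd : `|x + s * k - (x + t * k)| < d.
    rewrite E normrM; apply: le_lt_trans sd; rewrite ler_wpM2l //; lra.
  have -> : k * l * (s - t) = l * ((s - t) * k) by ring.
  rewrite E => h1; apply: le_trans h1 _.
  rewrite normrM mulrCA [leRHS]mulrC ler_wpM2l //.
  rewrite mulrAC ler_pdivrMr // ler_pM2l //; lra.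
move=> [/H h1 /H h2]; split.
  by rewrite mulrC reRM.
by rewrite mulrC imRM.
Qed.

Lemma crv_derive_line F (p q l : K) (t : R) : cdiff F (p + t%:C * q) l ->
  crv_derive (fun s => F (p + s%:C * q)) t (l * q).
Proof.
move=> h; split.
  by have := hdiff_line h; rewrite mul0r addr0.
have := hdiff_line (hdiffZ (0 -i* 1) h).
rewrite mulr0 mul0r addr0 -mulrA. rewrite !reM /= !mul0r mulN1r opprK add0r.
have -> : (fun s : R => re ((0 -i* 1) * F (p + s%:C * q))) =
  (fun s : R => im (F (p + s%:C * q))) => //.
by apply/funext => s; rewrite reM /= mul0r mulN1r opprK add0r.
Qed.

Lemma crv_derive_re g t v (k : K) : crv_derive g t v ->
  is_derive t 1 (fun s => re (k * g s)) (re (k * v)).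
Proof.
move=> [h1 h2].
have -> : (fun s => re (k * g s)) =
    (re k *: (fun s => re (g s))) - (im k *: (fun s => im (g s))).
  by apply/funext => s; rewrite reM.
rewrite reM; apply: is_deriveB.
Qed.

(** Mean value inequality: the increment is rotated onto the real axis, where it equals the real
    part of one rotated velocity. *)
Lemma crv_bound g (v : R -> K) (M : R) :
  (forall t : R, 0 <= t <= 1 -> crv_derive g t (v t)) ->
  (forall t : R, 0 <= t <= 1 -> abs (v t) <= M) -> abs (g 1 - g 0) <= M.
Proof.
move=> h hM; have [k [k1 kE]] := phase_ex (g 1 - g 0).
have [t /andP[/ltW t0 /ltW t1] E] : exists2 t : R, 0 < t < 1 &
    re (k * g 1) - re (k * g 0) = re (k * v t).
  by apply: (mean_value01 (u := fun s => re (k * g s))) => t /h; exact: crv_derive_re.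
have -> : abs (g 1 - g 0) = re (k * v t) by rewrite -E -reB -mulrBr kE.
apply: le_trans (ler_norm _) _; apply: le_trans (re_le_abs _) _.
by rewrite absM k1 mul1r hM // t0.
Qed.

(** Integration starts at -1 so that the derivative is two-sided at every point of [0, 1], endpoints
    included. *)
Lemma antiderivative (phi : R -> R) : continuous phi ->
  exists Phi : R -> R, forall x : R, -1 < x -> is_derive x 1 Phi (phi x).
Proof.
move=> cphi; pose mu := @lebesgue_measure R.
exists (fun x => (\int[mu]_(t in [set` Interval (BLeft (-1)) (BRight x)]) phi t)%R).
move=> x x1; have xu : x < x + 1 by rewrite ltrDl.
have [|||H1 H2] := @continuous_FTC1 R phi (BLeft (-1)) x (x + 1) xu.
- apply: continuous_compact_integrable; first exact: segment_compact.
  by apply: continuous_subspaceT => ?; exact: cphi.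
- by rewrite /= lte_fin.
- exact: cphi.
- by apply: DeriveDef => //; rewrite -derive1E.
Qed.

Definition convexC U := forall a b (t : R), U a -> U b -> 0 <= t <= 1 ->
  U (a + t%:C * (b - a)).

(** The integral of [f] along the segment, encoded as the increment of a primitive of the
    parametrized integrand; additivity and estimates become statements about derivatives. *)
Definition segint f a b v := exists g : R -> K,
  (forall t : R, 0 <= t <= 1 -> crv_derive g t (f (a + t%:C * (b - a)) * (b - a)))
  /\ v = g 1 - g 0.

(** Extends data on [0, 1] continuously to the whole line: integrands here, lifts of segments
    later. *)
Definition clamp (t : R) : R := if t < 0 then 0 else if 1 < t then 1 else t.

Lemma clamp01 t : 0 <= clamp t <= 1.
Proof. by rewrite /clamp; case: ltP => ?; last case: ltP => ?; lra. Qed.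

Lemma clamp_id t : 0 <= t <= 1 -> clamp t = t.
Proof. by move=> /andP[t0 t1]; rewrite /clamp ltNge t0 ltNge t1. Qed.

Lemma clamp_lip s t : `|clamp s - clamp t| <= `|s - t|.
Proof.
rewrite ler_norml; have := ler_norm (s - t); have := ler_norm (t - s).
rewrite [`|t - s|]distrC /clamp.
by case: (ltP s 0) => ?; last case: (ltP 1 s) => ?;
  (case: (ltP t 0) => ?; last case: (ltP 1 t) => ?); lra.
Qed.

Lemma segint_ex U f a b : convexC U -> (forall z, U z -> ccont f z) ->
  U a -> U b -> exists v, segint f a b v.
Proof.
move=> cU cf Ua Ub.
pose G (t : R) := f (a + (clamp t)%:C * (b - a)) * (b - a).
have cG (P : K -> R) : (forall x y, `|P x - P y| <= abs (x - y)) ->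
    continuous (fun t => P (G t)).
  move=> hP t; apply/cvgrPdist_lt => eps e0.
  have q0 : 0 < abs (b - a) + 1 by have := abs_ge0 (b - a); lra.
  have [d d0 Hd] := cf _ (cU a b (clamp t) Ua Ub (clamp01 t)) _ (divr_gt0 e0 q0).
  apply/nbhs_ballP; exists (d / (abs (b - a) + 1)); first by rewrite /= divr_gt0.
  move=> s hs0; have := hs0 : `|t - s| < _; rewrite ltr_pdivlMr // => hs.
  apply: le_lt_trans (hP _ _) _; rewrite absC /G -mulrBl absM.
  have /Hd h1 : abs (a + (clamp s)%:C * (b - a) - (a + (clamp t)%:C * (b - a))) < d.
    rewrite opprD addrACA subrr add0r -mulrBl -RC_B absM absR.
    apply: le_lt_trans hs; apply: ler_pM; rewrite ?abs_ge0 //.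
      by rewrite [leRHS]distrC; exact: clamp_lip.
    by rewrite lerDl.
  apply: le_lt_trans (_ : eps / (abs (b - a) + 1) * abs (b - a) < _).
    by rewrite ler_wpM2r ?abs_ge0 // ltW.
  rewrite mulrAC ltr_pdivrMr // ltr_pM2l //; lra.
(* [eq_rect] transports the bound on [re (x - y)] along [reB], to give the Lipschitz property of
   [re]. *)
have [F1 H1] := antiderivative (cG (@re R) (fun x y => 
  eq_rect _ (fun e => `|e| <= _) (re_le_abs (x - y)) _ (reB x y))).
have [F2 H2] := antiderivative (cG (@im R) (fun x y => 
  eq_rect _ (fun e => `|e| <= _) (im_le_abs (x - y)) _ (imB x y))).
exists ((F1 1 +i* F2 1) - (F1 0 +i* F2 0)), (fun t => F1 t +i* F2 t); split=> // t tI.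
have t1 : -1 < t by lra.
by have := H1 _ t1; have := H2 _ t1; rewrite /G (clamp_id tI).
Qed.

Lemma segint_uniq f a b v w : segint f a b v -> segint f a b w -> v = w.
Proof.
move=> [g [hg ->]] [g' [hg' ->]]; apply/eqP; rewrite -subr_eq0 -abs_eq0 eq_le.
rewrite abs_ge0 andbT.
have -> : g 1 - g 0 - (g' 1 - g' 0) = (g 1 - g' 1) - (g 0 - g' 0) by ring.
apply: (@crv_bound (fun t => g t - g' t) (fun=> 0)) => [t tI|t _].
  by have := crv_deriveB (hg t tI) (hg' t tI); rewrite subrr.
by rewrite abs0.
Qed.

(** One primitive, reparametrized affinely, serves every subsegment; additivity along a line then
    telescopes. *)
Lemma segint_sub f a b (g : R -> K) (x y : R) :
  (forall t : R, 0 <= t <= 1 -> crv_derive g t (f (a + t%:C * (b - a)) * (b - a))) ->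
  0 <= x <= 1 -> 0 <= y <= 1 ->
  segint f (a + x%:C * (b - a)) (a + y%:C * (b - a)) (g y - g x).
Proof.
move=> hg xI yI; exists (fun t => g (x + t * (y - x))); split=> [t tI|]; last first.
  by rewrite mul1r mul0r addr0 subrKC.
have uI : 0 <= x + t * (y - x) <= 1 by nra.
have := crv_derive_affine (hg _ uI).
congr crv_derive; rewrite -mulrA; congr (f _ * _); rewrite ?RC_D ?RC_M ?RC_B; ring.
Qed.

(** An affine integrand has the primitive al z + be z^2 / 2, so its integral is explicit. Goursat's
    argument takes the tangent approximation of [f]; the construction of a primitive takes
    [be = 0]. *)
Lemma segint_bound f a b v (al be : K) (M : R) : segint f a b v ->
  (forall t : R, 0 <= t <= 1 -> abs (f (a + t%:C * (b - a)) -
     (al + be * (a + t%:C * (b - a)))) <= M) ->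
  abs (v - (al * (b - a) + be / 2 * (b ^+ 2 - a ^+ 2))) <= M * abs (b - a).
Proof.
move=> [g [hg ->]] hM; pose F z := al * z + be / 2 * (z * z).
have dF z : cdiff F z (al + be * z).
  have h := cdiffD (cdiffZ al (hdiff_id z)) 
    (cdiffZ (be / 2) (cdiffM (hdiff_id z) (hdiff_id z))).
  by apply: hdiff_val h _ _ => //; field.
have -> : g 1 - g 0 - (al * (b - a) + be / 2 * (b ^+ 2 - a ^+ 2)) =
  (g 1 - F (a + 1%:C * (b - a))) - (g 0 - F (a + 0%:C * (b - a))).
  rewrite /F mul1r mul0r; ring.
apply: (crv_bound (g := fun t => g t - F (a + t%:C * (b - a)))) => t tI.
  exact: crv_deriveB (hg t tI) (crv_derive_line (dF _)).
by rewrite /= -mulrBl absM ler_wpM2r ?abs_ge0 ?hM.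
Qed.

End SegmentIntegrals.

(** * Triangle integrals vanish, and primitives exist on a half-plane *)

Section Goursat.
Variable R : realType.
Local Notation K := R[i].

Lemma geometric_small (D x eps : R) : 0 <= x < 1 -> 0 < eps ->
  exists n, forall k, (n <= k)%N -> D * x ^+ k < eps.
Proof.
move=> /andP[x0 x1] e0.
have h : `|x| < 1 by rewrite ger0_norm.
have /cvgrPdist_lt /(_ _ e0) [n _ H] := cvg_geometric D h.
exists n => k /H; rewrite /= sub0r normrN; apply: le_lt_trans; exact: ler_norm.
Qed.

(** The bound [e n] is the tail of the geometric series, so the intervals of radius [e n] about
    [x n] are nested, and the supremum of their left ends lies in all of them. *)
Lemma geometric_limit (x : nat -> R) (D : R) : 0 <= D ->
  (forall n, `|x n.+1 - x n| <= D * (1 / 2) ^+ n) ->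
  exists l, forall n, `|x n - l| <= 2 * D * (1 / 2) ^+ n.
Proof.
move=> D0 H; pose e n : R := 2 * D * (1 / 2) ^+ n.
have eS n : e n.+1 = e n - D * (1 / 2) ^+ n by rewrite /e exprS; field.
have e0 n : 0 <= e n by rewrite /e !mulr_ge0 ?exprn_ge0 //; lra.
have mono n k : `|x (n + k)%N - x n| <= e n - e (n + k)%N.
  elim: k => [|k IH]; first by rewrite addn0 !subrr normr0.
  rewrite addnS eS; have := H (n + k)%N; rewrite !ler_norml in IH *; lra.
have cross n k : x n - e n <= x k + e k.
  have [nk|/ltnW kn] := leqP n k.
    have := mono n (k - n)%N; rewrite subnKC // ler_norml.
    have := e0 n; have := e0 k; lra.
  have := mono k (n - k)%N; rewrite subnKC // ler_norml.
  have := e0 n; have := e0 k; lra.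
pose S := (range (fun n => x n - e n))%classic.
have hS : has_sup S.
  split; first by exists (x 0%N - e 0%N), 0%N.
  by exists (x 0%N + e 0%N) => _ [n _ <-].
exists (sup S) => n; rewrite -/(e n).
have h1 : x n - e n <= sup S by apply: sup_upper_bound => //; exists n.
have h2 : sup S <= x n + e n.
  by apply: sup_le_ub; [case: hS|move=> _ [k _ <-]].
by rewrite ler_norml; lra.
Qed.

Lemma halfplane_convex (L : R) : convexC (fun z : K => re z < L).
Proof.
move=> a b t; rewrite reD reRM reB => ha hb /andP[t0 t1].
have [->|tn] := eqVneq t 0; first by rewrite mul0r addr0.
have tp : 0 < t by rewrite lt_def tn.
have : t * (re b - L) < 0 by rewrite pmulr_rlt0 // subr_lt0.
have : (1 - t) * (re a - L) <= 0 by rewrite mulr_ge0_le0 //; lra.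
lra.
Qed.

Variables (f : K -> K) (L : R).
Local Notation U := (fun z : K => re z < L).
Hypothesis fdiff : forall z, re z < L -> exists l, cdiff f z l.

Let convexU : convexC U := @halfplane_convex L.

Let fcont z : U z -> ccont f z.
Proof. by move=> /fdiff[l /cdiff_cont]. Qed.

Definition seg_int a b : K := xget 0 [set v | segint f a b v]%classic.

Lemma seg_intP a b : U a -> U b -> segint f a b (seg_int a b).
Proof.
move=> Ua Ub; rewrite /seg_int.
have [v hv] := segint_ex convexU fcont Ua Ub.
by case: xgetP => [w -> //|/(_ v)].
Qed.

(** The parameters come in any order, so degenerate and reversed segments are instances. *)
Lemma seg_int_sub a b (x y z : R) : U a -> U b -> 
  0 <= x <= 1 -> 0 <= y <= 1 -> 0 <= z <= 1 ->
  let p t := a + t%:C * (b - a) in seg_int (p x) (p y) + seg_int (p y) (p z) = seg_int (p x) (p z).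
Proof.
move=> Ua Ub xI yI zI p; have [g [hg _]] := seg_intP Ua Ub.
have Up t : 0 <= t <= 1 -> U (p t) by move=> tI; exact: convexU.
have E s t : 0 <= s <= 1 -> 0 <= t <= 1 -> seg_int (p s) (p t) = g t - g s.
  move=> sI tI; apply: segint_uniq (segint_sub hg sI tI).
  by apply: seg_intP; exact: Up.
by rewrite !E //; ring.
Qed.

Lemma seg_int_same a : U a -> seg_int a a = 0.
Proof.
move=> Ua; have z : (0 : R) <= (0 : R) <= 1 by rewrite lexx ler01.
have := seg_int_sub Ua Ua z z z; rewrite /= subrr mulr0 addr0 => /eqP.
by rewrite -subr_eq0 addrK => /eqP.
Qed.

Lemma seg_int_opp a b : U a -> U b -> seg_int b a = - seg_int a b.
Proof.
move=> Ua Ub; have z : (0 : R) <= (0 : R) <= 1 by rewrite lexx ler01.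
have o : (0 : R) <= (1 : R) <= 1 by rewrite lexx ler01.
have := seg_int_sub Ua Ub o z o; rewrite /= mul0r mul1r addr0 subrKC (seg_int_same Ub).
by move/eqP; rewrite addr_eq0 => /eqP.
Qed.

Definition mid (a b : K) : K := (a + b) / 2.

Lemma midE a b : mid a b = a + (1 / 2 : R)%:C * (b - a).
Proof. by rewrite RC_M RC_V RC_nat mul1r /mid; field. Qed.

Lemma seg_int_mid a b : U a -> U b -> seg_int a b = seg_int a (mid a b) + seg_int (mid a b) b.
Proof.
move=> Ua Ub; have z : (0 : R) <= (0 : R) <= 1 by rewrite lexx ler01.
have o : (0 : R) <= (1 : R) <= 1 by rewrite lexx ler01.
have h : (0 : R) <= (1 / 2 : R) <= 1 by lra.
have := seg_int_sub Ua Ub z h o.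
by rewrite /= mul0r addr0 -midE mul1r subrKC => ->.
Qed.

Lemma U_mid a b : U a -> U b -> U (mid a b).
Proof. by move=> Ua Ub; rewrite midE; apply: convexU => //; lra. Qed.

Definition tri_int (T : K * K * K) : K :=
  seg_int T.1.1 T.1.2 + seg_int T.1.2 T.2 + seg_int T.2 T.1.1.

(** The four pieces of the subdivision by midpoints, [sub4] being the medial triangle. All keep the
    orientation of [T], so that each inner side is run through once in each direction and
    cancels. *)
Definition sub1 (T : K * K * K) := (T.1.1, mid T.1.1 T.1.2, mid T.2 T.1.1).
Definition sub2 (T : K * K * K) := (mid T.1.1 T.1.2, T.1.2, mid T.1.2 T.2).
Definition sub3 (T : K * K * K) := (mid T.2 T.1.1, mid T.1.2 T.2, T.2).
Definition sub4 (T : K * K * K) := (mid T.1.2 T.2, mid T.2 T.1.1, mid T.1.1 T.1.2).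

Definition next T :=
  if abs (tri_int T) <= 4 * abs (tri_int (sub1 T)) then sub1 T else
  if abs (tri_int T) <= 4 * abs (tri_int (sub2 T)) then sub2 T else
  if abs (tri_int T) <= 4 * abs (tri_int (sub3 T)) then sub3 T else sub4 T.

Definition inU T := [/\ U T.1.1, U T.1.2 & U T.2].

Lemma tri_int_sub T : inU T -> tri_int T = tri_int (sub1 T) + tri_int (sub2 T) + tri_int (sub3 T) + tri_int (sub4 T).
Proof.
case: T => -[a b] c [/= Ua Ub Uc]; rewrite /tri_int /=.
have Um1 := U_mid Ua Ub; have Um2 := U_mid Ub Uc; have Um3 := U_mid Uc Ua.
rewrite (seg_int_mid Ua Ub) (seg_int_mid Ub Uc) (seg_int_mid Uc Ua).
by rewrite (seg_int_opp Um2 Um3) (seg_int_opp Um3 Um1) (seg_int_opp Um1 Um2); ring.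
Qed.

Lemma next_tri_int T : inU T -> abs (tri_int T) <= 4 * abs (tri_int (next T)).
Proof.
move=> hT; rewrite /next; case: ifPn => // h1; case: ifPn => // h2.
case: ifPn => // h3; rewrite -!ltNge in h1 h2 h3.
have := absD (tri_int (sub1 T) + tri_int (sub2 T) + tri_int (sub3 T)) (tri_int (sub4 T)).
rewrite -tri_int_sub //.
have := absD (tri_int (sub1 T) + tri_int (sub2 T)) (tri_int (sub3 T)).
have := absD (tri_int (sub1 T)) (tri_int (sub2 T)); lra.
Qed.

Definition sides T (d : R) := [/\ abs (T.1.2 - T.1.1) <= d,
  abs (T.2 - T.1.2) <= d & abs (T.1.1 - T.2) <= d].

Lemma next_cases (P : K * K * K -> Prop) T :
  P (sub1 T) -> P (sub2 T) -> P (sub3 T) -> P (sub4 T) -> P (next T).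
Proof. by rewrite /next; case: ifP => // _; case: ifP => // _; case: ifP. Qed.

Lemma abs_half (w z : K) (d : R) : z = w / 2 -> abs w <= d -> abs z <= d / 2.
Proof.
move=> -> h; rewrite absM absV -(RC_nat R 2) absR ger0_norm //.
by rewrite ler_pM2r ?invr_gt0.
Qed.

Lemma next_sides T d : sides T d -> sides (next T) (d / 2).
Proof.
case: T => -[a b] c [/= h1 h2 h3].
apply: (@next_cases (fun T' => sides T' (d / 2))); split; rewrite /sub1 /sub2 /sub3 /sub4 /= /mid;
  solve [apply: (abs_half _ h1); by field | apply: (abs_half _ h2); by field
        | apply: (abs_half _ h3); by field | rewrite absC; apply: (abs_half _ h1); by field
        | rewrite absC; apply: (abs_half _ h2); by field
        | rewrite absC; apply: (abs_half _ h3); by field].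
Qed.

Lemma next_shift T d : 0 <= d -> sides T d -> abs ((next T).1.1 - T.1.1) <= d.
Proof.
case: T => -[a b] c d0 [/= h1 h2 h3].
have h (z : K) : abs z <= d / 2 -> abs z <= d by lra.
apply: (@next_cases (fun T' => abs (T'.1.1 - a) <= d)); rewrite /sub1 /sub2 /sub3 /sub4 /= /mid ?subrr ?abs0 //.
- by apply: h; apply: (abs_half _ h1); field.
- by apply: h; rewrite absC; apply: (abs_half _ h3); field.
- have -> : (b + c) / 2 - a = (b - a) / 2 + (c - a) / 2 by field.
  apply: le_trans (absD _ _) _; rewrite [leRHS]splitr; apply: lerD.
    by apply: (abs_half _ h1).
  by apply: (@abs_half (c - a)) => //; rewrite absC.
Qed.

(** Used with a fixed [M < L]: this bound survives the passage to the limit, so the point to which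
    the triangles shrink stays in the open half-plane. *)
Lemma next_re T (M : R) : [/\ re T.1.1 <= M, re T.1.2 <= M & re T.2 <= M] ->
  [/\ re (next T).1.1 <= M, re (next T).1.2 <= M & re (next T).2 <= M].
Proof.
case: T => -[a b] c [/= h1 h2 h3].
have h x y : re x <= M -> re y <= M -> re (mid x y) <= M.
  by rewrite midE reD reRM reB; lra.
by apply: (@next_cases (fun T' => [/\ re T'.1.1 <= M, re T'.1.2 <= M & re T'.2 <= M]));
  split; rewrite /sub1 /sub2 /sub3 /sub4 //=; exact: h.
Qed.

Lemma goursat T : inU T -> tri_int T = 0.
Proof.
move=> hT; pose Tn n := iter n next T.
pose M := Num.max (re T.1.1) (Num.max (re T.1.2) (re T.2)).
have hM : [/\ re T.1.1 <= M, re T.1.2 <= M & re T.2 <= M].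
  by rewrite /M !le_max !lexx !orbT.
have ML : M < L by rewrite /M !gt_max; case: hT => -> -> ->.
have Tre n : [/\ re (Tn n).1.1 <= M, re (Tn n).1.2 <= M & re (Tn n).2 <= M].
  by elim: n => [//|n IH]; exact: next_re.
have TU n : inU (Tn n) by have [? ? ?] := Tre n; split; apply: le_lt_trans ML.
pose d := abs (T.1.2 - T.1.1) + abs (T.2 - T.1.2) + abs (T.1.1 - T.2).
have d0 : 0 <= d by rewrite !addr_ge0 ?abs_ge0.
have e0 n : 0 <= (1 / 2 : R) ^+ n by rewrite exprn_ge0 //; lra.
have dn0 n : 0 <= d * (1 / 2) ^+ n by rewrite mulr_ge0.
have Ts n : sides (Tn n) (d * (1 / 2) ^+ n).
  elim: n => [|n IH]; last first.
    have -> : d * (1 / 2) ^+ n.+1 = d * (1 / 2) ^+ n / 2 by rewrite exprS; field.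
    exact: next_sides.
  have := abs_ge0 (T.1.2 - T.1.1); have := abs_ge0 (T.2 - T.1.2).
  have := abs_ge0 (T.1.1 - T.2); rewrite expr0 mulr1 /d => *; split=> /=; lra.
have TS n : abs (tri_int T) <= 4 ^+ n * abs (tri_int (Tn n)).
  elim: n => [|n IH]; first by rewrite mul1r.
  apply: le_trans IH _; rewrite exprSr -mulrA ler_wpM2l ?exprn_ge0 //.
  exact: next_tri_int.
pose an n := (Tn n).1.1.
have sh n : abs (an n.+1 - an n) <= d * (1 / 2) ^+ n by exact: next_shift.
have [x Hx] : exists x, forall n, `|re (an n) - x| <= 2 * d * (1 / 2) ^+ n.
  apply: geometric_limit d0 _ => n; rewrite -reB.
  exact: le_trans (re_le_abs _) (sh n).
have [y Hy] : exists x, forall n, `|im (an n) - x| <= 2 * d * (1 / 2) ^+ n.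
  apply: geometric_limit d0 _ => n; rewrite -imB.
  exact: le_trans (im_le_abs _) (sh n).
pose z : K := x +i* y.
have anz n : abs (an n - z) <= 4 * (d * (1 / 2) ^+ n).
  apply: le_trans (abs_le_reim _) _; rewrite reB imB.
  have := Hx n; have := Hy n; rewrite {2}/re {2}/im /=; lra.
have Uz : re z < L.
  have ML2 : 0 < L - M by rewrite subr_gt0.
  have h12 : 0 <= (1 / 2 : R) < 1 by lra.
  have [n /(_ n (leqnn n)) Hn] := geometric_small (2 * d) h12 ML2.
  have := Hx n; rewrite ler_norml /an; have [h _ _] := Tre n.
  rewrite /re /= in h *; lra.
have [l hl] := fdiff Uz.
apply/eqP; rewrite -abs_eq0 eq_le abs_ge0 andbT; apply/ler_addgt0Pl => eps eps0.
rewrite addr0.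
(* The 15 counts three sides of length at most [dn], all of whose points lie within [5 * dn] of [z];
   the added 1 keeps the divisor positive for a degenerate triangle. *)
have c0 : 0 < 15 * d ^+ 2 + 1 by have := sqr_ge0 d; lra.
have [del del0 Hdel] := hl _ (divr_gt0 eps0 c0).
have h12 : 0 <= (1 / 2 : R) < 1 by lra.
have [n /(_ n (leqnn n)) Hn] := geometric_small (5 * d) h12 del0.
pose dn := d * (1 / 2) ^+ n.
have [h1 h2 h3] := Ts n; have [U1 U2 U3] := TU n.
pose e := eps / (15 * d ^+ 2 + 1).
have ge0e : 0 <= e by rewrite ltW ?divr_gt0.
pose al := f z - l * z.
have key p q : U p -> U q -> abs (p - an n) <= dn -> abs (q - p) <= dn ->
    abs (q - an n) <= dn ->
    abs (seg_int p q - (al * (q - p) + l / 2 * (q ^+ 2 - p ^+ 2))) <= e * (5 * dn) * dn.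
  move=> Up Uq hp hpq hq.
  apply: le_trans (segint_bound (seg_intP Up Uq) (M := e * (5 * dn)) _) _.
    move=> t tI.
    have ht : abs (p + t%:C * (q - p) - an n) <= dn.
      have -> : p + t%:C * (q - p) - an n = (1 - t)%:C * (p - an n) + t%:C * (q - an n).
        by rewrite RC_B; ring.
      apply: le_trans (absD _ _) _; rewrite !absM !absR !ger0_norm; try lra.
      have : (1 - t) * abs (p - an n) <= (1 - t) * dn by rewrite ler_wpM2l //; lra.
      have : t * abs (q - an n) <= t * dn by rewrite ler_wpM2l //; lra.
      lra.
    have hz : abs (p + t%:C * (q - p) - z) <= 5 * dn.
      have -> : p + t%:C * (q - p) - z =
        (p + t%:C * (q - p) - an n) + (an n - z) by ring.
      apply: le_trans (absD _ _) _; have := anz n; rewrite -/dn; lra.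
    have -> : f (p + t%:C * (q - p)) - (al + l * (p + t%:C * (q - p))) =
      f (p + t%:C * (q - p)) - f z - (l * (p + t%:C * (q - p) - z) +
         0 * (p + t%:C * (q - p) - z)^*) by rewrite /al; ring.
    apply: le_trans (Hdel _ _) _; first by rewrite -mulrA -/dn in Hn; lra.
    by rewrite -/e ler_wpM2l.
  by rewrite ler_wpM2l // mulr_ge0 // mulr_ge0 // /dn dn0.
have an0 : abs (an n - an n) <= dn by rewrite subrr abs0 dn0.
rewrite absC in h3.
have k1 := key _ _ U1 U2 an0 h1 h1.
have k2 : abs (seg_int (Tn n).1.2 (Tn n).2 -
   (al * ((Tn n).2 - (Tn n).1.2) + l / 2 * ((Tn n).2 ^+ 2 - (Tn n).1.2 ^+ 2)))
   <= e * (5 * dn) * dn by exact: key.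
have k3 : abs (seg_int (Tn n).2 (Tn n).1.1 -
   (al * ((Tn n).1.1 - (Tn n).2) + l / 2 * ((Tn n).1.1 ^+ 2 - (Tn n).2 ^+ 2)))
   <= e * (5 * dn) * dn by apply: key => //; rewrite absC.
have kS : abs (tri_int (Tn n)) <= 15 * e * dn ^+ 2.
  rewrite /tri_int.
  set i1 := seg_int _ _ in k1 *; set i2 := seg_int _ _ in k2 *; set i3 := seg_int _ _ in k3 *.
  set q1 := al * _ + _ in k1; set q2 := al * _ + _ in k2; set q3 := al * _ + _ in k3.
  (* The affine parts [q1], [q2], [q3] sum to 0 around the closed triangle. *)
  have -> : i1 + i2 + i3 = (i1 - q1) + (i2 - q2) + (i3 - q3).
    by rewrite /q1 /q2 /q3; ring.
  apply: le_trans (absD _ _) _; apply: le_trans (lerD (absD _ _) (lexx _)) _.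
  by move: k1 k2 k3; rewrite -/dn; lra.
apply: le_trans (TS n) _.
(* The factor 4^n lost by subdividing is exactly compensated by the square of the size. *)
have e4 : 4 ^+ n * dn ^+ 2 = d ^+ 2 :> R.
  rewrite /dn exprMn -exprM mulnC exprM mulrCA -exprMn.
  by rewrite (_ : 4 * (1 / 2) ^+ 2 = 1 :> R) ?expr1n ?mulr1 //; field.
apply: le_trans (ler_wpM2l (exprn_ge0 _ _) kS) _ => //.
rewrite mulrCA e4.
rewrite -mulrA mulrCA /e mulrAC ler_pdivrMr // ler_pM2l //; lra.
Qed.

(** By Goursat, the increment of the integral from a base point is the integral from [z] to [w],
    which is compared with that of the constant [f z]. *)
Theorem halfplane_primitive : exists F, forall z, re z < L -> cdiff F z (f z).
Proof.
pose z0 : K := (L - 1)%:C.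
have U0 : U z0 by rewrite /re /=; lra.
exists (seg_int z0) => z Uz eps e0.
have [d d0 Hd] := fcont Uz e0.
exists (Num.min d (L - re z)); first by rewrite lt_min d0 subr_gt0.
move=> w; rewrite lt_min => /andP[w1 w2].
have Uw : U w.
  have := re_le_abs (w - z); rewrite reB => /(le_trans (ler_norm _)); lra.
have : tri_int (z0, z, w) = 0 by exact: goursat.
rewrite /tri_int /= (seg_int_opp U0 Uw) => /eqP; rewrite subr_eq0 => /eqP <-.
rewrite mul0r addr0 [seg_int z0 z + _]addrC addrK.
have := segint_bound (al := f z) (be := 0) (seg_intP Uz Uw) (M := eps).
rewrite !mul0r addr0; apply=> t /andP[t0 t1].
rewrite mul0r addr0 ltW // Hd // addrC addKr absM absR ger0_norm //.
by apply: le_lt_trans w1; rewrite ler_piMl ?abs_ge0.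
Qed.

End Goursat.

(** * Maximum principle and removable singularities *)

Section MeanValue.
Variable R : realType.
Local Notation K := R[i].
Implicit Types (f : K -> K) (z c : K).

(** The halves come from re w = (w + conj w) / 2; for the imaginary part below, from im w = (w -
    conj w) / (2i). *)
Lemma hdiff_re (u : R -> R) (z : K) (l : R) : is_derive (re z) 1 u l ->
  hdiff (fun w => (u (re w))%:C) z (l / 2)%:C (l / 2)%:C.
Proof.
move=> /is_derive_epsP h eps e0; have [d d0 H] := h _ e0; exists d => // w wd.
have E : (l / 2)%:C * (w - z) + (l / 2)%:C * (w - z)^* = (l * (re w - re z))%:C.
  rewrite -reB; case: (w - z) => a b; apply/eqP; rewrite eq_complex /=.
  by apply/andP; split; apply/eqP; rewrite /re /=; field.
rewrite E -!RC_B absR.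
have hre : `|re w - re z| <= abs (w - z) by rewrite -reB re_le_abs.
by apply: le_trans (H _ (le_lt_trans hre wd)) _; rewrite ler_pM2l.
Qed.

Lemma hdiff_im (u : R -> R) (z : K) (l : R) : is_derive (im z) 1 u l ->
  hdiff (fun w => (u (im w))%:C) z (0 -i* (l / 2)) (0 +i* (l / 2)).
Proof.
move=> /is_derive_epsP h eps e0; have [d d0 H] := h _ e0; exists d => // w wd.
have E : (0 -i* (l / 2)) * (w - z) + (0 +i* (l / 2)) * (w - z)^* =
    (l * (im w - im z))%:C.
  rewrite -imB; case: (w - z) => a b; apply/eqP; rewrite eq_complex /=.
  by apply/andP; split; apply/eqP; rewrite /im /=; field.
rewrite E -!RC_B absR.
have him : `|im w - im z| <= abs (w - z) by rewrite -imB im_le_abs.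
by apply: le_trans (H _ (le_lt_trans him wd)) _; rewrite ler_pM2l.
Qed.

Definition cexp z : K := (expR (re z))%:C * (cos (im z) +i* sin (im z)).

Lemma abs_cexp z : abs (cexp z) = expR (re z).
Proof.
rewrite absM absR ger0_norm ?expR_ge0 //.
rewrite (_ : abs (_ +i* _) = 1) ?mulr1 //.
by rewrite /abs /= cos2Dsin2 sqrtr1.
Qed.

Lemma cdiff_cexp z : cdiff cexp z (cexp z).
Proof.
have hE := hdiff_re (is_derive_expR (re z)).
have hC := hdiff_im (is_derive_cos (im z)).
have hS := hdiffZ (0 +i* 1) (hdiff_im (is_derive_sin (im z))).
have h := hdiffM hE (hdiffD hC hS).
apply: (@hdiff_eq _ (fun w => (expR (re w))%:C *
    ((cos (im w))%:C + (0 +i* 1) * (sin (im w))%:C))) => [w|].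
  rewrite /cexp; congr (_ * _); apply/eqP; rewrite eq_complex /=.
  by apply/andP; split; apply/eqP; ring.
apply: hdiff_val h _ _; rewrite /cexp.
- apply/eqP; rewrite eq_complex /=.
  by apply/andP; split; apply/eqP; field.
- apply/eqP; rewrite eq_complex /=.
  by apply/andP; split; apply/eqP; field.
Qed.

Definition twopii : K := 0 +i* (pi *+ 2).

Lemma cexp_periodic z : cexp (z + twopii) = cexp z.
Proof. by rewrite /cexp reD imD /re /im /= addr0 cosD2pi sinD2pi. Qed.

(* In the coordinate [zeta = log (z - c)] the punctured disk becomes a half-plane,
   where Goursat's theorem gives a primitive [F] of [f (c + cexp zeta)]; its
   increment over the period is [twopii * f c] by letting [re zeta] tend to
   [-oo].  Rolle's theorem for the periodic function [F zeta - f c * zeta] on a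
   vertical line then replaces Cauchy's integral formula. *)
Lemma mean_value_circle f c (rho r : R) (k : K) : ccont f c ->
  (forall z, 0 < abs (z - c) < rho -> exists l, cdiff f z l) -> 0 < r < rho ->
  exists2 z, abs (z - c) = r & re (k * f z) = re (k * f c).
Proof.
move=> fc fd /andP[r0 rrho]; have rho0 := lt_trans r0 rrho.
pose L := ln rho; pose H z := f (c + cexp z).
have expL z : re z < L -> 0 < expR (re z) < rho.
  by move=> h; rewrite expR_gt0 -[rho]lnK ?posrE // ltr_expR.
have Hd z : re z < L -> exists l, cdiff H z l.
  move=> /expL h; have [|l hl] := fd (c + cexp z).
    by rewrite addrC addKr abs_cexp.
  exists (l * (0 + cexp z)); apply: (cdiff_comp (f := fun z => c + cexp z) _ hl).
  exact: cdiffD (hdiff_cst _ _) (cdiff_cexp z).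
have [F dF] := halfplane_primitive Hd.
have HP z : H (z + twopii) = H z by rewrite /H cexp_periodic.
have re2 z (t : R) : re (z + t%:C * twopii) = re z.
  by rewrite reD reRM /re /= mulr0 addr0.
pose P z := F (z + twopii) - F z.
have dP z : re z < L -> cdiff P z 0.
  move=> hz; have h1 := dF _ hz.
  have h2 : cdiff F (z + twopii) (H z).
    by rewrite -HP; apply: dF; rewrite -[twopii]mul1r re2.
  have h3 := cdiff_comp (cdiffD (hdiff_id z) (hdiff_cst twopii z)) h2.
  by apply: hdiff_val (cdiffB h3 h1) _ _ => //; ring.
(* [P] has derivative 0 on a convex set, so it is constant by the mean value inequality. *)
have cP x y : re x < L -> re y < L -> P x = P y.
  move=> hx hy; apply/eqP; rewrite eq_sym -subr_eq0 -abs_eq0 eq_le abs_ge0 andbT.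
  have -> : P y - P x = P (x + 1%:C * (y - x)) - P (x + 0%:C * (y - x)).
    by rewrite mul1r mul0r addr0 subrKC.
  apply: (crv_bound (g := fun t => P (x + t%:C * (y - x))) (v := fun=> 0)).
    move=> t tI; rewrite -(mul0r (y - x)); apply: crv_derive_line.
    by apply: dP; exact: (halfplane_convex hx hy tI).
  by move=> t _; rewrite abs0.
have dG x (t : R) : re x < L -> crv_derive
    (fun s => F (x + s%:C * twopii) - f c * (x + s%:C * twopii)) t
    ((H (x + t%:C * twopii) - f c) * twopii).
  move=> hx; apply: (crv_derive_line (F := fun z => F z - f c * z)).
  apply: hdiff_val (cdiffB (dF _ _) (cdiffZ (f c) (hdiff_id _))) _ _ => //.
    by rewrite re2.
  by rewrite mulr1.
have PE x : re x < L -> P x = f c * twopii.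
  move=> hx; apply/eqP; rewrite -subr_eq0 -abs_eq0 eq_le abs_ge0 andbT.
  apply/ler_addgt0Pl => eps e0; rewrite addr0.
  have q0 : 0 < abs twopii + 1 by have := abs_ge0 twopii; lra.
  have [d d0 Hdel] := fc _ (divr_gt0 e0 q0).
  (* Far enough to the left that [cexp] has modulus below [d], so that [H] stays close to [f c] over
     a whole period. *)
  pose x1 := Num.min (ln d) L - 1.
  have m1 : Num.min (ln d) L <= L by rewrite ge_min lexx orbT.
  have m2 : Num.min (ln d) L <= ln d by rewrite ge_min lexx.
  have x1L : re (x1%:C : K) < L by rewrite /re /= /x1; lra.
  rewrite (cP x x1%:C) //.
  have -> : P x1%:C - f c * twopii =
     (F (x1%:C + 1%:C * twopii) - f c * (x1%:C + 1%:C * twopii)) -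
     (F (x1%:C + 0%:C * twopii) - f c * (x1%:C + 0%:C * twopii)).
    by rewrite mul1r mul0r addr0 /P; ring.
  apply: (crv_bound (g := fun t => F (x1%:C + t%:C * twopii) - f c * (x1%:C + t%:C * twopii))).
    by move=> t _; exact: dG.
  move=> t _; rewrite /= absM.
  have : abs (H (x1%:C + t%:C * twopii) - f c) < eps / (abs twopii + 1).
    apply: Hdel; rewrite addrC addKr abs_cexp re2 /re /=.
    by rewrite -[d]lnK ?posrE // ltr_expR /x1; lra.
  move=> /ltW h; apply: le_trans (ler_wpM2r (abs_ge0 _) h) _.
  by rewrite mulrAC ler_pdivrMr // ler_pM2l //; lra.
pose x0 : K := (ln r)%:C.
have x0L : re x0 < L by rewrite /re /= ltr_ln ?posrE.
pose g (t : R) := F (x0 + t%:C * twopii) - f c * (x0 + t%:C * twopii).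
(* The factor -i cancels the i of [twopii], so the point found below makes the real part of
   [k * (f z - f c)] vanish. *)
pose k' : K := k * (0 -i* 1).
have [t _] := mean_value01 (fun t _ => crv_derive_re k' (dG x0 t x0L)).
rewrite -reB -mulrBr.
have -> : F (x0 + 1%:C * twopii) - f c * (x0 + 1%:C * twopii) -
   (F (x0 + 0%:C * twopii) - f c * (x0 + 0%:C * twopii)) = P x0 - f c * twopii.
  by rewrite mul1r mul0r addr0 /P; ring.
rewrite PE // subrr mulr0 {1}/re /= => E.
exists (c + cexp (x0 + t%:C * twopii)).
  by rewrite addrC addKr abs_cexp re2 /re /= lnK.
apply/eqP; rewrite -subr_eq0 -reB -mulrBr -/(H _).
have : k' * ((H (x0 + t%:C * twopii) - f c) * twopii) =
  (pi *+ 2)%:C * (k * (H (x0 + t%:C * twopii) - f c)).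
  have -> : twopii = (pi *+ 2)%:C * (0 +i* 1).
    by apply/eqP; rewrite eq_complex /=; apply/andP; split; apply/eqP; ring.
  have ii : (0 -i* 1) * (0 +i* 1) = 1 :> K.
    by apply/eqP; rewrite eq_complex /=; apply/andP; split; apply/eqP; ring.
  by rewrite /k' -[RHS]mul1r -ii; ring.
move=> E2; move/eqP: E; rewrite E2 reRM eq_sym mulf_eq0 => /orP[|//].
by rewrite gt_eqF // mulrn_wgt0 // pi_gt0.
Qed.

(* [abs (f z) + e * abs (z - c) ^+ 2] is strictly subharmonic, so it attains its
   maximum on the boundary only. *)
Theorem max_principle f c (r M : R) :
  (forall z, abs (z - c) <= r -> ccont f z) ->
  (forall z0, abs (z0 - c) < r -> exists2 d : R, 0 < d & forall z,
      0 < abs (z - z0) < d -> exists l, cdiff f z l) ->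
  (forall z, abs (z - c) = r -> abs (f z) <= M) ->
  forall z, abs (z - c) <= r -> abs (f z) <= M.
Proof.
move=> fc fd hM z1 hz1; rewrite leNgt; apply/negP => h1.
have z1r : abs (z1 - c) < r.
  rewrite lt_neqAle hz1 andbT; apply/eqP => /hM; lra.
have r0 : 0 < r by apply: le_lt_trans z1r; exact: abs_ge0.
have r20 : 0 < r ^+ 2 by rewrite exprn_gt0.
(* Half of the excess of |f z1| over [M] is spent on [e * r ^+ 2], so [u] stays below [u z1] on the
   boundary circle. *)
pose e := (abs (f z1) - M) / (2 * r ^+ 2).
have e0 : 0 < e by rewrite divr_gt0 ?mulr_gt0 //; lra.
have er : 2 * (e * r ^+ 2) = abs (f z1) - M.
  by rewrite /e; field; rewrite gt_eqF.
pose u z := abs (f z) + e * abs (z - c) ^+ 2.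
have [||z0 hz0 umax] := @EVT_annulus R u c 0 r.
- by rewrite lexx ltW.
- move=> z /andP[_ hz] eps eps0.
  have eps20 : 0 < eps / 2 by lra.
  have [d d0 Hd] := fc _ hz _ eps20.
  have er0 : 0 < 4 * e * r by apply: mulr_gt0 => //; apply: mulr_gt0.
  exists (Num.min d (eps / (4 * e * r))); first by rewrite lt_min d0 divr_gt0.
  move=> w /andP[_ hw]; rewrite lt_min ltr_pdivlMr // => /andP[/Hd w1 w2].
  have k1 := abs_lerB (f w) (f z); have k2 := abs_lerB (f z) (f w).
  rewrite absC in k2.
  have k3 := abs_lerB (w - c) (z - c); have k4 := abs_lerB (z - c) (w - c).
  have E1 : w - c - (z - c) = w - z by ring.
  have E2 : z - c - (w - c) = z - w by ring.
  rewrite E1 in k3; rewrite E2 (absC z w) in k4.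
  have p1 := abs_ge0 (w - c); have p2 := abs_ge0 (z - c).
  have p3 := abs_ge0 (w - z).
  have q1 : `|abs (w - c) ^+ 2 - abs (z - c) ^+ 2| <= 2 * r * abs (w - z).
    rewrite subr_sqr normrM mulrC; apply: ler_pM => //.
      by rewrite ger0_norm ?addr_ge0 //; lra.
    by rewrite ler_norml; lra.
  have q2 : e * `|abs (w - c) ^+ 2 - abs (z - c) ^+ 2| <= e * (2 * r * abs (w - z)).
    by rewrite ler_pM2l.
  rewrite /u opprD addrACA -mulrBr; apply: le_lt_trans (ler_normD _ _) _.
  rewrite [`|e * _|]normrM (ger0_norm (ltW e0)).
  have : `|abs (f w) - abs (f z)| <= abs (f w - f z) by rewrite ler_norml; lra.
  lra.
have u1 : u z1 <= u z0 by apply: umax; rewrite abs_ge0.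
have e1 : 0 <= e * abs (z1 - c) ^+ 2 by rewrite mulr_ge0 ?exprn_ge0 ?abs_ge0 ?ltW.
have z0r : abs (z0 - c) < r.
  rewrite lt_neqAle; case/andP: hz0 => _ ->; rewrite andbT; apply/eqP => h.
  have := hM _ h; rewrite /u h in u1 e1 *.
  have : 0 < e * r ^+ 2 by rewrite mulr_gt0.
  lra.
have [d d0 Hd] := fd _ z0r.
have [k [k1 kE]] := phase_ex (f z0).
(* The linear term reproduces the cross term of |z - c|^2 expanded about [z0]; equal real parts of
   [g] then leave [u] a gain of [e * (rho / 2) ^+ 2]. *)
pose g z := k * f z + (2 * e)%:C * (z0 - c)^* * (z - z0).
pose rho := Num.min d (r - abs (z0 - c)).
have rho0 : 0 < rho by rewrite lt_min d0 subr_gt0.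
have dl z : cdiff (fun z => (2 * e)%:C * (z0 - c)^* * (z - z0)) z
    ((2 * e)%:C * (z0 - c)^* * (1 - 0)).
  by apply: cdiffZ; apply: cdiffB (hdiff_id _) (hdiff_cst _ _).
have gc : ccont g z0.
  apply: ccontD; last exact: cdiff_cont (dl _).
  by apply: ccontM; [exact: hdiff_cont (hdiff_cst k z0)|apply: fc; exact: ltW].
have gd z : 0 < abs (z - z0) < rho -> exists l, cdiff g z l.
  rewrite lt_min => /andP[zz0 /andP[zd _]].
  have [|l hl] := Hd z; first by rewrite zz0.
  exists (k * l + (2 * e)%:C * (z0 - c)^* * (1 - 0)).
  exact: cdiffD (cdiffZ k hl) (dl z).
have rr : 0 < rho / 2 < rho by lra.
have [z hz] := mean_value_circle 1 gc gd rr.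
rewrite !mul1r /g subrr mulr0 addr0 kE {2}/re /= => E.
have zr : abs (z - c) <= r.
  have -> : z - c = (z - z0) + (z0 - c) by ring.
  apply: le_trans (absD _ _) _; rewrite hz.
  have : rho <= r - abs (z0 - c) by rewrite ge_min lexx orbT.
  lra.
have uz : u z <= u z0 by apply: umax; rewrite abs_ge0.
have h2 : re (k * f z) <= abs (f z).
  by apply: le_trans (ler_norm _) _; apply: le_trans (re_le_abs _) _; rewrite absM k1 mul1r.
have h3 : abs (z - c) ^+ 2 = (rho / 2) ^+ 2 + 2 * re ((z0 - c)^* * (z - z0))
    + abs (z0 - c) ^+ 2.
  rewrite -hz.
  have -> : z - c = (z - z0) + (z0 - c) by ring.
  case: (z - z0) => x y; case: (z0 - c) => x' y'; rewrite !abs_sqr /re /im /=; ring.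
have h4 : 0 < e * (rho / 2) ^+ 2 by rewrite mulr_gt0 // exprn_gt0 //; lra.
move: E uz; rewrite reD -mulrA reRM /u h3 !mulrDr; lra.
Qed.

End MeanValue.

(** * Removable singularities, division, and differentiability of derivatives *)

Section Removable.
Variable R : realType.
Local Notation K := R[i].
Implicit Types (f k d : K -> K) (z w c : K).

(** [S] collects the eventual lower bounds of [u] near [c]; its supremum, the lower limit, is the
    limit under the Cauchy condition. *)
Lemma cauchy_at_point (u : K -> R) (c : K) :
  (forall eps : R, 0 < eps -> exists2 del : R, 0 < del & forall z w,
     0 < abs (z - c) < del -> 0 < abs (w - c) < del -> `|u z - u w| <= eps) ->
  exists l, forall eps : R, 0 < eps -> exists2 del : R, 0 < del & forall z,
     0 < abs (z - c) < del -> `|u z - l| <= eps.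
Proof.
move=> hu.
pose S := [set x : R | exists2 del : R, 0 < del & forall z,
   0 < abs (z - c) < del -> x <= u z]%classic.
have pt (del : R) : 0 < del -> exists z, 0 < abs (z - c) < del.
  move=> h; exists (c + (del / 2)%:C); rewrite addrC addKr absR gtr0_norm; lra.
have key (eps : R) : 0 < eps -> exists2 del : R, 0 < del & forall z,
     0 < abs (z - c) < del -> S (u z - eps) /\ ubound S (u z + eps).
  move=> e0; have [del del0 H] := hu _ e0; exists del => // z hz; split.
    by exists del => // w hw; have := H _ _ hz hw; rewrite ler_norml; lra.
  move=> x [d d0 Hx]; have [|w] := pt (Num.min del d); first by rewrite lt_min del0.
  rewrite lt_min => /and3P[w0 w1 w2].
  have := H _ w hz; have := Hx w; rewrite w0 w1 w2 => /(_ isT) h1 /(_ isT).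
  by rewrite ler_norml; lra.
have hS : has_sup S.
  have [d d0 H] := key 1 ltr01; have [z hz] := pt _ d0; have [h1 h2] := H _ hz.
  by split; [exists (u z - 1)|exists (u z + 1)].
exists (sup S) => eps e0; have [d d0 H] := key _ e0; exists d => // z /H[h1 h2].
have := sup_upper_bound hS h1; have := sup_le_ub hS.1 h2.
by rewrite ler_norml; lra.
Qed.

Lemma abs_mulV_le (x y : K) (a b : R) : abs x <= a -> 0 < b -> b <= abs y ->
  abs (x / y) <= a / b.
Proof.
move=> h1 b0 h2; rewrite absM absV; apply: ler_pM; rewrite ?abs_ge0 ?invr_ge0 //.
  exact: abs_ge0.
by rewrite lef_pV2 ?posrE //; exact: lt_le_trans h2.
Qed.

Section Quotients.
Variables (k d : K -> K) (c : K) (rho : R).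
Hypothesis rho0 : 0 < rho.
Hypothesis kc : ccont k c.
Hypothesis kd : forall z, 0 < abs (z - c) < rho -> cdiff k z (d z).

(** Filling in [d w] on the diagonal makes [E w] continuous on the disk for [w] different from [c].
    [Q] is its counterpart at [c], where no derivative is known yet. *)
Let E w z := if z == w then d w else (k z - k w) / (z - w).
Let Q z := (k z - k c) / (z - c).

Let kcont z : abs (z - c) < rho -> ccont k z.
Proof.
move=> h; have [->//|zc] := eqVneq z c.
by apply: cdiff_cont; apply: kd; rewrite h abs_gt0 subr_eq0 zc.
Qed.

Let quot_cdiff w z l : z != w -> cdiff k z l -> exists l', cdiff (E w) z l'.
Proof.
move=> zw hl; have zw0 : 0 < abs (z - w) by rewrite abs_gt0 subr_eq0.
have h := cdiff_div (cdiffB hl (hdiff_cst (k w) z))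
  (cdiffB (hdiff_id z) (hdiff_cst w z)).
eexists; apply: (hdiff_ext zw0 _ (h _)); last by rewrite subr_eq0.
move=> x hx; rewrite /E; case: eqP => // xw.
by move: hx; rewrite xw absC ltxx.
Qed.

Let E_cont w z : 0 < abs (w - c) < rho -> abs (z - c) < rho -> ccont (E w) z.
Proof.
move=> hw hz; have [->|zw] := eqVneq z w.
  move=> eps e0; have e20 : 0 < eps / 2 by lra.
  have [del del0 H] := kd hw e20; exists del => // x xd.
  rewrite /E eqxx; case: eqP => [_|/eqP xw]; first by rewrite subrr abs0.
  have x0 : 0 < abs (x - w) by rewrite abs_gt0 subr_eq0.
  have -> : (k x - k w) / (x - w) - d w =
     (k x - k w - (d w * (x - w) + 0 * (x - w)^*)) / (x - w).
    by field; rewrite subr_eq0.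
  apply: le_lt_trans (abs_mulV_le (H _ xd) x0 (lexx _)) _.
  by rewrite mulfK ?gt_eqF //; lra.
have zw0 : 0 < abs (z - w) by rewrite abs_gt0 subr_eq0.
have h1 : ccont (fun x => k x - k w) z.
  by apply: ccontD (kcont hz) _; exact: cdiff_cont (hdiff_cst (- k w) z).
have h2 : ccont (fun x => (x - w)^-1) z.
  have h := cdiffB (hdiff_id z) (hdiff_cst w z).
  have zw' : z - w != 0 by rewrite subr_eq0.
  exact: cdiff_cont (cdiff_comp (f := fun x => x - w) h (cdiff_inv zw')).
apply: (ccont_ext zw0 _ (ccontM h1 h2)) => x hx; rewrite /E; case: eqP => // xw.
by move: hx; rewrite xw absC ltxx.
Qed.

Let r := rho / 2.
Let r0 : 0 < r. Proof. by rewrite divr_gt0. Qed.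
Let rrho : r < rho.
Proof. by rewrite /r ltr_pdivrMr // mulr_natr mulr2n ltrDl. Qed.

(** On a circle about [c] the denominators stay away from 0, so continuity of [k] at [c] makes the
    convergence of [E w] to [Q] uniform in [z]. *)
Let sphere_close (eta : R) : 0 < eta -> exists2 del : R, 0 < del <= r / 2 &
  forall w z, 0 < abs (w - c) < del -> abs (z - c) = r -> abs (E w z - Q z) <= eta.
Proof.
move=> eta0; have [r0' rr'] := (r0, rrho).
have [||z1 _ hM] := @EVT_annulus R (fun z => abs (k z - k c)) c r r.
- by rewrite lexx ltW.
- move=> z /andP[_ hz] eps e0; have [del del0 H] := kcont (le_lt_trans hz rrho) e0.
  exists del => // w _ /H h.
  have k1 := abs_lerB (k w - k c) (k z - k c).
  have k2 := abs_lerB (k z - k c) (k w - k c).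
  have E1 : k w - k c - (k z - k c) = k w - k z by ring.
  have E2 : k z - k c - (k w - k c) = k z - k w by ring.
  rewrite E1 in k1; rewrite E2 (absC (k z) (k w)) in k2.
  by rewrite ltr_norml; lra.
pose M := abs (k z1 - k c) + 1.
have M0 : 0 < M by rewrite /M; have := abs_ge0 (k z1 - k c); lra.
(* Each of the two terms of the numerator will be at most eta r^2 / 4, against a denominator of at
   least r^2 / 2. *)
have e10 : 0 < eta * r / 4 by rewrite divr_gt0 ?mulr_gt0.
have e20 : 0 < eta * r ^+ 2 / (4 * M).
  by rewrite divr_gt0 ?mulr_gt0 ?exprn_gt0.
have [d1 d10 H1] := kc e10.
exists (Num.min d1 (Num.min (r / 2) (eta * r ^+ 2 / (4 * M)))).
  by rewrite !lt_min d10 e20 !ge_min lexx orbT andbT /= divr_gt0.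
move=> w z /andP[w0]; rewrite !lt_min => /and3P[w1 w2 w3] hz.
have zwr : r / 2 <= abs (z - w).
  have := abs_lerB (z - c) (w - c).
  have -> : z - c - (w - c) = z - w by ring.
  rewrite hz; lra.
have zc0 : z - c != 0 by rewrite -abs_gt0 hz.
have zw0 : z - w != 0 by rewrite -abs_gt0; lra.
have zw : z == w = false by apply/eqP => zw; rewrite zw subrr eqxx in zw0.
rewrite /E zw /Q.
have -> : (k z - k w) / (z - w) - (k z - k c) / (z - c) =
   ((k c - k w) * (z - c) + (w - c) * (k z - k c)) / ((z - c) * (z - w)).
  by field; rewrite zc0 zw0.
have -> : eta = (eta * r ^+ 2 / 2) / (r * (r / 2)).
  by field; rewrite gt_eqF.
apply: abs_mulV_le.
- apply: le_trans (absD _ _) _; rewrite !absM hz.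
  have h1 : abs (k c - k w) * r <= eta * r / 4 * r.
    by rewrite ler_wpM2r ?ltW // absC H1.
  have h2 : abs (w - c) * abs (k z - k c) <= eta * r ^+ 2 / (4 * M) * M.
    apply: ler_pM; rewrite ?abs_ge0 //; first exact: ltW.
    apply: le_trans (hM _ _) _; first by rewrite hz lexx.
    by rewrite /M; lra.
  have h3 : eta * r ^+ 2 / (4 * M) * M = eta * r ^+ 2 / 4.
    by field; rewrite gt_eqF.
  rewrite h3 in h2; rewrite expr2 in h2 *; lra.
- by rewrite mulr_gt0 // divr_gt0.
- by rewrite absM hz ler_pM2l.
Qed.

(** Closeness on the circle spreads inward by the maximum principle. It is applied to the difference
    of [E w] and [E w'], because continuity of [Q] at [c] is still open; afterwards [w'] is moved
    towards [c] with [z] fixed. *)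
Lemma quotients_close (eta : R) : 0 < eta -> exists2 del : R, 0 < del &
  forall w z, 0 < abs (w - c) < del -> 0 < abs (z - c) < del ->
    abs (E w z - Q z) <= eta.
Proof.
have [r0' rr'] := (r0, rrho); move=> eta0; have eta40 : 0 < eta / 4 by lra.
have [del /andP[del0 delr] H] := sphere_close eta40.
exists del => // w z hw hz.
have inrho x : abs (x - c) <= r -> abs (x - c) < rho by move=> /le_lt_trans; exact.
have indel x : 0 < abs (x - c) < del -> 0 < abs (x - c) < rho.
  by move=> /andP[-> h] /=; lra.
have step w' : 0 < abs (w' - c) < del -> forall x, abs (x - c) <= r ->
    abs (E w x - E w' x) <= eta / 2.
  move=> hw'; apply: (max_principle (f := fun x => E w x - E w' x)).
  - move=> x /inrho hx; apply: ccontD; first exact: E_cont (indel _ hw) hx.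
    apply: (ccont_ext (f := fun x => (-1) * E w' x) ltr01) => [y _|].
      by rewrite mulN1r.
    by apply: ccontM; [exact: cdiff_cont (hdiff_cst (-1) x)|exact: E_cont (indel _ hw') hx].
  - move=> x0 hx0.
    (* The distance to [y], or 1 if [y] is [x0] itself: the punctured disk of this radius about [x0]
       misses [y]. *)
    pose md y := if x0 == y then 1 else abs (x0 - y).
    have md0 y : 0 < md y.
      by rewrite /md; case: eqP => // /eqP h; rewrite abs_gt0 subr_eq0.
    have mdP y x : 0 < abs (x - x0) < md y -> x != y.
      rewrite /md; case: eqP => [->|_] /andP[h1 h2].
        by rewrite -subr_eq0 -abs_gt0.
      by apply/eqP => xy; move: h2; rewrite xy absC ltxx.
    exists (Num.min (md c) (Num.min (md w) (Num.min (md w') (rho - r)))).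
      by rewrite !lt_min !md0 subr_gt0.
    move=> x; rewrite !lt_min => /andP[x1 /and4P[x2 x3 x4 x5]].
    have xc : x != c by apply: mdP; rewrite x1.
    have xw : x != w by apply: mdP; rewrite x1.
    have xw' : x != w' by apply: mdP; rewrite x1.
    have hx : cdiff k x (d x).
      apply: kd; rewrite abs_gt0 subr_eq0 xc /=.
      have -> : x - c = (x - x0) + (x0 - c) by ring.
      by apply: le_lt_trans (absD _ _) _; lra.
    have [l1 hl1] := quot_cdiff xw hx; have [l2 hl2] := quot_cdiff xw' hx.
    by exists (l1 - l2); exact: cdiffB.
  - move=> x hx.
    have -> : E w x - E w' x = (E w x - Q x) - (E w' x - Q x) by ring.
    apply: le_trans (absB _ _) _; have := H _ _ hw hx; have := H _ _ hw' hx; lra.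
have zr : abs (z - c) <= r by move: hz => /andP[_]; lra.
have zc : z - c != 0 by rewrite -abs_gt0; case/andP: hz.
have cQ : ccont (fun y => (k z - k y) / (z - y)) c.
  apply: ccontM.
    apply: ccontD; first exact: cdiff_cont (hdiff_cst (k z) c).
    apply: (ccont_ext (f := fun x => (-1) * k x) ltr01) => [y _|].
      by rewrite mulN1r.
    by apply: ccontM => //; exact: cdiff_cont (hdiff_cst (-1) c).
  have h := cdiffB (hdiff_cst z c) (hdiff_id c).
  exact: cdiff_cont (cdiff_comp (f := fun x => z - x) h (cdiff_inv zc)).
have eta20 : 0 < eta / 2 by lra.
have [d1 d10 H1] := cQ _ eta20.
pose m := Num.min (abs (z - c)) (Num.min d1 del).
have m0 : 0 < m by rewrite /m !lt_min d10 del0 abs_gt0 zc.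
pose w' := c + (m / 2)%:C.
have aw' : abs (w' - c) = m / 2 by rewrite /w' addrC addKr absR gtr0_norm; lra.
have [m1 [m2 m3]] : m <= abs (z - c) /\ m <= d1 /\ m <= del.
  by rewrite /m !ge_min !lexx !orbT.
have hw' : 0 < abs (w' - c) < del by rewrite aw'; lra.
have zw' : (z == w') = false.
  by apply/eqP => zw'; rewrite -zw' in aw'; lra.
have -> : E w z - Q z = (E w z - E w' z) + (E w' z - Q z) by ring.
apply: le_trans (absD _ _) _; rewrite [leRHS]splitr; apply: lerD.
  exact: step.
by rewrite {1}/E zw' ltW // H1 // aw'; lra.
Qed.

(* The difference quotient [E w z] is symmetric in its two arguments, so the
   uniform closeness of [E w] to [Q] makes [Q] Cauchy at [c]. *)
Theorem removable : exists q, cdiff k c q /\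
  forall eps : R, 0 < eps -> exists2 del : R, 0 < del & forall w,
    0 < abs (w - c) < del -> abs (d w - q) <= eps.
Proof.
have Esym z w : z != w -> E z w = E w z.
  move=> zw; rewrite /E eq_sym (negbTE zw).
  have h : z - w != 0 by rewrite subr_eq0.
  have h' : w - z != 0 by rewrite subr_eq0 eq_sym.
  by field; rewrite h h'.
have cau (eps : R) : 0 < eps -> exists2 del : R, 0 < del & forall z w,
     0 < abs (z - c) < del -> 0 < abs (w - c) < del -> abs (Q z - Q w) <= eps.
  move=> e0; have e20 : 0 < eps / 2 by lra.
  have [del del0 H] := quotients_close e20; exists del => // z w hz hw.
  have [->|zw] := eqVneq z w; first by rewrite subrr abs0 ltW.
  have -> : Q z - Q w = (E z w - Q w) - (E w z - Q z) by rewrite (Esym z w) //; ring.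
  apply: le_trans (absB _ _) _; rewrite [leRHS]splitr.
  by apply: lerD; exact: H.
have [|x Hx] := @cauchy_at_point (fun z => re (Q z)) c.
  move=> eps /cau[del del0 H]; exists del => // z w hz hw.
  by rewrite -reB; apply: le_trans (re_le_abs _) _; exact: H.
have [|y Hy] := @cauchy_at_point (fun z => im (Q z)) c.
  move=> eps /cau[del del0 H]; exists del => // z w hz hw.
  by rewrite -imB; apply: le_trans (im_le_abs _) _; exact: H.
pose q : K := x +i* y.
have Hq (eps : R) : 0 < eps -> exists2 del : R, 0 < del & forall z,
     0 < abs (z - c) < del -> abs (Q z - q) <= eps.
  move=> e0; have e20 : 0 < eps / 2 by lra.
  have [d1 d10 H1] := Hx _ e20; have [d2 d20 H2] := Hy _ e20.
  exists (Num.min d1 d2); first by rewrite lt_min d10.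
  move=> z /andP[z0]; rewrite lt_min => /andP[z1 z2].
  apply: le_trans (abs_le_reim _) _; rewrite reB imB [re q]/re [im q]/im /=.
  by rewrite [leRHS]splitr; apply: lerD; [apply: H1|apply: H2]; rewrite z0.
exists q; split=> eps e0.
  have [del del0 H] := Hq _ e0; exists del => // z hz.
  have [->|zc] := eqVneq z c; first by rewrite !subrr rmorph0 !mulr0 addr0 subr0 abs0 mulr0.
  have zc0 : z - c != 0 by rewrite subr_eq0.
  have -> : k z - k c - (q * (z - c) + 0 * (z - c)^*) = (Q z - q) * (z - c).
    by rewrite /Q; field.
  by rewrite absM ler_wpM2r ?abs_ge0 // H // abs_gt0 zc0.
have e20 : 0 < eps / 2 by lra.
have [d1 d10 H1] := Hq _ e20; have [d2 d20 H2] := quotients_close e20.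
exists (Num.min d1 d2); first by rewrite lt_min d10.
move=> w /andP[w0]; rewrite lt_min => /andP[w1 w2].
(* On the diagonal [E w w] is [d w], so closeness to [Q] also gives the limit of the derivative. *)
have -> : d w - q = (E w w - Q w) + (Q w - q) by rewrite /E eqxx; ring.
apply: le_trans (absD _ _) _; rewrite [leRHS]splitr.
by apply: lerD; [apply: H2|apply: H1]; rewrite w0.
Qed.

End Quotients.

Definition holo f c (rho : R) := forall z, abs (z - c) < rho -> exists l, cdiff f z l.

Lemma holo_deriv_fun f c rho : holo f c rho ->
  exists d, forall z, abs (z - c) < rho -> cdiff f z (d z).
Proof.
move=> hf; have H z : exists l, abs (z - c) < rho -> cdiff f z l.
  have [h|_] := ltP (abs (z - c)) rho; last by exists 0.
  by have [l hl] := hf _ h; exists l.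
by have [d hd] := choice H; exists d.
Qed.

(** The quotient, completed by the derivative of [f], is differentiable off [c] and continuous at
    [c]; [removable] supplies its derivative there. *)
Lemma holo_division f c rho : 0 < rho -> holo f c rho ->
  exists k, [/\ holo k c rho, forall z, f z = f c + (z - c) * k z & cdiff f c (k c)].
Proof.
move=> rho0 /holo_deriv_fun[d hd].
have dc : cdiff f c (d c) by apply: hd; rewrite subrr abs0.
pose k z := if z == c then d c else (f z - f c) / (z - c).
have kE z : f z = f c + (z - c) * k z.
  rewrite /k; case: eqP => [->|/eqP zc]; first by rewrite subrr mul0r addr0.
  by field; rewrite subr_eq0.
have kd z : z != c -> abs (z - c) < rho -> exists l, cdiff k z l.
  move=> zc hz; have zc0 : 0 < abs (z - c) by rewrite abs_gt0 subr_eq0.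
  have h := cdiff_div (cdiffB (hd _ hz) (hdiff_cst (f c) z))
    (cdiffB (hdiff_id z) (hdiff_cst c z)).
  eexists; apply: (hdiff_ext zc0 _ (h _)); last by rewrite subr_eq0.
  move=> x hx; rewrite /k; case: eqP => // xc.
  by move: hx; rewrite xc absC ltxx.
have kcont : ccont k c.
  move=> eps e0; have e20 : 0 < eps / 2 by lra.
  have [del del0 H] := dc _ e20; exists del => // z zd.
  rewrite /k eqxx; case: eqP => [_|/eqP zc]; first by rewrite subrr abs0.
  have z0 : 0 < abs (z - c) by rewrite abs_gt0 subr_eq0.
  have -> : (f z - f c) / (z - c) - d c =
     (f z - f c - (d c * (z - c) + 0 * (z - c)^*)) / (z - c).
    by field; rewrite subr_eq0.
  apply: le_lt_trans (abs_mulV_le (H _ zd) z0 (lexx _)) _.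
  by rewrite mulfK ?gt_eqF //; lra.
have [dk hdk] : exists dk, forall z, 0 < abs (z - c) < rho -> cdiff k z (dk z).
  have H z : exists l, 0 < abs (z - c) < rho -> cdiff k z l.
    have [/andP[h1 h2]|_] := boolP (0 < abs (z - c) < rho); last by exists 0.
    by have [|l hl] := kd z _ h2; [rewrite -subr_eq0 -abs_gt0|exists l].
  by have [dk hdk] := choice H; exists dk.
exists k; split=> //.
  move=> z hz; have [->|zc] := eqVneq z c; last exact: kd.
  by have [q [hq _]] := removable rho0 kcont hdk; exists q.
by rewrite /k eqxx.
Qed.

(** Writing f = f c + (z - c) k gives d = k + (z - c) dk. Since [dk] has a limit at [c] by
    [removable], both terms are differentiable there, each with derivative [q]. *)
Lemma holo_derivative f d c rho : 0 < rho ->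
  (forall z, abs (z - c) < rho -> cdiff f z (d z)) -> exists l, cdiff d c l.
Proof.
move=> rho0 hd.
have hf : holo f c rho by move=> z /hd; exists (d z).
have [k [hk kE kc]] := holo_division rho0 hf.
have [dk hdk] := holo_deriv_fun hk.
have cc : abs (c - c) < rho by rewrite subrr abs0.
have [|q [hq Hq]] := removable rho0 (cdiff_cont (hdk _ cc)) (d := dk).
  by move=> z /andP[_ ?]; exact: hdk.
have dE z : abs (z - c) < rho -> d z = k z + (z - c) * dk z.
  move=> hz; apply: cdiff_uniq (hd _ hz) _.
  apply: (@hdiff_eq _ (fun w => f c + (w - c) * k w)) => [w|]; first by rewrite -kE.
  have h := cdiffD (hdiff_cst (f c) z)
    (cdiffM (cdiffB (hdiff_id z) (hdiff_cst c z)) (hdk _ hz)).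
  by apply: hdiff_val h _ _ => //; ring.
have h2 : cdiff (fun z => (z - c) * dk z) c q.
  move=> eps e0; have [del del0 H] := Hq _ e0; exists del => // z hz.
  have [->|zc] := eqVneq z c; first by rewrite !subrr rmorph0 !mul0r !mulr0 addr0 !subr0 abs0 mulr0.
  have -> : (z - c) * dk z - (c - c) * dk c - (q * (z - c) + 0 * (z - c)^*) =
    (dk z - q) * (z - c) by ring.
  by rewrite absM ler_wpM2r ?abs_ge0 // H // abs_gt0 subr_eq0 zc.
exists (q + q); apply: (hdiff_ext rho0 _ (cdiffD hq h2)) => z /dE; exact: esym.
Qed.

End Removable.

(** * From stable convex harmonic to convex analytic mappings *)

Section OpenMapping.
Variable R : realType.
Local Notation K := R[i].
Implicit Types (T f : K -> K) (z w a b : K).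

Lemma beltrami_lower a b v : (abs a - abs b) * abs v <= abs (a * v + b * v^*).
Proof.
rewrite mulrBl -absM -(absJ v) -absM.
have := abs_lerB (a * v) (- (b * v^*)); by rewrite opprK absN.
Qed.

(** Cramer's rule for the real-linear map taking v to a v + b conj v, whose determinant is |a|^2 -
    |b|^2. *)
Lemma beltrami_solve a b e : abs b < abs a -> exists v, a * v + b * v^* = e.
Proof.
move=> ba; have D0 : abs a ^+ 2 - abs b ^+ 2 != 0.
  rewrite subr_eq0 gt_eqF // ltr_pXn2r ?nnegrE ?abs_ge0 //.
pose D : K := (abs a ^+ 2 - abs b ^+ 2)%:C.
have DE : D = a * a^* - b * b^* by rewrite !mulcJ_abs -RC_B.
have D0' : D != 0 by rewrite -abs_eq0 absR normr_eq0.
have DJ : D^* = D by rewrite /D /= oppr0.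
clearbody D.
exists ((a^* * e - b * e^*) / D).
rewrite rmorphM rmorphB !rmorphM /= conjc_inv !conjcK DJ.
apply: (mulIf D0'); rewrite mulrDl !mulrA !mulfVK //.
by rewrite DE; ring.
Qed.

(** For [w] near [T z0], the distance from [w] to [T] is minimal at an interior point of a small
    closed disk, and a nonzero minimum could be lowered by moving in the direction that the
    differential sends to [w - T z]. *)
Lemma open_mapping T (a b : K -> K) :
  (forall z, abs z < 1 -> hdiff T z (a z) (b z)) ->
  (forall z, abs z < 1 -> abs (b z) < abs (a z)) ->
  (forall z w, abs z < 1 -> abs w < 1 -> T z = T w -> z = w) ->
  forall z0 (eps : R), abs z0 < 1 -> 0 < eps -> exists2 d : R, 0 < d &
    forall w, abs (w - T z0) < d ->
      exists z, [/\ abs z < 1, abs (z - z0) < eps & T z = w].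
Proof.
move=> hT hab inj z0 eps hz0 e0.
pose r := Num.min eps (1 - abs z0) / 2.
have r0 : 0 < r by rewrite divr_gt0 // lt_min e0 subr_gt0.
have r1 : r < eps.
  have : Num.min eps (1 - abs z0) <= eps by rewrite ge_min lexx.
  by rewrite /r in r0 *; lra.
have r2 : r < 1 - abs z0.
  have : Num.min eps (1 - abs z0) <= 1 - abs z0 by rewrite ge_min lexx orbT.
  by rewrite /r in r0 *; lra.
have inD z : abs (z - z0) <= r -> abs z < 1.
  move=> h; have := absD (z - z0) z0; rewrite subrK; lra.
have dist_cont w z : abs (z - z0) <= r -> forall eps', 0 < eps' ->
    exists2 d : R, 0 < d & forall x, abs (x - z) < d ->
      `| - abs (w - T x) - - abs (w - T z)| < eps'.
  move=> hz eps' e0'; have [d d0 H] := hdiff_cont (hT _ (inD _ hz)) e0'.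
  exists d => // x /H h.
  have k1 := abs_lerB (w - T x) (w - T z); have k2 := abs_lerB (w - T z) (w - T x).
  have E1 : w - T x - (w - T z) = T z - T x by ring.
  have E2 : w - T z - (w - T x) = T x - T z by ring.
  rewrite E1 (absC (T z)) in k1; rewrite E2 in k2.
  by rewrite ltr_norml; lra.
have [||z1 /andP[hz1 hz1'] H1] := @EVT_annulus R (fun z => - abs (T z0 - T z)) z0 r r.
- by rewrite lexx ltW.
- move=> z /andP[_ hz] eps' e0'; have [d d0 H] := dist_cont (T z0) z hz _ e0'.
  by exists d => // x _; exact: H.
have h1 : abs (z1 - z0) = r by apply/eqP; rewrite eq_le hz1 hz1'.
pose m := abs (T z0 - T z1).
have m0 : 0 < m.
  rewrite /m abs_gt0 subr_eq0; apply/eqP => /(inj _ _ hz0 (inD _ hz1')) h.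
  by move: h1; rewrite h subrr abs0 => h'; rewrite -h' ltxx in r0.
exists (m / 2); first by rewrite divr_gt0.
move=> w hw.
have [||z /andP[_ hz] H2] := @EVT_annulus R (fun z => - abs (w - T z)) z0 0 r.
- by rewrite lexx ltW.
- move=> z /andP[_ hz] eps' e0'; have [d d0 H] := dist_cont w z hz _ e0'.
  by exists d => // x _; exact: H.
have hz0' := H2 z0; rewrite subrr abs0 lexx ltW // lerN2 in hz0'.
have {}hz0' := hz0' isT.
have zr : abs (z - z0) < r.
  rewrite lt_neqAle hz andbT; apply/eqP => h.
  have := H1 z; rewrite h lexx lerN2 -/m => /(_ isT) h2.
  have := absD (T z0 - w) (w - T z); rewrite addrA subrK (absC (T z0) w); lra.
exists z; split; [exact: inD|lra|].
apply/eqP; rewrite eq_sym -subr_eq0 -abs_eq0 eq_le abs_ge0 andbT leNgt.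
apply/negP => e_gt0; pose e := w - T z.
have zD := inD _ hz.
have [v hv] := beltrami_solve e (hab _ zD).
have v0 : 0 < abs v.
  rewrite abs_gt0; apply/eqP => v0; move: hv; rewrite v0 rmorph0 !mulr0 addr0.
  by move=> h; rewrite -/e -h abs0 ltxx in e_gt0.
have ep : 0 < abs e / (2 * abs v) by rewrite divr_gt0 ?mulr_gt0.
have [d d0 Hd] := hT _ zD _ ep.
(* So short a step stays in the disk and in the range of the linear approximation, whose error is at
   most half of the gain. *)
pose t := Num.min 1 (Num.min d (r - abs (z - z0)) / (2 * abs v)).
have mm0 : 0 < Num.min d (r - abs (z - z0)) by rewrite lt_min d0 subr_gt0.
have t0 : 0 < t by rewrite lt_min ltr01 divr_gt0 ?mulr_gt0.
have t1 : t <= 1 by rewrite ge_min lexx.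
have tv : t * abs v <= Num.min d (r - abs (z - z0)) / 2.
  have : t <= Num.min d (r - abs (z - z0)) / (2 * abs v) by rewrite ge_min lexx orbT.
  by rewrite -(ler_pM2r v0) invfM mulrA divfK // gt_eqF.
have mm1 : Num.min d (r - abs (z - z0)) <= d by rewrite ge_min lexx.
have mm2 : Num.min d (r - abs (z - z0)) <= r - abs (z - z0) by rewrite ge_min lexx orbT.
pose x := z + t%:C * v.
have xz : x - z = t%:C * v by rewrite /x addrC addKr.
have axz : abs (x - z) = t * abs v by rewrite xz absM absR ger0_norm // ltW.
have xr : abs (x - z0) <= r.
  have -> : x - z0 = (x - z) + (z - z0) by ring.
  by apply: le_trans (absD _ _) _; rewrite axz; lra.
have := H2 x; rewrite xr abs_ge0 lerN2 => /(_ isT).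
have : abs (x - z) < d by rewrite axz; lra.
move=> /Hd; rewrite axz xz.
have -> : a z * (t%:C * v) + b z * (t%:C * v)^* = t%:C * e.
  by rewrite conjRM -hv; ring.
have -> : abs e / (2 * abs v) * (t * abs v) = t * abs e / 2.
  by field; rewrite gt_eqF.
move=> k1 k2.
have k3 : abs (w - T x) <= (1 - t) * abs e + t * abs e / 2.
  have -> : w - T x = (1 - t)%:C * e - (T x - T z - t%:C * e).
    by rewrite RC_B /e; ring.
  apply: le_trans (absB _ _) _; apply: lerD => //.
  by rewrite absM absR ger0_norm // subr_ge0.
have : 0 < t * abs e by rewrite mulr_gt0.
rewrite -/e in k2; lra.
Qed.

(** [A] and [B] solve the chain rule equations by Cramer's rule. The lower bound on the differential
    of [T] first yields a Lipschitz bound for [y], then the little-o estimate. *)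
Lemma hdiff_lift T (y : K -> K) x a b a1 b1 : ccont y x ->
  hdiff (fun s => T (y s)) x a1 b1 -> hdiff T (y x) a b -> abs b < abs a ->
  exists A B, [/\ hdiff y x A B, a * A + b * B^* = a1 & a * B + b * A^* = b1].
Proof.
move=> cy hTy hT ab.
have D0 : abs a ^+ 2 - abs b ^+ 2 != 0.
  rewrite subr_eq0 gt_eqF // ltr_pXn2r ?nnegrE ?abs_ge0 //.
pose D : K := (abs a ^+ 2 - abs b ^+ 2)%:C.
have DE : D = a * a^* - b * b^* by rewrite !mulcJ_abs -RC_B.
have D0' : D != 0 by rewrite -abs_eq0 absR normr_eq0.
have DJ : D^* = D by rewrite /D /= oppr0.
clearbody D.
pose A := (a^* * a1 - b * b1^*) / D; pose B := (a^* * b1 - b * a1^*) / D.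
have EA : a * A + b * B^* = a1.
  rewrite /A /B rmorphM rmorphB !rmorphM /= conjc_inv !conjcK DJ.
  by apply: (mulIf D0'); rewrite mulrDl !mulrA !mulfVK // DE; ring.
have EB : a * B + b * A^* = b1.
  rewrite /A /B rmorphM rmorphB !rmorphM /= conjc_inv !conjcK DJ.
  by apply: (mulIf D0'); rewrite mulrDl !mulrA !mulfVK // DE; ring.
clearbody A B; exists A, B; split=> // eps e0.
pose g := abs a - abs b.
have g0 : 0 < g by rewrite subr_gt0.
(* The error of [T] absorbs at most half of [g * abs De]; the other half bounds |De| by this
   multiple of |h|. *)
pose C := (abs a1 + abs b1 + 1) * 2 / g.
have C0 : 0 < C.
  rewrite divr_gt0 // mulr_gt0 //.
  by have := abs_ge0 a1; have := abs_ge0 b1; lra.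
pose e1 := Num.min (g / 2) (eps * g / (2 * C)).
have eg0 : 0 < eps * g by apply: mulr_gt0.
have C20 : 0 < 2 * C by apply: mulr_gt0.
have e10 : 0 < e1 by rewrite lt_min; apply/andP; split; exact: divr_gt0.
have e1g : e1 <= g / 2 by rewrite ge_min lexx.
have e1C : e1 * C <= eps * g / 2.
  have : e1 <= eps * g / (2 * C) by rewrite ge_min lexx orbT.
  by rewrite ler_pdivlMr //; lra.
have e20 : 0 < Num.min 1 (eps * g / 2).
  by rewrite lt_min ltr01 divr_gt0.
have e21 : Num.min 1 (eps * g / 2) <= 1 by rewrite ge_min lexx.
have e22 : Num.min 1 (eps * g / 2) <= eps * g / 2 by rewrite ge_min lexx orbT.
have [d1 d10 H1] := hT _ e10; have [d2 d20 H2] := cy _ d10.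
have [d3 d30 H3] := hTy _ e20.
exists (Num.min d2 d3); first by rewrite lt_min d20.
move=> s; rewrite lt_min => /andP[/H2/H1 s1 /H3 s2].
set De := y s - y x in s1 *; set h := s - x in s2 *.
set ta := T (y s) - _ - _ in s1; set si := T (y s) - _ - _ in s2.
have EM : a * De + b * De^* = a1 * h + b1 * h^* + (si - ta) by rewrite /si /ta; ring.
clearbody ta si; clearbody De h.
have pD := abs_ge0 De; have ph := abs_ge0 h.
have m1 : g * abs De <= (abs a1 + abs b1) * abs h + (abs si + abs ta).
  apply: le_trans (beltrami_lower _ _ _) _; rewrite EM.
  apply: le_trans (absD _ _) _; apply: lerD; first exact: lin_le.
  exact: absB.
have m2 : abs ta <= g / 2 * abs De by apply: le_trans s1 _; rewrite ler_wpM2r.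
have m3 : abs si <= 1 * abs h by apply: le_trans s2 _; rewrite ler_wpM2r.
have m4 : abs De <= C * abs h.
  rewrite /C mulrAC ler_pdivlMr // [abs De * g]mulrC.
  by move: m1 m2 m3; rewrite -!mulrA; nra.
have m5 : abs ta <= eps * g / 2 * abs h.
  apply: le_trans s1 _; apply: le_trans (ler_wpM2l (ltW e10) m4) _.
  by rewrite mulrA ler_wpM2r.
have m6 : abs si <= eps * g / 2 * abs h by apply: le_trans s2 _; rewrite ler_wpM2r.
set er := De - _.
have : a * er + b * er^* = si - ta.
  have -> : si - ta = a * De + b * De^* - (a1 * h + b1 * h^*) by rewrite EM; ring.
  rewrite /er rmorphB rmorphD !rmorphM /= conjcK -EA -EB; ring.
move=> E; have := beltrami_lower a b er; rewrite E -/g => m7.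
rewrite -(ler_pM2l g0); apply: le_trans m7 _; apply: le_trans (absB _ _) _.
have -> : g * (eps * abs h) = eps * g / 2 * abs h + eps * g / 2 * abs h by field.
exact: lerD.
Qed.

(* The curve [y] depends only on the real part of its argument. *)
Lemma segment_lift T (a b : K -> K) z1 z2 :
  (forall z, abs z < 1 -> hdiff T z (a z) (b z)) ->
  (forall z, abs z < 1 -> abs (b z) < abs (a z)) ->
  (forall z w, abs z < 1 -> abs w < 1 -> T z = T w -> z = w) ->
  abs z1 < 1 -> abs z2 < 1 ->
  (forall t : R, 0 <= t <= 1 -> exists2 z, abs z < 1 & T z = T z1 + t%:C * (T z2 - T z1)) ->
  exists y : K -> K, [/\ forall x, abs (y x) < 1, y 0 = z1 /\ y 1 = z2,
    forall x, exists t : R, T (y x) = T z1 + t%:C * (T z2 - T z1),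
    forall x, ccont y x &
    forall x, 0 < re x < 1 -> exists A B, hdiff y x A B /\
      a (y x) * (A + B) + b (y x) * (A + B)^* = T z2 - T z1].
Proof.
move=> hT hab inj hz1 hz2 conv.
have H x : exists z, abs z < 1 /\ T z = T z1 + (clamp (re x))%:C * (T z2 - T z1).
  by have [z ? ?] := conv _ (clamp01 (re x)); exists z.
have [y hy] := choice H.
have cy x : ccont y x.
  move=> eps e0; have [yx1 yx2] := hy x.
  have [d d0 Hd] := open_mapping hT hab inj yx1 e0.
  have q0 : 0 < abs (T z2 - T z1) + 1 by have := abs_ge0 (T z2 - T z1); lra.
  exists (d / (abs (T z2 - T z1) + 1)); first exact: divr_gt0.
  move=> s; rewrite ltr_pdivlMr // => hs; have [ys1 ys2] := hy s.
  have /Hd[z [zD zy zT]] : abs (T (y s) - T (y x)) < d.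
    rewrite yx2 ys2 opprD addrACA subrr add0r -mulrBl -RC_B absM absR.
    apply: le_lt_trans hs; apply: ler_pM; rewrite ?abs_ge0 //; last by rewrite lerDl.
    by apply: le_trans (clamp_lip _ _) _; rewrite -reB re_le_abs.
  (* The preimage near [y x] provided by openness is [y s] itself, by injectivity. *)
  by rewrite (inj _ _ ys1 zD) // zT.
exists y; split=> //.
- by move=> x; case: (hy x).
- split.
    have [h1 h2] := hy 0; apply: inj => //; rewrite h2 clamp_id /re /= ?lexx ?ler01 //.
    by rewrite mul0r addr0.
  have [h1 h2] := hy 1; apply: inj => //; rewrite h2 clamp_id /re /= ?lexx ?ler01 //.
  by rewrite mul1r subrKC.
- by move=> x; exists (clamp (re x)); case: (hy x).
move=> x hx; have [y1 y2] := hy x.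
pose D := T z2 - T z1.
have h1 : hdiff (fun s => T (y s)) x (D * (1 / 2)%:C) (D * (1 / 2)%:C).
  have h := hdiffD (hdiff_cst (T z1) x) (hdiffZ D (hdiff_re (is_derive_id (re x) 1))).
  (* Within this distance of [x] the clamp is inactive. *)
  have m0 : 0 < Num.min (re x) (1 - re x) by rewrite lt_min subr_gt0.
  apply: (hdiff_ext m0 _ (hdiff_val h _ _)); rewrite ?add0r // => s.
  rewrite lt_min => /andP[s1 s2]; have [_ ->] := hy s.
  rewrite clamp_id; first by rewrite mulrC.
  have := re_le_abs (s - x); rewrite reB ler_norml; lra.
have [A [B [hAB E1 E2]]] := hdiff_lift (cy x) h1 (hT _ y1) (hab _ y1).
exists A, B; split=> //; rewrite rmorphD -/D.
have -> : D = D * (1 / 2)%:C + D * (1 / 2)%:C.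
  by rewrite -mulrDr -RC_D -splitr mulr1.
by rewrite -{1}E1 -E2 /=; ring.
Qed.

End OpenMapping.

(** * Univalence and convexity of the analytic functions h + lam g *)

Section StableConvex.
Variable R : realType.
Local Notation K := R[i].
Variables (h g dh dg : K -> K).
Hypothesis hd : forall z, abs z < 1 -> cdiff h z (dh z).
Hypothesis gd : forall z, abs z < 1 -> cdiff g z (dg z).
Hypothesis sense : forall z, abs z < 1 -> abs (dg z) < abs (dh z).
Local Notation T := (fun mu z => h z + mu * (g z)^*).
Hypothesis Tinj : forall mu, abs mu = 1 ->
  forall z w, abs z < 1 -> abs w < 1 -> T mu z = T mu w -> z = w.
Hypothesis Tconv : forall mu, abs mu = 1 -> forall z1 z2, abs z1 < 1 -> abs z2 < 1 ->
  forall t : R, 0 <= t <= 1 ->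
    exists2 z, abs z < 1 & T mu z = T mu z1 + t%:C * (T mu z2 - T mu z1).

Lemma continuous_line (f : K -> K) : (forall x, ccont f x) ->
  continuous (fun t : R => re (f (0 + t%:C * 1))).
Proof.
move=> cf t; apply/cvgrPdist_lt => eps e0.
have [d d0 H] := cf (0 + t%:C * 1) _ e0.
apply/nbhs_ballP; exists d => // s hs0; have hs := hs0 : `|t - s| < d.
rewrite -reB; apply: le_lt_trans (re_le_abs _) _; rewrite absC; apply: H.
by rewrite !add0r !mulr1 -RC_B absR distrC.
Qed.

Section Lift.
Variables (lam kap : K).
Hypotheses (lam1 : abs lam = 1) (kap1 : abs kap = 1).
Let mu := - (kap^* ^+ 2 * lam^*).
Let Phi z := h z + lam * g z.
Let dPhi z := dh z + lam * dg z.

Let mu1 : abs mu = 1.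
Proof. by rewrite absN absM absX !absJ lam1 kap1 expr1n mulr1. Qed.

Let kk : kap * kap^* = 1.
Proof. by rewrite mulcJ_abs kap1 expr1n. Qed.

(** As |kap| = 1, [kap * mu] times conj y is minus the conjugate of [kap * lam * y], and a number
    and minus its conjugate have the same imaginary part. *)
Let im_shear (x y : K) : im (kap * (x + lam * y)) = im (kap * (x + mu * y^*)).
Proof.
have -> : kap * (x + mu * y^*) = kap * x - (kap * kap^*) * (kap * lam * y)^*.
  by rewrite /mu !rmorphM; ring.
rewrite kk mul1r imB mulrDr imD mulrA; congr (_ + _).
by case: (kap * lam * y) => p q; rewrite /im /= opprK.
Qed.

(* With this choice of [mu], [kap * Phi] and [kap * T mu] have the same imaginary
   part, so the preimage under [T mu] of a segment of direction [kap^-1] is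
   mapped by [Phi] into a line of the same direction (the shear construction of
   Clunie and Sheil-Small). *)
Lemma shear_lift z1 z2 : abs z1 < 1 -> abs z2 < 1 ->
  im (kap * (Phi z2 - Phi z1)) = 0 ->
  exists u : R -> R, [/\ continuous u, u 0 = re (kap * Phi z1) /\ u 1 = re (kap * Phi z2),
    forall t, exists z, [/\ abs z < 1, u t = re (kap * Phi z) &
       im (kap * Phi z) = im (kap * Phi z1)] &
    z1 != z2 -> forall t : R, 0 < t < 1 -> exists2 l, is_derive t 1 u l & l != 0].
Proof.
move=> hz1 hz2 im0.
have hT z : abs z < 1 -> hdiff (T mu) z (dh z) (mu * (dg z)^*).
  move=> hz; have h1 := hdiffD (hd hz) (hdiffZ mu (hdiffJ (gd hz))).
  by apply: hdiff_val h1 _ _; rewrite ?rmorph0; ring.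
have hab z : abs z < 1 -> abs (mu * (dg z)^*) < abs (dh z).
  by move=> hz; rewrite absM mu1 mul1r absJ; exact: sense.
have [y [yD [y0 y1] yT yc yd]] := segment_lift hT hab (Tinj mu1) hz1 hz2
  (Tconv mu1 hz1 hz2).
have dPhiP z : abs z < 1 -> cdiff Phi z (dPhi z).
  by move=> hz; exact: cdiffD (hd hz) (cdiffZ lam (gd hz)).
have Pc x : ccont (fun x => kap * Phi (y x)) x.
  apply: ccontM; first exact: cdiff_cont (hdiff_cst kap x).
  exact: ccont_comp (yc x) (cdiff_cont (dPhiP _ (yD x))).
have Dim : im (kap * (T mu z2 - T mu z1)) = 0.
  by rewrite -im0 /Phi !mulrBr !imB !im_shear.
exists (fun t => re (kap * Phi (y (0 + t%:C * 1)))); split.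
- exact: (continuous_line (f := fun x => kap * Phi (y x))).
- by rewrite mul0r mul1r addr0 add0r y0 y1.
- move=> t; exists (y (0 + t%:C * 1)); split=> //.
  have [s E] := yT (0 + t%:C * 1).
  by rewrite !im_shear E mulrDr imD mulrCA imRM Dim mulr0 addr0.
move=> z12 t tI; pose x : K := 0 + t%:C * 1.
have xI : 0 < re x < 1 by rewrite /x add0r mulr1.
have [A [B [hAB EAB]]] := yd x xI.
have hl := hdiff_line (hdiffZ kap (hdiff_comp hAB (dPhiP _ (yD x)))).
eexists; first exact: hl.
rewrite rmorph1 !mulr1 !mul0r !addr0; apply/eqP => re0.
pose v := A + B.
have {}re0 : re (kap * (dPhi (y x) * v)) = 0.
  by rewrite -re0; congr re; rewrite /v; ring.
(* The imaginary part vanishes by the shear, so the product of [kap], [dPhi] and [v] is 0. No factor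
   can be: [dPhi] by sense preservation, [v] because [T] separates the endpoints. *)
have im0' : im (kap * (dPhi (y x) * v)) = 0.
  have -> : dPhi (y x) * v = dh (y x) * v + lam * (dg (y x) * v) by rewrite /dPhi; ring.
  rewrite im_shear rmorphM -Dim -EAB -/v; congr (im (_ * _)); rewrite /=; ring.
have /eqP : kap * (dPhi (y x) * v) = 0.
  by apply: complexP; [exact: re0|exact: im0'].
rewrite !mulf_eq0 => /or3P[/eqP k0|/eqP dP0|/eqP v0].
- by move: kap1; rewrite k0 abs0 => /eqP; rewrite eq_sym oner_eq0.
- have := sense (yD x); have := abs_lerB (dh (y x)) (- (lam * dg (y x))).
  by rewrite opprK -/(dPhi _) dP0 abs0 absN absM lam1 mul1r; lra.
- move: EAB; rewrite -/v v0 rmorph0 !mulr0 addr0 => /eqP; rewrite eq_sym subr_eq0.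
  by move=> /eqP/(Tinj mu1 hz2 hz1) E; rewrite E eqxx in z12.
Qed.

End Lift.

(** Equal values make every direction admissible; the lift for [kap = 1] then contradicts Rolle's
    theorem. *)
Theorem stable_analytic_inj lam : abs lam = 1 -> forall z w, abs z < 1 -> abs w < 1 ->
  h z + lam * g z = h w + lam * g w -> z = w.
Proof.
move=> lam1 z w hz hw E; apply/eqP; apply/negPn/negP => zw.
have [u [cu [u0 u1] _ /(_ zw) du]] : exists u : R -> R, [/\ continuous u,
    u 0 = re (1 * (h z + lam * g z)) /\ u 1 = re (1 * (h w + lam * g w)),
    forall t, exists x, [/\ abs x < 1, u t = re (1 * (h x + lam * g x)) &
       im (1 * (h x + lam * g x)) = im (1 * (h z + lam * g z))] &
    z != w -> forall t : R, 0 < t < 1 -> exists2 l, is_derive t 1 u l & l != 0].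
  by apply: shear_lift => //; rewrite ?abs1 // E subrr mulr0.
have [||||c cI dc0] := @Rolle R u 0 1.
- exact: ltr01.
- by move=> x; rewrite in_itv /= => /du[l [? _] _].
- by apply: continuous_subspaceT => x; exact: cu.
- by rewrite u0 u1 E.
move: cI; rewrite in_itv /= => /du[l hl /eqP]; apply.
by case: dc0 => _ <-; case: hl => _ <-.
Qed.

(** With [kap] rotating the chord onto the real axis, the intermediate value theorem for [u] reaches
    the required real part while the imaginary part stays constant. *)
Theorem stable_analytic_convex lam : abs lam = 1 ->
  forall z w (t : R), abs z < 1 -> abs w < 1 -> 0 <= t <= 1 ->
  exists2 x, abs x < 1 & h x + lam * g x =
    h z + lam * g z + t%:C * ((h w + lam * g w) - (h z + lam * g z)).
Proof.
move=> lam1 z w t hz hw tI.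
pose Phi z := h z + lam * g z; rewrite -/(Phi z) -/(Phi w).
have [k [k1 kE]] := phase_ex (Phi w - Phi z).
have im0 : im (k * (Phi w - Phi z)) = 0 by rewrite kE.
have [u [cu [u0 u1] uz _]] := shear_lift lam1 k1 hz hw im0.
have [||c _ uc] := @IVT R u 0 1 ((1 - t) * u 0 + t * u 1) ler01.
- by apply: continuous_subspaceT => x; exact: cu.
- case/andP: tI => t0 t1.
  have [h01|h10] := leP (u 0) (u 1).
    have : 0 <= t * (u 1 - u 0) by rewrite mulr_ge0 // subr_ge0.
    have : 0 <= (1 - t) * (u 1 - u 0) by rewrite mulr_ge0 // subr_ge0.
    lra.
  have : 0 <= t * (u 0 - u 1) by rewrite mulr_ge0 // subr_ge0 ltW.
  have : 0 <= (1 - t) * (u 0 - u 1) by rewrite mulr_ge0 // subr_ge0 // ltW.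
  lra.
have [x [xD ux ix]] := uz c; exists x => //.
have kn0 : k != 0 by rewrite -abs_eq0 k1 oner_eq0.
have E : k * (Phi z + t%:C * (Phi w - Phi z)) =
  k * Phi z + t%:C * (k * (Phi w - Phi z)) by ring.
apply: (mulfI kn0); rewrite E; apply: complexP.
  by rewrite -ux uc u0 u1 reD reRM mulrBr reB /Phi; ring.
by rewrite ix imD imRM im0 mulr0 addr0.
Qed.

End StableConvex.

(** * Growth and distortion of convex analytic functions *)

Section ConvexFunctions.
Variable R : realType.
Local Notation K := R[i].

(** X^n - 1 splits and is separable in characteristic 0, so it has n distinct roots, one of them
    primitive. *)
Lemma prim_root_ex n : (0 < n)%N -> exists x : K, n.-primitive_root x.
Proof.
move=> n0; pose p : {poly K} := 'X^n - 1.
have [r Dp] := closed_field_poly_normal (p : {poly C R}).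
rewrite (monicP _) ?monicXnsubC // scale1r in Dp.
have rn1 : all n.-unity_root r by apply/allP => z; rewrite -root_prod_XsubC -Dp.
have szr : (n < (size r).+1)%N.
  by rewrite -(size_prod_XsubC r id) -Dp size_XnsubC.
have [|z _ hz] := hasP (has_prim_root n0 rn1 _ szr); last by exists z.
by rewrite -separable_prod_XsubC -Dp separable_Xn_sub_1 // pnatr_eq0 -lt0n.
Qed.

Lemma unity_root_abs n (x : K) : (0 < n)%N -> x ^+ n = 1 -> abs x = 1.
Proof.
move=> n0 h; apply/eqP; rewrite -(@pexpr_eq1 _ _ n) ?abs_ge0 //.
by rewrite -absX h abs1.
Qed.

Lemma prim_root_sum n (x : K) k : n.-primitive_root x -> (0 < k < n)%N ->
  \sum_(j < n) (x ^+ k) ^+ j = 0.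
Proof.
move=> hx /andP[k0 kn]; have /eqP := subrX1 (x ^+ k) n.
rewrite -exprM mulnC exprM (prim_expr_order hx) expr1n subrr eq_sym mulf_eq0.
move=> /orP[|/eqP //]; rewrite subr_eq0 -(prim_order_dvd hx) => /(dvdn_leq k0).
by rewrite leqNgt kn.
Qed.

Lemma convex_average (P : K -> Prop) (F : nat -> K) n :
  (forall x y (t : R), P x -> P y -> 0 <= t <= 1 -> P (x + t%:C * (y - x))) ->
  (forall j, P (F j)) -> (0 < n)%N -> P (n%:R^-1 * \sum_(j < n) F j).
Proof.
move=> cP PF; case: n => // n _; elim: n => [|n IH].
  by rewrite big_ord1 invr1 mul1r.
(* The new average lies at parameter 1 / (n + 2) on the way from the old average to the new
   point. *)
have := cP _ (F n.+1) (n.+2%:R^-1) IH (PF _).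
rewrite RC_V RC_nat invr_ge0 ler0n invf_le1 ?ltr0n // ler1n => /(_ isT).
rewrite [in X in _ -> X]big_ord_recr /=; set S := \sum_(j < n.+1) _.
congr P; have n1 : n.+1%:R != 0 :> K by rewrite pnatr_eq0.
have n2 : n.+2%:R != 0 :> K by rewrite pnatr_eq0.
have E : n.+2%:R = n.+1%:R + 1 :> K by rewrite natr1.
rewrite {}E in n2 *; move: (n.+1%:R : K) n1 n2 => a n1 n2.
by field; rewrite n1 n2.
Qed.

Lemma bernoulli (x : R) n : 0 <= x <= 1 -> 1 - n%:R * x <= (1 - x) ^+ n.
Proof.
move=> /andP[x0 x1]; elim: n => [|n IH]; first by rewrite mul0r subr0.
rewrite exprS; apply: le_trans (ler_wpM2l _ IH); last by rewrite subr_ge0.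
rewrite -natr1; have : 0 <= (n%:R : R) by rewrite ler0n.
by have := sqr_ge0 x; nra.
Qed.

Lemma holo_cont (f : K -> K) c rho z : holo f c rho -> abs (z - c) < rho -> ccont f z.
Proof. by move=> hf /hf[l /cdiff_cont]. Qed.

Lemma max_principle_holo (f : K -> K) (r M : R) : r < 1 -> holo f 0 1 ->
  (forall z, abs z = r -> abs (f z) <= M) -> forall z, abs z <= r -> abs (f z) <= M.
Proof.
move=> r1 hf hM z hz; apply: (@max_principle _ f 0 r M); rewrite ?subr0 //.
- by move=> x hx; apply: holo_cont hf _; exact: le_lt_trans hx r1.
- move=> x; rewrite subr0 => hx; exists (r - abs x); first by rewrite subr_gt0.
  move=> y /andP[_ hy]; apply: hf; rewrite subr0.
  by have := absD (y - x) x; rewrite subrK; lra.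
- by move=> x; rewrite subr0; exact: hM.
Qed.

(** The maximum principle on the circle of radius 1 - x gives (1 - x)^n |psi z| <= 1; Bernoulli's
    inequality makes this linear in [x], and a small [x] finishes without a limit. *)
Lemma schwarz_order (psi : K -> K) n : holo psi 0 1 ->
  (forall z, abs z < 1 -> abs (z ^+ n * psi z) <= 1) ->
  forall z, abs z < 1 -> abs (psi z) <= 1.
Proof.
move=> hpsi hb z hz; set M := abs (psi z).
have key (x : R) : 0 < x <= 1 - abs z -> (1 - n%:R * x) * M <= 1.
  move=> /andP[x0 x1]; have z0 := abs_ge0 z.
  have [x1'|x1'] := eqVneq x 1.
    have zz : z = 0 by apply/eqP; rewrite -abs_eq0; lra.
    case: (n) hb => [|k] hb; last first.
      rewrite x1' mulr1; apply: le_trans (_ : 0 <= 1); last by [].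
      rewrite mulr_le0_ge0 ?abs_ge0 // subr_le0 -natr1 lerDr ler0n //.
    by have := hb z hz; rewrite mul0r subr0 expr0 !mul1r.
  have r0 : 0 < 1 - x by rewrite subr_gt0 lt_neqAle x1'; lra.
  have r1 : 1 - x < 1 by lra.
  have hM : M <= ((1 - x) ^+ n)^-1.
    apply: (max_principle_holo r1 hpsi) => [y hy|]; last by lra.
    have := hb y; rewrite absM absX hy => /(_ r1).
    by rewrite mulrC -ler_pdivlMr ?exprn_gt0 // mul1r.
  have h1 : (1 - n%:R * x) <= (1 - x) ^+ n by apply: bernoulli; lra.
  apply: le_trans (ler_wpM2r (abs_ge0 _) h1) _.
  by rewrite mulrC -ler_pdivlMr ?exprn_gt0 // mul1r.
rewrite leNgt; apply/negP => M1.
have n0 : 0 <= (n%:R : R) by rewrite ler0n.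
have nM : 0 <= n%:R * M by rewrite mulr_ge0 ?abs_ge0.
have q0 : 0 < n%:R * M + 1 by lra.
(* Small enough that [M] minus the loss n x M still exceeds 1. *)
pose x := Num.min (1 - abs z) ((M - 1) / (n%:R * M + 1) / 2).
have Mq : 0 < (M - 1) / (n%:R * M + 1) by rewrite divr_gt0 // subr_gt0.
have x0 : 0 < x by rewrite lt_min subr_gt0 hz /= divr_gt0.
have x1 : x <= 1 - abs z by rewrite ge_min lexx.
have x2 : x * (n%:R * M + 1) <= (M - 1) / 2.
  have : x <= (M - 1) / (n%:R * M + 1) / 2 by rewrite ge_min lexx orbT.
  by rewrite mulrAC ler_pdivlMr.
have := key x; rewrite x0 x1 => /(_ isT); nra.
Qed.

(** * Coefficient bound, growth and distortion *)

Section Coefficients.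
Variables (Phi dPhi : K -> K).
Hypothesis dP : forall z, abs z < 1 -> cdiff Phi z (dPhi z).
Hypotheses (P0 : Phi 0 = 0) (dP0 : dPhi 0 = 1).
Hypothesis dPn0 : forall z, abs z < 1 -> dPhi z != 0.
Hypothesis Pinj : forall z w, abs z < 1 -> abs w < 1 -> Phi z = Phi w -> z = w.
Hypothesis Pconv : forall z w (t : R), abs z < 1 -> abs w < 1 -> 0 <= t <= 1 ->
  exists2 x, abs x < 1 & Phi x = Phi z + t%:C * (Phi w - Phi z).

(** [phi n] is the n-th iterated quotient and [phi n 0] the n-th Taylor coefficient. The implication
    inside [H] lets choice produce a total function to iterate. *)
Lemma taylor_ex (f : K -> K) : holo f 0 1 -> exists phi : nat -> K -> K,
  phi 0%N = f /\ forall n, [/\ holo (phi n) 0 1, cdiff (phi n) 0 (phi n.+1 0) &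
    forall z, phi n z = phi n 0 + z * phi n.+1 z].
Proof.
move=> hf.
have H (g : K -> K) : exists k : K -> K, holo g 0 1 -> [/\ holo k 0 1,
    cdiff g 0 (k 0) & forall z, g z = g 0 + z * k z].
  have [hg|] := pselect (holo g 0 1); last by exists g.
  have [k [h1 h2 h3]] := holo_division ltr01 hg; exists k => _; split=> // z.
  by rewrite {1}h2 subr0.
have [nx hnx] := choice H; exists (fun n => iter n nx f); split=> // n.
have hn : holo (iter n nx f) 0 1.
  by elim: n => [//|n IH] /=; have [] := hnx _ IH.
by have [] := hnx _ hn.
Qed.

Lemma taylor_sum (phi : nat -> K -> K) z n :
  (forall n, phi n z = phi n 0 + z * phi n.+1 z) ->
  phi 0%N z = \sum_(j < n) phi j 0 * z ^+ j + z ^+ n * phi n z.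
Proof.
move=> H; elim: n => [|n ->]; first by rewrite big_ord0 add0r mul1r.
by rewrite big_ord_recr /= -addrA; congr (_ + _); rewrite H exprS; ring.
Qed.

(* The average of [Phi] over rotations by [n]-th roots of unity keeps only the
   multiples of [n] in the expansion and takes its values in the convex image of
   [Phi], so Schwarz's lemma applies to [Phi^-1] of it. *)
Lemma convex_coef (phi : nat -> K -> K) n : phi 0%N = Phi ->
  (forall n, [/\ holo (phi n) 0 1, cdiff (phi n) 0 (phi n.+1 0) &
    forall z, phi n z = phi n 0 + z * phi n.+1 z]) ->
  (0 < n)%N -> abs (phi n 0) <= 1.
Proof.
move=> phi0 H n0.
have phi1 : phi 1%N 0 = 1.
  have [_ h _] := H 0%N; rewrite -dP0; rewrite phi0 in h.
  by apply: cdiff_uniq h (dP _); rewrite abs0.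
have phi1E z : Phi z = z * phi 1%N z.
  by have [_ _ h] := H 0%N; have := h z; rewrite phi0 P0 add0r.
have phi1n0 z : abs z < 1 -> phi 1%N z != 0.
  move=> hz; have [->|z0] := eqVneq z 0; first by rewrite phi1 oner_eq0.
  apply/eqP => h; case/eqP: z0; apply: (Pinj hz); first by rewrite abs0.
  by rewrite P0 phi1E h mulr0.
have [x hx] := prim_root_ex n0.
have xj j z : abs (x ^+ j * z) = abs z.
  by rewrite absM absX (unity_root_abs n0 (prim_expr_order hx)) expr1n mul1r.
have nK0 : n%:R != 0 :> K by rewrite pnatr_eq0 -lt0n.
pose A z := n%:R^-1 * \sum_(j < n) Phi (x ^+ j * z).
pose B z := n%:R^-1 * \sum_(j < n) phi n (x ^+ j * z).
have AE z : A z = z ^+ n * B z.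
  rewrite /A /B mulrCA; congr (_ * _).
  have -> : \sum_(j < n) Phi (x ^+ j * z) =
      \sum_(j < n) (\sum_(k < n) phi k 0 * (x ^+ j * z) ^+ k +
         (x ^+ j * z) ^+ n * phi n (x ^+ j * z)).
    apply: eq_bigr => j _; rewrite -phi0; apply: taylor_sum => m.
    by have [_ _] := H m; exact.
  rewrite big_split /= exchange_big /= big1 ?add0r => [|k _].
    rewrite big_distrr /=; apply: eq_bigr => j _; congr (_ * _).
    by rewrite exprMn -exprM mulnC exprM (prim_expr_order hx) expr1n mul1r.
  have [k0|k0] := posnP k.
    by rewrite k0 phi0 P0; apply: big1 => j _; rewrite mul0r.
  transitivity (phi k 0 * z ^+ k * \sum_(j < n) (x ^+ k) ^+ j).
    rewrite big_distrr /=; apply: eq_bigr => j _.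
    by rewrite exprMn -!exprM [(j * k)%N]mulnC; ring.
  by rewrite (prim_root_sum hx) ?k0 ?ltn_ord // mulr0.
have hA z : abs z < 1 -> exists y, abs y < 1 /\ Phi y = A z.
  move=> hz; pose P w := exists y, abs y < 1 /\ Phi y = w.
  apply: (convex_average (P := P) (F := fun j => Phi (x ^+ j * z))) => //.
    move=> _ _ t [y1 [h1 <-]] [y2 [h2 <-]] tI.
    by have [y ? ?] := Pconv h1 h2 tI; exists y.
  by move=> j; exists (x ^+ j * z); rewrite xj.
have [om hom] : exists om, forall z, abs z < 1 -> abs (om z) < 1 /\ Phi (om z) = A z.
  have H1 z : exists y, abs z < 1 -> abs y < 1 /\ Phi y = A z.
    have [hz|_] := ltP (abs z) 1; last by exists 0.
    by have [y] := hA z hz; exists y.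
  by have [om] := choice H1; exists om.
have rot (f df : K -> K) z : (forall w, abs w < 1 -> cdiff f w (df w)) -> abs z < 1 ->
    exists l, cdiff (fun z => n%:R^-1 * \sum_(j < n) f (x ^+ j * z)) z l.
  move=> hf hz; eexists; apply: cdiffZ.
  apply: (cdiff_sum (F := fun j w => f (x ^+ j * w))) => j _.
  apply: (cdiff_comp (f := fun w => x ^+ j * w)); first exact: cdiffZ (hdiff_id z).
  by apply: hf; rewrite xj.
have Ad z : abs z < 1 -> exists l, cdiff A z l by move=> hz; exact: (rot Phi dPhi).
have [phin_h _ _] := H n.
have Bd z : abs z < 1 -> exists l, cdiff B z l.
  have [dn hdn] := holo_deriv_fun phin_h.
  by move=> hz; apply: (rot (phi n) dn) => // w hw; apply: hdn; rewrite subr0.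
(* The inverse of [Phi] is continuous by openness and differentiable by lifting; the conjugate
   derivative vanishes because [Phi] has none. *)
have omd z : abs z < 1 -> exists l, cdiff om z l.
  move=> hz; have [omz PA] := hom _ hz; have [l hl] := Ad _ hz.
  have dPab w : abs w < 1 -> abs 0 < abs (dPhi w).
    by move=> hw; rewrite abs0 abs_gt0 dPn0.
  have z1 : 0 < 1 - abs z by rewrite subr_gt0.
  have inD s : abs (s - z) < 1 - abs z -> abs s < 1.
    by move=> hs; have := absD (s - z) z; rewrite subrK; lra.
  have co : ccont om z.
    move=> eps e0; have [d d0 Hd] := open_mapping (b := fun=> 0) dP dPab Pinj omz e0.
    have [d1 d10 Hd1] := cdiff_cont hl d0.
    exists (Num.min d1 (1 - abs z)); first by rewrite lt_min d10.
    move=> s; rewrite lt_min => /andP[/Hd1 s1 /inD s2].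
    have [oms PAs] := hom _ s2.
    have [|y [yD yo yE]] := Hd (A s); first by rewrite PA.
    by rewrite (Pinj oms yD) // yE.
  have hPo : hdiff (fun s => Phi (om s)) z l 0.
    by apply: (hdiff_ext z1 _ hl) => s /inD/hom[_ ->].
  have [a [b [hab _ E]]] := hdiff_lift co hPo (dP omz) (dPab _ omz).
  exists a; move: E => /eqP; rewrite mul0r addr0 mulf_eq0 (negbTE (dPn0 omz)) /=.
  by move=> /eqP b0; rewrite b0 in hab.
(* Since A = z^n B and Phi w = w phi_1(w), this is om / z^n written without dividing by z. *)
pose psi z := B z / phi 1%N (om z).
have psiE z : abs z < 1 -> z ^+ n * psi z = om z.
  move=> hz; have [omz PA] := hom _ hz.
  by rewrite /psi mulrA -AE -PA phi1E mulfK ?phi1n0.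
have hpsi : holo psi 0 1.
  move=> z; rewrite subr0 => hz; have [omz PA] := hom _ hz.
  have [l1 h1] := Bd _ hz; have [l2 h2] := omd _ hz.
  have [phi1_h _ _] := H 1%N.
  have [|l3 h3] := phi1_h (om z); first by rewrite subr0.
  by eexists; exact: cdiff_div h1 (cdiff_comp h2 h3) (phi1n0 _ omz).
have zero : abs (0 : K) < 1 by rewrite abs0.
have := schwarz_order (n := n) hpsi _ zero.
have om0 : om 0 = 0.
  have [om1 om2] := hom _ zero; apply: Pinj => //.
  by rewrite om2 AE expr0n eqn0Ngt n0 mul0r P0.
(* At 0 the average of [phi n] is its value there, and the denominator is 1. *)
have -> : psi 0 = phi n 0.
  rewrite /psi om0 phi1 divr1 /B.
  have -> : \sum_(j < n) phi n (x ^+ j * 0) = n%:R * phi n 0.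
    rewrite (eq_bigr (fun=> phi n 0)) => [|j _]; last by rewrite mulr0.
    by rewrite sumr_const card_ord mulr_natl.
  by rewrite mulrA mulVf ?mul1r.
by apply=> z hz; rewrite psiE // ltW //; case: (hom _ hz).
Qed.

Lemma geometric_le (x : R) n : 0 <= x < 1 -> \sum_(j < n) x ^+ j <= (1 - x)^-1.
Proof.
move=> /andP[x0 x1]; have q : 0 < 1 - x by rewrite subr_gt0.
rewrite -[leRHS]mul1r ler_pdivlMr //.
have -> : (\sum_(j < n) x ^+ j) * (1 - x) = 1 - x ^+ n.
  by have := subrX1 x n => E; rewrite mulrC -[1 - x]opprB mulNr -E opprB.
by rewrite lerBlDr lerDl exprn_ge0.
Qed.

Lemma geometric_deriv_le (x : R) n : 0 <= x < 1 ->
  \sum_(j < n.+1) j%:R * x ^+ j.-1 <= (1 - x)^-2.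
Proof.
move=> /andP[x0 x1]; have q : 0 < (1 - x) ^+ 2 by rewrite exprn_gt0 ?subr_gt0.
rewrite -[leRHS]mul1r ler_pdivlMr //.
have -> : (\sum_(j < n.+1) j%:R * x ^+ j.-1) * (1 - x) ^+ 2 =
    1 - n.+1%:R * x ^+ n + n%:R * x ^+ n.+1.
  elim: n => [|n IH]; first by rewrite big_ord1 !mul0r mul1r; ring.
  by rewrite big_ord_recr mulrDl IH /= -!natr1 !exprS; ring.
have xn : 0 <= x ^+ n by rewrite exprn_ge0.
have nn : 0 <= (n%:R : R) by rewrite ler0n.
rewrite -natr1 exprS; have : 0 <= n%:R * x ^+ n * (1 - x).
  by rewrite !mulr_ge0 // subr_ge0 ltW.
lra.
Qed.

Lemma pow_lip (z w : K) (rho : R) n : abs z <= rho -> abs w <= rho ->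
  abs (z ^+ n - w ^+ n) <= n%:R * rho ^+ n.-1 * abs (z - w).
Proof.
move=> hz hw; have rho0 : 0 <= rho by apply: le_trans hz; exact: abs_ge0.
elim: n => [|n IH]; first by rewrite subrr abs0 !mul0r.
have -> : z ^+ n.+1 - w ^+ n.+1 = z * (z ^+ n - w ^+ n) + w ^+ n * (z - w).
  by rewrite !exprS; ring.
apply: le_trans (absD _ _) _; rewrite !absM absX.
have h1 : abs z * abs (z ^+ n - w ^+ n) <= rho * (n%:R * rho ^+ n.-1 * abs (z - w)).
  by apply: ler_pM; rewrite ?abs_ge0.
have h2 : abs w ^+ n * abs (z - w) <= rho ^+ n * abs (z - w).
  by rewrite ler_wpM2r ?abs_ge0 // lerXn2r ?nnegrE ?abs_ge0.
apply: le_trans (lerD h1 h2) _; rewrite le_eqVlt; apply/orP; left; apply/eqP.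
by case: n {IH h1 h2} => [|n] /=; rewrite -!natr1 ?exprS; ring.
Qed.

(** The remainder is z^n phi_n(z). On a circle of radius r between rho and 1, the coefficient bound
    gives r^n |phi_n| <= max |Phi| + 1 / (1 - r); the maximum principle carries this inward, leaving
    the factor (rho / r)^n. *)
Lemma convex_tail (phi : nat -> K -> K) (rho : R) : phi 0%N = Phi ->
  (forall n, [/\ holo (phi n) 0 1, cdiff (phi n) 0 (phi n.+1 0) &
    forall z, phi n z = phi n 0 + z * phi n.+1 z]) ->
  0 <= rho < 1 -> exists M x, 0 <= x < 1 /\ forall n z, abs z <= rho ->
    abs (Phi z - \sum_(j < n) phi j 0 * z ^+ j) <= M * x ^+ n.
Proof.
move=> phi0 H /andP[rho0 rho1].
have c1 n : abs (phi n 0) <= 1.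
  case: n => [|n]; last exact: convex_coef.
  by rewrite phi0 P0 abs0.
pose r := (1 + rho) / 2; have r0 : 0 < r by rewrite /r; lra.
have r1 : r < 1 by rewrite /r; lra.
have rr : rho < r by rewrite /r; lra.
have [||z1 _ hM] := @EVT_annulus R (fun z => abs (Phi z)) 0 r r.
- by rewrite lexx ltW.
- move=> z; rewrite subr0 => /andP[_ hz] eps e0.
  have [d d0 Hd] := cdiff_cont (dP (le_lt_trans hz r1)) e0.
  exists d => // w _ /Hd h.
  have k1 := abs_lerB (Phi w) (Phi z); have k2 := abs_lerB (Phi z) (Phi w).
  by rewrite absC in k2; rewrite ltr_norml; lra.
pose M := abs (Phi z1) + (1 - r)^-1.
have E n z : Phi z - \sum_(j < n) phi j 0 * z ^+ j = z ^+ n * phi n z.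
  rewrite -phi0 (@taylor_sum phi z n); first by rewrite addrC addKr.
  by move=> m; have [_ _] := H m; exact.
exists M, (rho / r); split.
  by rewrite divr_ge0 ?(ltW r0) //= ltr_pdivrMr ?mul1r.
move=> n z hz; rewrite E absM absX.
have [hn _ _] := H n.
have hb : abs (phi n z) <= M / r ^+ n.
  apply: (max_principle_holo r1 hn); last exact: le_trans hz (ltW rr).
  move=> y hy; rewrite ler_pdivlMr ?exprn_gt0 // mulrC -hy -absX -absM -E.
  apply: le_trans (absB _ _) _; apply: lerD.
    by apply: hM; rewrite subr0 hy lexx.
  apply: le_trans (abs_sum _ _) _.
  apply: le_trans (geometric_le n (_ : 0 <= r < 1)); last by rewrite (ltW r0).
  apply: ler_sum => j _; rewrite absM absX hy -[leRHS]mul1r.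
  by rewrite ler_wpM2r ?exprn_ge0 ?(ltW r0).
rewrite expr_div_n mulrCA.
by apply: ler_pM; rewrite ?exprn_ge0 ?abs_ge0 // lerXn2r ?nnegrE ?abs_ge0.
Qed.

Theorem convex_growth z : abs z < 1 -> abs (Phi z) <= abs z / (1 - abs z).
Proof.
move=> hz; have hP : holo Phi 0 1.
  by move=> w; rewrite subr0 => hw; exists (dPhi w); exact: dP.
have [phi [phi0 H]] := taylor_ex hP.
have zI : 0 <= abs z < 1 by rewrite abs_ge0.
have [M [x [xI HM]]] := convex_tail phi0 H zI.
apply/ler_addgt0Pl => eps e0.
have [n /(_ n.+1 (leqnSn n)) hn] := geometric_small M xI e0.
have -> : Phi z = (Phi z - \sum_(j < n.+1) phi j 0 * z ^+ j) +
    \sum_(j < n.+1) phi j 0 * z ^+ j by rewrite subrK.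
apply: le_trans (absD _ _) _; apply: lerD.
  by apply: le_trans (HM _ _ (lexx _)) _; exact: ltW.
rewrite big_ord_recl phi0 P0 mul0r add0r; apply: le_trans (abs_sum _ _) _.
apply: le_trans (_ : \sum_(j < n) abs z * abs z ^+ j <= _); last first.
  by rewrite -big_distrr /= ler_wpM2l ?abs_ge0 // geometric_le.
apply: ler_sum => j _; rewrite absM absX -exprS -[leRHS]mul1r.
rewrite ler_wpM2r ?exprn_ge0 ?abs_ge0 //.
exact: convex_coef.
Qed.

(** The Taylor polynomials have Lipschitz constant at most the sum of j rho^(j - 1), hence at most
    (1 - rho)^-2, and so has their limit. *)
Lemma convex_lip z w (rho : R) : rho < 1 -> abs z <= rho -> abs w <= rho ->
  abs (Phi z - Phi w) <= (1 - rho)^-2 * abs (z - w).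
Proof.
move=> rho1 hz hw; have rho0 : 0 <= rho by apply: le_trans hz; exact: abs_ge0.
have hP : holo Phi 0 1.
  by move=> y; rewrite subr0 => hy; exists (dPhi y); exact: dP.
have [phi [phi0 H]] := taylor_ex hP.
have rI : 0 <= rho < 1 by rewrite rho0.
have [M [x [xI HM]]] := convex_tail phi0 H rI.
apply/ler_addgt0Pl => eps e0; have e20 : 0 < eps / 2 by lra.
have [n /(_ n.+1 (leqnSn n)) hn] := geometric_small M xI e20.
pose S z := \sum_(j < n.+1) phi j 0 * z ^+ j.
have -> : Phi z - Phi w = ((Phi z - S z) - (Phi w - S w)) + (S z - S w) by ring.
apply: le_trans (absD _ _) _; apply: lerD.
  apply: le_trans (absB _ _) _; have := HM n.+1 _ hz; have := HM n.+1 _ hw.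
  rewrite -/(S z) -/(S w); lra.
rewrite /S -sumrB; apply: le_trans (abs_sum _ _) _.
apply: le_trans (ler_wpM2r (abs_ge0 _) (geometric_deriv_le n rI)).
rewrite big_distrl /=; apply: ler_sum => j _; rewrite -mulrBr absM.
apply: le_trans (pow_lip j hz hw); rewrite -[leRHS]mul1r ler_wpM2r ?abs_ge0 //.
case: (nat_of_ord j) => [|m]; last exact: convex_coef.
by rewrite phi0 P0 abs0.
Qed.

(** Difference quotients are taken towards the origin along the radius, so that both points lie in
    the closed disk of radius |z| and the Lipschitz constant there is already the sharp one. *)
Theorem convex_distortion z : abs z < 1 ->
  abs (z * dPhi z) <= abs z / (1 - abs z) ^+ 2.
Proof.
move=> hz; have [->|z0] := eqVneq z 0; first by rewrite mul0r abs0 mul0r.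
have az0 : 0 < abs z by rewrite abs_gt0.
rewrite absM ler_wpM2l ?abs_ge0 //; apply/ler_addgt0Pl => eps e0.
have [d d0 Hd] := dP hz e0.
pose t := Num.min 1 (d / abs z / 2).
have dz : 0 < d / abs z by rewrite divr_gt0.
have t0 : 0 < t by rewrite lt_min ltr01 divr_gt0.
have t1 : t <= 1 by rewrite ge_min lexx.
have t2 : t * abs z < d.
  rewrite -ltr_pdivlMr //; have : t <= d / abs z / 2 by rewrite ge_min lexx orbT.
  lra.
pose w := (1 - t)%:C * z.
have wz : w - z = - (t%:C * z) by rewrite /w RC_B; ring.
have awz : abs (w - z) = t * abs z by rewrite wz absN absM absR gtr0_norm.
have hw : abs w <= abs z.
  by rewrite /w absM absR ger0_norm ?subr_ge0 // ler_piMl ?abs_ge0 //; lra.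
have h1 := convex_lip hz hw (lexx _).
have := Hd w; rewrite awz mul0r addr0 => /(_ t2) h2.
have h3 : abs (dPhi z * (w - z)) <= eps * (t * abs z) + (1 - abs z)^-2 * (t * abs z).
  have -> : dPhi z * (w - z) = (Phi w - Phi z) - (Phi w - Phi z - dPhi z * (w - z)).
    by ring.
  apply: le_trans (absB _ _) _; rewrite addrC; apply: lerD => //.
  by rewrite -awz.
move: h3; rewrite absM awz -mulrDl ler_pM2r ?mulr_gt0 //.
Qed.

End Coefficients.
End ConvexFunctions.

(** * The Bohr-type radius *)

Section OrderOfVanishing.
Variable R : realType.
Local Notation K := R[i].

(** The derivative of z^(k + 1) phi is z^k times (k + 1) phi + z phi', a cofactor that is
    holomorphic again by [holo_derivative]; hence the induction generalizes over [f] and [phi]. *)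
Lemma cderivn_pow k (f phi : K -> K) : holo phi 0 1 ->
  (forall z, abs z < 1 -> f z = z ^+ k * phi z) ->
  cderivn k f 0 = k`!%:R * phi 0.
Proof.
elim: k f phi => [|k IH] f phi hphi fE.
  rewrite /cderivn derive1n0 fact0 mul1r.
  by have := fE 0; rewrite abs0 ltr01 expr0 mul1r; exact.
have [d hd] := holo_deriv_fun hphi.
have hd' z : abs z < 1 -> cdiff phi z (d z) by move=> hz; apply: hd; rewrite subr0.
rewrite /cderivn derive1Sn -/(cderivn k _).
rewrite (IH _ (fun z => k.+1%:R * phi z + z * d z)).
- by rewrite mul0r addr0 mulrA -natrM mulnC -factS.
- move=> z; rewrite subr0 => hz.
  have z1 : 0 < 1 - abs z by rewrite subr_gt0.
  have [|l hl] := @holo_derivative _ phi d z _ z1.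
    move=> w hw; apply: hd'.
    by have := absD (w - z) z; rewrite subrK; lra.
  by eexists; exact: cdiffD (cdiffZ k.+1%:R (hd' _ hz)) (cdiffM (hdiff_id z) hl).
- move=> z hz; apply: cdiff_cderiv.
  have z1 : 0 < 1 - abs z by rewrite subr_gt0.
  apply: (hdiff_ext z1 (f := fun z => z ^+ k.+1 * phi z)) => [w hw|].
    by rewrite fE //; have := absD (w - z) z; rewrite subrK; lra.
  have h := cdiffM (cdiffX z k.+1) (hd' _ hz).
  by apply: hdiff_val h _ _ => //=; rewrite exprS; ring.
Qed.

(** Each vanishing derivative makes the current cofactor vanish at 0, by [cderivn_pow], so another z
    can be split off. *)
Lemma vanishing_order m (f : K -> K) : holo f 0 1 ->
  (forall k, (k < m)%N -> cderivn k f 0 = 0) ->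
  exists2 phi, holo phi 0 1 & forall z, f z = z ^+ m * phi z.
Proof.
move=> hf; elim: m => [|m IH] h0; first by exists f => // z; rewrite mul1r.
have [k km|phi hphi fE] := IH; first by apply: h0; exact: ltnW.
have := h0 m (ltnSn m); rewrite (cderivn_pow hphi) // => /eqP.
rewrite mulf_eq0 pnatr_eq0 eqn0Ngt fact_gt0 /= => /eqP phi0.
have [psi [hpsi psiE _]] := holo_division ltr01 hphi.
exists psi => // z; rewrite fE psiE phi0 subr0 add0r exprS; ring.
Qed.

Lemma diskE (z : C R) : disk z <-> abs z < 1.
Proof. by rewrite /disk /= normCE -[1 in X in X <-> _]/(1%:C) ltcR. Qed.

Lemma holomorphic_holo (f : C R -> C R) : holomorphic_on f (@disk R) -> holo f 0 1.
Proof.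
move=> hf z; rewrite subr0 => /diskE/hf/derivable_cdiff h.
by exists (cderiv f z).
Qed.

Lemma Bclass_bound n (w : C R -> C R) : Bclass n w ->
  forall z, abs z < 1 -> abs (w z) <= abs z ^+ n.
Proof.
move=> [hw wb w0 _] z hz.
have hh := holomorphic_holo hw.
have [phi hphi wE] := vanishing_order hh w0.
rewrite wE absM absX -[leRHS]mulr1 ler_wpM2l ?exprn_ge0 ?abs_ge0 //.
apply: (schwarz_order (n := n) hphi) hz => x hx; rewrite -wE.
by have /diskE/wb := hx; rewrite normCE -[1]/(1%:C) lecR.
Qed.

Lemma Bclass_pow n : Bclass n (fun z : C R => z ^+ n).
Proof.
have hX k : holo (fun z : K => z ^+ k) 0 1.
  by move=> z _; eexists; exact: cdiffX.
split.
- by move=> z _; exact: cdiff_derivable (cdiffX z n).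
- move=> z /diskE hz; rewrite normCE absX -[1]/(1%:C) lecR.
  by rewrite exprn_ile1 ?abs_ge0 // ltW.
(* Split off z^k: for k < n the cofactor z^(n - k) vanishes at 0. *)
- move=> k kn; rewrite (cderivn_pow (hX (n - k)%N)) => [|z _].
    by rewrite expr0n subn_eq0 leqNgt kn mulr0.
  by rewrite -exprD subnKC // ltnW.
- rewrite (cderivn_pow (hX 0%N)) => [|z _]; last by rewrite expr0 mulr1.
  by rewrite expr0 mulr1 pnatr_eq0 -lt0n fact_gt0.
Qed.

End OrderOfVanishing.

(** * Bounds for stable convex mappings, and the equation of the radius *)

Section Bounds.
Variable R : realType.
Local Notation K := R[i].

Lemma align (x y : K) : exists2 l, abs l = 1 & abs (x + l * y) = abs x + abs y.
Proof.
have [k1 [h1 E1]] := phase_ex x; have [k2 [h2 E2]] := phase_ex y.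
have kk : k1^* * k1 = 1 by rewrite mulrC mulcJ_abs h1 expr1n.
exists (k1^* * k2); first by rewrite absM absJ h1 h2 mulr1.
have -> : x + k1^* * k2 * y = k1^* * (k1 * x + k2 * y).
  by rewrite mulrDr !mulrA kk mul1r.
by rewrite absM absJ h1 mul1r E1 E2 -RC_D absR ger0_norm // addr_ge0 ?abs_ge0.
Qed.

Lemma jac_lt (x y : C R) : 0 < `|x| ^+ 2 - `|y| ^+ 2 -> abs y < abs x.
Proof.
have -> : `|x| ^+ 2 - `|y| ^+ 2 = (abs x ^+ 2 - abs y ^+ 2)%:C.
  by rewrite normXE normXE RC_B.
by rewrite ltcR subr_gt0 ltr_pXn2r ?nnegrE ?abs_ge0.
Qed.

(** The analytic bounds hold for every unimodular [l]; the aligning [l] depends on the point and on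
    which of the two sums is estimated. *)
Lemma stable_bounds (h g dh dg : K -> K) :
  (forall z, abs z < 1 -> cdiff h z (dh z)) ->
  (forall z, abs z < 1 -> cdiff g z (dg z)) ->
  (forall z, abs z < 1 -> abs (dg z) < abs (dh z)) ->
  h 0 = 0 -> g 0 = 0 -> dh 0 = 1 -> dg 0 = 0 ->
  (forall mu, abs mu = 1 -> forall z w, abs z < 1 -> abs w < 1 ->
    h z + mu * (g z)^* = h w + mu * (g w)^* -> z = w) ->
  (forall mu, abs mu = 1 -> forall z w, abs z < 1 -> abs w < 1 ->
    forall t : R, 0 <= t <= 1 -> exists2 x, abs x < 1 & h x + mu * (g x)^* =
      h z + mu * (g z)^* + t%:C * (h w + mu * (g w)^* - (h z + mu * (g z)^*))) ->
  forall z, abs z < 1 ->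
    abs (h z) + abs (g z) <= abs z / (1 - abs z) /\
    abs (z * dh z) + abs (z * dg z) <= abs z / (1 - abs z) ^+ 2.
Proof.
move=> hd gd sense h0 g0 dh0 dg0 Tinj Tconv.
have key l z : abs l = 1 -> abs z < 1 ->
    abs (h z + l * g z) <= abs z / (1 - abs z) /\
    abs (z * (dh z + l * dg z)) <= abs z / (1 - abs z) ^+ 2.
  move=> l1 hz.
  have dP x : abs x < 1 -> cdiff (fun y => h y + l * g y) x (dh x + l * dg x).
    by move=> hx; exact: cdiffD (hd _ hx) (cdiffZ l (gd _ hx)).
  have P0 : h 0 + l * g 0 = 0 by rewrite h0 g0 mulr0 addr0.
  have dP0 : dh 0 + l * dg 0 = 1 by rewrite dh0 dg0 mulr0 addr0.
  have dPn0 x : abs x < 1 -> dh x + l * dg x != 0.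
    move=> /sense hx; rewrite -abs_gt0.
    have := abs_lerB (dh x) (- (l * dg x)).
    by rewrite opprK absN absM l1 mul1r; lra.
  have inj := stable_analytic_inj hd gd sense Tinj Tconv l1.
  have conv := stable_analytic_convex hd gd sense Tinj Tconv l1.
  split; first exact: (convex_growth dP P0 dP0 dPn0 inj conv).
  exact: (convex_distortion dP P0 dP0 dPn0 inj conv).
move=> z hz; split.
  have [l l1 <-] := align (h z) (g z); exact: (key l z l1 hz).1.
have [l l1 E] := align (dh z) (dg z).
rewrite !absM -mulrDr -E -absM; exact: (key l z l1 hz).2.
Qed.

Lemma stable_convex_bounds (h g : C R -> C R) : SH0 h g -> stable_convex h g ->
  forall z, abs z < 1 ->
    abs (h z) + abs (g z) <= abs z / (1 - abs z) /\
    abs (z * cderiv h z) + abs (z * cderiv g z) <= abs z / (1 - abs z) ^+ 2.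
Proof.
move=> [[hh hg] [h0 dh0] [g0 dg0] _ jac] stab.
apply: stable_bounds => //.
- by move=> z /diskE/hh; exact: derivable_cdiff.
- by move=> z /diskE/hg; exact: derivable_cdiff.
- by move=> z /diskE/jac/jac_lt.
- move=> mu mu1 z w /diskE hz /diskE hw.
  have [|inj _] := stab mu; first by rewrite normCE mu1.
  exact: inj.
move=> mu mu1 z w /diskE hz /diskE hw t tI.
have [|_ conv] := stab mu; first by rewrite normCE mu1.
have [||x /diskE hx E] := conv (harm_mu mu h g z) (harm_mu mu h g w) _ _ t tI.
- by exists z.
- by exists w.
exists x => //; transitivity (harm_mu mu h g x) => //; rewrite E.
rewrite -[h z + _]/(harm_mu mu h g z) -[h w + _]/(harm_mu mu h g w); ring.
Qed.

Lemma ratio_lt (a b : R) k : 0 <= a -> a < b -> b < 1 ->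
  a / (1 - a) ^+ k < b / (1 - b) ^+ k.
Proof.
move=> a0 ab b1; have qa : 0 < 1 - a by lra.
have qb : 0 < 1 - b by lra.
apply: (@lt_le_trans _ _ (b / (1 - a) ^+ k)).
  by rewrite ltr_pM2r // invr_gt0 exprn_gt0.
rewrite ler_wpM2l //; first by lra.
by rewrite lef_pV2 ?posrE ?exprn_gt0 // lerXn2r ?nnegrE; lra.
Qed.

Lemma ratio_le (a b : R) k : 0 <= a -> a <= b -> b < 1 ->
  a / (1 - a) ^+ k <= b / (1 - b) ^+ k.
Proof.
by move=> a0; rewrite le_eqVlt => /predU1P[->//|ab] b1; apply/ltW/ratio_lt.
Qed.

(** The exponent 1 makes the second quotient, too, an instance of [ratio_lt]. *)
Lemma rad_funE (s m p q : nat) (r : R) : rad_fun s m p q r =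
  (r ^+ m / (1 - r ^+ m) ^+ 2) ^+ s + (r ^+ q / (1 - r ^+ q) ^+ 1) ^+ p - 1.
Proof.
by rewrite /rad_fun expr1; congr (_ + _ - 1); rewrite expr_div_n -!exprM (mulnC s m).
Qed.

(** Serves twice: for uniqueness of the root and for failure of the inequality beyond it. *)
Lemma rad_fun_lt (s m p q : nat) (x y : R) :
  (0 < s)%N -> (0 < m)%N -> (0 < p)%N -> (0 < q)%N ->
  0 <= x -> x < y -> y < 1 -> rad_fun s m p q x < rad_fun s m p q y.
Proof.
move=> s0 m0 p0 q0 x0 xy y1; rewrite !rad_funE ltrD2r.
have y0 : 0 <= y by apply: le_trans x0 (ltW xy).
have x1 := lt_trans xy y1.
have P n : (0 < n)%N -> [/\ 0 <= x ^+ n, x ^+ n < y ^+ n & y ^+ n < 1].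
  by move=> n0; rewrite exprn_ge0 // ltrXn2r // exprn_ilt1 // -lt0n n0.
have [xm xym ym] := P _ m0; have [xq xyq yq] := P _ q0.
have nn a k : 0 <= a -> a < 1 -> 0 <= a / (1 - a) ^+ k :> R.
  by move=> a0 a1; rewrite divr_ge0 // exprn_ge0 // subr_ge0 ltW.
apply: ltrD.
  by rewrite ltrXn2r -?lt0n ?ratio_lt // nn // (lt_trans xym ym).
by rewrite ltrXn2r -?lt0n ?ratio_lt // nn // (lt_trans xyq yq).
Qed.

Lemma rad_fun_root (s m p q : nat) :
  (0 < s)%N -> (0 < m)%N -> (0 < p)%N -> (0 < q)%N ->
  exists2 r0 : R, 0 < r0 < 1 & rad_fun s m p q r0 = 0.
Proof.
(* The function blows up at 1, so an endpoint below 1 is needed: for this [b], Bernoulli gives b^q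
   >= 1/2, so the second term alone is at least 1. *)
move=> s0 m0 p0 q0; pose b : R := 1 - (2 * q%:R)^-1.
have q1 : 1 <= (q%:R : R) by rewrite ler1n.
have qi0 : 0 < (2 * q%:R : R)^-1 by rewrite invr_gt0; lra.
have qi1 : (2 * q%:R : R)^-1 < 1 by rewrite invf_lt1; lra.
have b0 : 0 < b by rewrite /b; lra.
have b1 : b < 1 by rewrite /b; lra.
have n0 : - 1 = rad_fun s m p q (0 : R).
  rewrite /rad_fun !expr0n muln_eq0 !eqn0Ngt s0 m0 q0 /= !mul0r.
  by rewrite expr0n eqn0Ngt p0 addr0 add0r.
have bq : 1 / 2 <= b ^+ q.
  apply: le_trans (bernoulli q (_ : 0 <= (2 * q%:R)^-1 <= 1)); last by lra.
  have -> : q%:R * (2 * q%:R)^-1 = 1 / 2 :> R by field; lra.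
  lra.
have bq1 : b ^+ q < 1 by rewrite exprn_ilt1 ?ltW // -lt0n.
have bm1 : b ^+ m < 1 by rewrite exprn_ilt1 ?ltW // -lt0n.
have hb : 0 <= rad_fun s m p q b.
  rewrite /rad_fun subr_ge0 -[leLHS]add0r; apply: lerD.
    apply: divr_ge0; apply: exprn_ge0; first exact: ltW.
    by rewrite subr_ge0 ltW.
  rewrite exprn_ege1 // ler_pdivlMr ?subr_gt0 //; lra.
have [||c cI hc] := @IVT R (rad_fun s m p q) 0 b 0 (ltW b0).
- apply: continuous_in_subspaceT => x; rewrite inE /= in_itv /= => /andP[x0 xb].
  have x1 := le_lt_trans xb b1.
  have nz n : (0 < n)%N -> 1 - x ^+ n != 0.
    by move=> n_gt0; rewrite subr_eq0 eq_sym lt_eqF // exprn_ilt1 // -lt0n.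
  have cX (n : nat) (u : R -> R) : {for x, continuous u} ->
      {for x, continuous (fun y => u y ^+ n)}.
    by move=> hu; exact: (continuous_comp hu (@exprn_continuous R n (u x))).
  have cB (u v : R -> R) : {for x, continuous u} -> {for x, continuous v} ->
      {for x, continuous (fun y => u y - v y)} by move=> hu hv; exact: continuousB.
  have cF (u v : R -> R) : v x != 0 -> {for x, continuous u} ->
      {for x, continuous v} -> {for x, continuous (fun y => u y / v y)}.
    by move=> v0 hu hv; exact: (continuousM hu (continuousV v0 hv)).
  have cid : {for x, continuous (fun y : R => y)} by exact: cvg_id.
  have cst1 : {for x, continuous (fun _ : R => 1 : R)} by exact: cvg_cst.
  have c1 := cF _ _ (expf_neq0 (2 * s) (nz _ m0)) (cX (s * m)%N _ cid)
    (cX (2 * s)%N _ (cB _ _ cst1 (cX m _ cid))).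
  have c2 := cX p _ (cF _ _ (nz _ q0) (cX q _ cid) (cB _ _ cst1 (cX q _ cid))).
  exact: (cB _ _ (continuousD c1 c2) cst1).
- rewrite -n0 min_l ?max_r ?hb ?andbT //; lra.
exists c => //; move: cI; rewrite /= in_itv /= => /andP[c0 cb].
rewrite (le_lt_trans cb b1) andbT lt_neqAle c0 andbT; apply/eqP => c00.
by move: hc; rewrite -c00 -n0 => /eqP; rewrite oppr_eq0 oner_eq0.
Qed.

End Bounds.

(** * The extremal half-plane map *)

Section HalfPlaneMap.
Variable R : realType.
Local Notation K := R[i].

Definition hp (z : C R) : C R := z / (1 - z).

Lemma sub1_neq0 (z : K) : abs z < 1 -> 1 - z != 0.
Proof.
move=> hz; rewrite subr_eq0; apply/eqP => h.
by move: hz; rewrite -h abs1 ltxx.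
Qed.

Lemma cdiff_hp (z : K) : abs z < 1 -> cdiff hp z ((1 - z) ^- 2).
Proof.
move=> /sub1_neq0 hz.
have h := cdiff_div (hdiff_id z) (cdiffB (hdiff_cst 1 z) (hdiff_id z)) hz.
by apply: hdiff_val h _ _ => //; field.
Qed.

Lemma hp_inj (z w : K) : abs z < 1 -> abs w < 1 -> hp z = hp w -> z = w.
Proof.
move=> /sub1_neq0 hz /sub1_neq0 hw; rewrite /hp => /eqP.
rewrite eqr_div // !mulrBr !mulr1 [w * z]mulrC.
by rewrite (inj_eq (addIr _)) => /eqP.
Qed.

(** Both sides say |c| < |c + 1|, since c / (c + 1) inverts the map. *)
Lemma hp_image (c : K) : (exists2 z, abs z < 1 & hp z = c) <-> 0 < 1 + 2 * re c.
Proof.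
have E : abs (c + 1) ^+ 2 = abs c ^+ 2 + (1 + 2 * re c).
  by rewrite !abs_sqr reD imD /re /im /=; ring.
split=> [[z hz zc]|c0].
  have h1 := sub1_neq0 hz.
  have c1 : c + 1 != 0.
    have -> : c + 1 = (1 - z)^-1 by rewrite -zc /hp; field.
    by rewrite invr_eq0.
  have ac : abs c = abs z * abs (c + 1).
    by rewrite -absM; congr abs; rewrite -zc /hp; field.
  have c10 : 0 < abs (c + 1) by rewrite abs_gt0.
  have : abs c ^+ 2 < abs (c + 1) ^+ 2.
    by rewrite ltr_pXn2r ?nnegrE ?abs_ge0 // ac gtr_pMl.
  by rewrite E; lra.
have c1 : c + 1 != 0.
  rewrite -abs_gt0 lt_def abs_ge0 andbT; apply/eqP => h.
  by move: E; rewrite h expr0n /=; have := sqr_ge0 (abs c); lra.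
exists (c / (c + 1)); last by rewrite /hp; field; rewrite c1 /= addrAC subrr add0r oner_eq0.
rewrite absM absV ltr_pdivrMr ?abs_gt0 // mul1r.
by rewrite -(@ltr_pXn2r _ 2) ?nnegrE ?abs_ge0 // E ltrDl.
Qed.

Let zero : C R -> C R := fun=> 0.

Lemma cderiv_zero z : cderiv zero z = 0.
Proof. by apply: cdiff_cderiv; exact: hdiff_cst. Qed.

Lemma harm_mu_hp mu : harm_mu mu hp zero = hp.
Proof. by apply/funext => z; rewrite /harm_mu /zero rmorph0 mulr0 addr0. Qed.

Lemma SH0_hp : SH0 hp zero.
Proof.
split.
- split=> z /diskE hz; first exact: cdiff_derivable (cdiff_hp hz).
  exact: cdiff_derivable (hdiff_cst 0 z).
- split; first by rewrite /hp mul0r.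
  rewrite (cdiff_cderiv (cdiff_hp _)) ?abs0 //.
  by rewrite subr0 expr1n invr1.
- by split=> //; exact: cderiv_zero.
- by rewrite /harm harm_mu_hp => z w /diskE hz /diskE hw; exact: hp_inj.
- move=> z /diskE hz; rewrite cderiv_zero (cdiff_cderiv (cdiff_hp hz)).
  by rewrite normr0 expr0n subr0 exprn_gt0 // normr_gt0 invr_eq0 expf_neq0 // sub1_neq0.
Qed.

Lemma stable_convex_hp : stable_convex hp zero.
Proof.
move=> mu _; rewrite harm_mu_hp; split.
  by move=> z w /diskE hz /diskE hw; exact: hp_inj.
have im (c : K) : (hp @` (@disk R))%classic c <-> 0 < 1 + 2 * re c.
  rewrite -hp_image; split=> [[z /diskE]|[z hz]]; first by exists z.
  by exists z => //; apply/diskE.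
move=> a b /im ha /im hb t /andP[t0 t1]; apply/im.
have -> : re ((1 - t%:C) * a + t%:C * b) = (1 - t) * re a + t * re b.
  by rewrite mulrBl mul1r reD reB !reRM; ring.
have : 0 <= (1 - t) * (1 + 2 * re a) by rewrite mulr_ge0 ?subr_ge0 // ltW.
have [->|tn] := eqVneq t 0; first by lra.
have : 0 < t * (1 + 2 * re b) by rewrite mulr_gt0 // lt_def tn.
lra.
Qed.

(** At positive real points the half-plane map attains the growth and distortion bounds; as g = 0,
    both operators take the same value. *)
Lemma hp_values (r : R) m q : 0 < r < 1 -> (0 < m)%N -> (0 < q)%N ->
  let z : C R := r%:C in
  [/\ `|Dop hp zero (z ^+ m)| = (r ^+ m / (1 - r ^+ m) ^+ 2)%:C,
      `|Dscr hp zero (z ^+ m)| = (r ^+ m / (1 - r ^+ m) ^+ 2)%:C &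
      `|harm hp zero (z ^+ q)| = (r ^+ q / (1 - r ^+ q))%:C].
Proof.
move=> /andP[r0 r1] m0 q0 z.
have zE n : z ^+ n = (r ^+ n)%:C by rewrite RC_X.
have rn n : (0 < n)%N -> 0 < r ^+ n < 1.
  by move=> n0; rewrite exprn_gt0 // exprn_ilt1 ?ltW // -lt0n.
have /andP[m1 m2] := rn _ m0; have /andP[q1 q2] := rn _ q0.
have zm : abs (z ^+ m) < 1 by rewrite zE absR gtr0_norm.
have Dh : z ^+ m * cderiv hp (z ^+ m) = (r ^+ m / (1 - r ^+ m) ^+ 2)%:C.
  by rewrite (cdiff_cderiv (cdiff_hp zm)) zE RC_M RC_V [((1 - r ^+ m) ^+ 2)%:C]RC_X RC_B.
have pos : 0 <= r ^+ m / (1 - r ^+ m) ^+ 2.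
  by rewrite divr_ge0 ?exprn_ge0 ?subr_ge0 // ltW.
have posq : 0 <= r ^+ q / (1 - r ^+ q) by rewrite divr_ge0 ?subr_ge0 // ltW.
split.
- by rewrite /Dop cderiv_zero mulr0 rmorph0 subr0 Dh normCE absR ger0_norm.
- by rewrite /Dscr cderiv_zero mulr0 rmorph0 addr0 Dh normCE absR ger0_norm.
- rewrite /harm harm_mu_hp /hp zE normCE -[1]/(1%:C) -RC_B -RC_V -RC_M.
  by rewrite absR ger0_norm.
Qed.

End HalfPlaneMap.

Theorem theorem3p4 (R : realType) (s m p q : nat) :
  (0 < s)%N -> (0 < m)%N -> (0 < p)%N -> (0 < q)%N ->
  exists r0 : R,
  [/\ 0 < r0 < 1,
      rad_fun s m p q r0 = 0,
      (forall r : R, 0 < r < 1 -> rad_fun s m p q r = 0 -> r = r0),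
      (forall (h g wm wq : C R -> C R),
         SH0 h g -> stable_convex h g -> Bclass m wm -> Bclass q wq ->
         forall z : C R, `|z| <= r0%:C ->
           `|Dop h g (wm z)| ^+ s + `|harm h g (wq z)| ^+ p <= 1 /\
           `|Dscr h g (wm z)| ^+ s + `|harm h g (wq z)| ^+ p <= 1) &
      (forall r : R, r0 < r < 1 ->
         (exists (h g wm wq : C R -> C R) (z : C R),
            [/\ SH0 h g, stable_convex h g, Bclass m wm /\ Bclass q wq,
                `|z| = r%:C &
                1 < `|Dop h g (wm z)| ^+ s + `|harm h g (wq z)| ^+ p]) /\
         (exists (h g wm wq : C R -> C R) (z : C R),
            [/\ SH0 h g, stable_convex h g, Bclass m wm /\ Bclass q wq,
                `|z| = r%:C &
                1 < `|Dscr h g (wm z)| ^+ s + `|harm h g (wq z)| ^+ p]))].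
Proof.
move=> s0 m0 p0 q0; have [r0 /andP[r00 r01] rad0] := rad_fun_root R s0 m0 p0 q0.
exists r0; split=> //; first by rewrite r00.
- move=> r /andP[rp r1] radr; have [lt|gt|//] := ltgtP r r0.
    by have := rad_fun_lt s0 m0 p0 q0 (ltW rp) lt r01; rewrite radr rad0 ltxx.
  by have := rad_fun_lt s0 m0 p0 q0 (ltW r00) gt r1; rewrite radr rad0 ltxx.
- move=> h g wm wq hS hsc hm hq z; rewrite normCE lecR => hz.
  have z1 := le_lt_trans hz r01.
  have bound n w : (0 < n)%N -> Bclass n w -> abs (w z) <= r0 ^+ n /\ r0 ^+ n < 1.
    move=> n0 hw; split; last by rewrite exprn_ilt1 ?ltW // -lt0n.
    apply: le_trans (Bclass_bound hw z1) _.
    by rewrite lerXn2r ?nnegrE ?abs_ge0 // ltW.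
  have [m1 m2] := bound _ _ m0 hm; have [q1 q2] := bound _ _ q0 hq.
  have [_ D1] := stable_convex_bounds hS hsc (le_lt_trans m1 m2).
  have [D2 _] := stable_convex_bounds hS hsc (le_lt_trans q1 q2).
  (* Both operators obey the same triangle inequality, so one estimate serves for either sign. *)
  have main (D F : C R) :
      abs D <= abs (wm z * cderiv h (wm z)) + abs (wm z * cderiv g (wm z)) ->
      abs F <= abs (h (wq z)) + abs (g (wq z)) -> `|D| ^+ s + `|F| ^+ p <= 1.
    move=> hD hF; rewrite !normXE -RC_D -[1]/(1%:C) lecR.
    (* Here 0 is read as the value of [rad_fun] at [r0], and the two powers are compared term by
       term. *)
    rewrite -subr_le0 -rad0 rad_funE lerD2r; apply: lerD.
      rewrite lerXn2r ?nnegrE ?abs_ge0 //.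
        by rewrite divr_ge0 ?exprn_ge0 ?subr_ge0 // ltW.
      apply: le_trans hD _; apply: le_trans D1 _.
      by apply: ratio_le; rewrite ?abs_ge0.
    rewrite lerXn2r ?nnegrE ?abs_ge0 //.
      by rewrite divr_ge0 ?exprn_ge0 ?subr_ge0 // ltW.
    apply: le_trans hF _; apply: le_trans D2 _; rewrite -[1 - abs _]expr1.
    by apply: ratio_le; rewrite ?abs_ge0.
  have hF : abs (harm h g (wq z)) <= abs (h (wq z)) + abs (g (wq z)).
    by apply: le_trans (absD _ _) _; rewrite mul1r absJ.
  split; apply: main => //.
    by apply: le_trans (absB _ _) _; rewrite absJ.
  by apply: le_trans (absD _ _) _; rewrite absJ.
move=> r /andP[r0r r1]; have r0' := lt_trans r00 r0r.
have rI : 0 < r < 1 by rewrite r0'.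
have [v1 v2 v3] := hp_values rI m0 q0.
(* Strict monotonicity makes [rad_fun] positive beyond its root. *)
have rad : 1 < (r ^+ m / (1 - r ^+ m) ^+ 2)%:C ^+ s + (r ^+ q / (1 - r ^+ q))%:C ^+ p :> C R.
  rewrite -!RC_X -RC_D -[1]/(1%:C) ltcR -subr_gt0.
  have := rad_fun_lt s0 m0 p0 q0 (ltW r00) r0r r1.
  by rewrite rad0 rad_funE expr1.
have nr : `|r%:C : C R| = r%:C by rewrite normCE absR gtr0_norm.
split.
- exists (@hp R), (fun=> 0), (fun z => z ^+ m), (fun z => z ^+ q), r%:C.
  split=> //; [exact: SH0_hp|exact: stable_convex_hp| | ].
    by split; exact: Bclass_pow.
  by rewrite v1 v3.
- exists (@hp R), (fun=> 0), (fun z => z ^+ m), (fun z => z ^+ q), r%:C.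
  split=> //; [exact: SH0_hp|exact: stable_convex_hp| | ].
    by split; exact: Bclass_pow.
  by rewrite v2 v3.
Qed.
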